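(* Let $\zeta$ be a primitive non-periodic substitution on the two symbols $\{0,1\}$, let $\theta$ be the Perron-Frobenius eigenvalue of its substitution matrix $\mathsf{S}_\zeta$, and suppose that $\mathsf{S}_\zeta^{\mathsf{T}}$ is irreducible over $\mathbb{Q}$. Then any one of the following conditions implies that the substitution $\mathbb{Z}$-action has pure singular spectrum: (i) $\mathsf{S}_\zeta^{\mathsf{T}}=\begin{pmatrix}A&B\\C&D\end{pmatrix}$ with $A,B,C,D>0$ and $\theta>2\min\{A+C,\,B+D\}$; (ii) $\mathsf{S}_\zeta^{\mathsf{T}}=\begin{pmatrix}A&B\\C&0\end{pmatrix}$ with $A,B,C>0$ and $B<A+C$; (iii) $\zeta(0)=0^A1^B$ and $\zeta(1)=1^C0^D$ with $A,B,C,D>0$, and $\theta>6$.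
   Context: Let $\mathcal{A}=\{0,1\}$ and let $\mathcal{A}^+$ be the set of nonempty finite words over $\mathcal{A}$. A substitution is a map $\zeta:\mathcal{A}\to\mathcal{A}^+$, extended to words by concatenation. Its substitution matrix $\mathsf{S}_\zeta$ is the $2\times2$ nonnegative integer matrix with $\mathsf{S}_\zeta(i,j)$ equal to the number of symbols $i$ in $\zeta(j)$ (rows and columns indexed by $0,1$); thus row $i$ of $\mathsf{S}_\zeta^{\mathsf{T}}$ lists the numbers of $0$'s and of $1$'s in $\zeta(i)$. $\zeta$ is primitive if some power of $\mathsf{S}_\zeta$ has all entries strictly positive. An integer matrix is irreducible over $\mathbb{Q}$ if its characteristic polynomial is irreducible over $\mathbb{Q}$. The word $a^k$ is the letter $a$ repeated $k$ times. The substitution space $X_\zeta$ is the set of bi-infinite sequences $x\in\mathcal{A}^{\mathbb{Z}}$ such that every finite word occurring in $x$ is a subword of $\zeta^n(a)$ for some $a\in\mathcal{A}$ and $n\in\mathbb{N}$; a primitive $\zeta$ is non-periodic if and only if $X_\zeta$ is infinite. The substitution dynamical system, or substitution $\mathbb{Z}$-action, is the left shift $T$ on $X_\zeta$; for primitive $\zeta$ it is uniquely ergodic, and it is considered with its unique invariant probability measure $\mu$. The $\mathbb{Z}$-action has pure singular spectrum if for every $f\in L^2(X_\zeta,\mu)$ the spectral measure $\sigma_f$ (the positive measure on the circle $\mathbb{R}/\mathbb{Z}$ with $\int e^{2\pi i k\omega}\,d\sigma_f(\omega)=\langle f\circ T^k,f\rangle$ for all $k\in\mathbb{Z}$) is singular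 with respect to Lebesgue measure. *)

(* Defs.v *)
From HB Require Import structures.
From mathcomp Require Export all_boot all_order all_algebra.
From mathcomp Require Export complex.
From mathcomp Require Export all_classical all_reals all_analysis.
Export Order.TTheory GRing.Theory Num.Theory.
Export numFieldNormedType.Exports.

Set Implicit Arguments.
Unset Strict Implicit.
Unset Printing Implicit Defensive.

Local Open Scope classical_set_scope.
Local Open Scope ring_scope.

Notation letter := 'I_2.
HB.instance Definition _ := isPointed.Build 'I_2 ord0.

Definition l0 : letter := ord0.
Definition l1 : letter := ord_max.

Record substitution := Substitution {
  subst_fun :> letter -> seq letter ;
  subst_neq0 : forall a, subst_fun a != [::] }.

Definition subst_word (zeta : substitution) (w : seq letter) : seq letter :=
  flatten (map zeta w).

Definition subst_matrix (zeta : substitution) : 'M[int]_2 :=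
  \matrix_(i, j) (count_mem i (zeta j))%:Z.

Definition primitive_subst (zeta : substitution) : Prop :=
  exists n : nat, forall i j, 0 < (subst_matrix zeta ^+ n) i j.

Definition irreducible_over_rat n (M : 'M[int]_n) : Prop :=
  irreducible_poly (char_poly (map_mx intr M : 'M[rat]_n)).

(* A Perron-Frobenius eigenvalue is a positive eigenvalue that exceeds in
   modulus every other complex eigenvalue; for a primitive nonnegative matrix
   there is exactly one. *)
Definition perron_frobenius_eigenvalue (R : realType) n (M : 'M[int]_n)
    (theta : R) : Prop :=
  [/\ 0 < theta,
      eigenvalue (map_mx intr M : 'M[R]_n) theta &
      forall z : R[i], eigenvalue (map_mx intr M : 'M[R[i]]_n) z ->
        z != theta%:C%C -> `|z| < theta%:C%C].

Definition factor_at (x : int -> letter) (i : int) (n : nat) : seq letter :=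
  [seq x (i + k%:Z) | k <- iota 0 n].

Definition subst_space (zeta : substitution) : set (int -> letter) :=
  [set x | forall (i : int) (n : nat), exists (a : letter) (m : nat),
     infix (factor_at x i n) (iter m (subst_word zeta) [:: a])].

(* For primitive substitutions non-periodicity amounts to infinitude of the
   substitution space, and this is taken as the definition. *)
Definition non_periodic (zeta : substitution) : Prop :=
  infinite_set (subst_space zeta).

(* The product sigma-algebra on the full two-sided shift, which is also its
   Borel sigma-algebra. *)
Definition coordinate_sets : set (set (int -> letter)) :=
  [set C | exists (n : int) (a : letter), C = [set x | x n = a]].

Notation full_shift := (g_sigma_algebraType coordinate_sets).

Definition shift_pow (k : int) (x : full_shift) : full_shift :=
  fun n => x (n + k).

Definition shift : full_shift -> full_shift := shift_pow 1.

Definition shift_invariant (R : realType) (mu : probability full_shift R) :=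
  forall B : set full_shift, measurable B -> mu (shift @^-1` B) = mu B.

(* The invariant probability measure of the subshift [subst_space zeta], seen as
   a measure on the full shift carried by [subst_space zeta]. *)
Definition invariant_probability (R : realType) (zeta : substitution)
    (mu : probability full_shift R) : Prop :=
  mu (subst_space zeta) = 1%E /\ shift_invariant mu.

Section ComplexIntegration.
Context d (T : measurableType d) (R : realType).
Variable mu : {measure set T -> \bar R}.

Definition cintegral (D : set T) (f : T -> R[i]) : R[i] :=
  Complex (\int[mu]_(x in D) complex.Re (f x))
          (\int[mu]_(x in D) complex.Im (f x)).

Definition cmeasurable (f : T -> R[i]) : Prop :=
  measurable_fun [set: T] (fun x => complex.Re (f x)) /\
  measurable_fun [set: T] (fun x => complex.Im (f x)).

Definition square_integrable (f : T -> R[i]) : Prop :=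
  cmeasurable f /\
  (\int[mu]_x (complex.Re (f x) ^+ 2 + complex.Im (f x) ^+ 2)%:E < +oo)%E.

Definition cinner (f g : T -> R[i]) : R[i] :=
  cintegral [set: T] (fun x => f x * (g x)^*%C).

End ComplexIntegration.

Definition mutually_singular d (T : measurableType d) (R : realType)
    (mu nu : set T -> \bar R) : Prop :=
  exists N : set T, [/\ measurable N, mu N = 0%E & nu (~` N) = 0%E].

(* The value e^{2 pi i t}. *)
Definition circle_exp (R : realType) (t : R) : R[i] :=
  Complex (cos (2 * pi * t)) (sin (2 * pi * t)).

(* The circle R/Z is represented by its fundamental domain [0, 1): a measure on
   the circle is a Borel measure on R carried by [0, 1). *)
Definition circle_measure (R : realType)
    (sigma : {finite_measure set (measurableTypeR R) -> \bar R}) : Prop :=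
  sigma (~` `[0%R, 1%R[) = 0%E.

Definition is_spectral_measure (R : realType) (mu : probability full_shift R)
    (f : full_shift -> R[i])
    (sigma : {finite_measure set (measurableTypeR R) -> \bar R}) : Prop :=
  circle_measure sigma /\
  forall k : int,
    cintegral sigma `[0%R, 1%R[ (fun omega => circle_exp (k%:~R * omega))
      = cinner mu (f \o shift_pow k) f.

Definition pure_singular_spectrum (R : realType)
    (mu : probability full_shift R) : Prop :=
  forall f : full_shift -> R[i], square_integrable mu f ->
  forall sigma : {finite_measure set (measurableTypeR R) -> \bar R},
    is_spectral_measure mu f sigma ->
    mutually_singular sigma (@lebesgue_measure R).

Definition matrix22 (a b c d : nat) : 'M[int]_2 :=
  \matrix_(i, j) if i == l0 then (if j == l0 then a%:Z else b%:Z)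
                 else (if j == l0 then c%:Z else d%:Z).

Definition large_min_condition (R : realType) (zeta : substitution) (theta : R)
    : Prop :=
  exists A B C D : nat,
    [/\ [/\ (0 < A)%N, (0 < B)%N, (0 < C)%N & (0 < D)%N],
        (subst_matrix zeta)^T = matrix22 A B C D &
        2 * (minn (A + C) (B + D))%:R < theta].

Definition zero_entry_condition (zeta : substitution) : Prop :=
  exists A B C : nat,
    [/\ [/\ (0 < A)%N, (0 < B)%N & (0 < C)%N],
        (subst_matrix zeta)^T = matrix22 A B C 0 &
        (B < A + C)%N].

Definition block_condition (R : realType) (zeta : substitution) (theta : R)
    : Prop :=
  exists A B C D : nat,
    [/\ [/\ (0 < A)%N, (0 < B)%N, (0 < C)%N & (0 < D)%N],
        zeta l0 = nseq A l0 ++ nseq B l1,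
        zeta l1 = nseq C l1 ++ nseq D l0 &
        6 < theta].

(* Main.v *)
(* Approximate f by a function g of finitely many coordinates.  The sums of g
   along the words zeta^n(b), twisted by the frequency w, evolve under the
   spectral cocycle: the 2x2 matrix of the twisted letter counts of zeta(0) and
   zeta(1) at the phases exp(-2 pi i w |zeta^n(b)|).  In dimension 2 its growth is
   governed by its determinant alone, because the vector of the numbers
   1 - exp(-2 pi i w |zeta^n(b)|) is another orbit of the cocycle.  For almost
   every w the pairs of phases equidistribute on the torus (this uses the
   irreducibility of the substitution matrix), so the geometric mean of the
   determinants is bounded by a Mahler measure, and each of the conditions
   (i)-(iii) makes the latter smaller than the square root of theta.  Hence the
   twisted sums of g over N letters are o(sqrt N) for almost every w.

   By Parseval and Tonelli, the error f - g contributes little to the mean square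
   of the twisted sums of f, except for a small set of frequencies w.  That mean
   square is the integral of the Fejer kernel F_N(w - .) against the spectral
   measure sigma, so this integral is small for w in a set A of almost full
   Lebesgue measure.  Integrating F_N over A instead gives a function whose
   sigma-integral is small and which is close to 1 in Lebesgue mean, and its
   superlevel sets separate sigma from the Lebesgue measure. *)
Require Import Defs.
From mathcomp Require Import ring lra zify measurable_realfun.
Set Implicit Arguments.
Unset Strict Implicit.
Unset Printing Implicit Defensive.
Local Open Scope classical_set_scope.
Local Open Scope ring_scope.

(** The determinant controls only the area spanned by the two orbits, and recovering the vector [V]
    from it means dividing by [1 - w]. By a Borel-Cantelli argument, for almost every frequency this
    number is at least a constant over [j.+1 ^+ 2] at level [j], so the division costs only
    polynomial factors, which do not change an exponential rate. The logarithm of the determinant is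
    unbounded near its zeros, so equidistribution alone does not give its mean. Only an upper bound
    is needed: the inequality of the means handles a polynomial numerator, and a factor [1 - z] that
    has to be divided out is replaced by a multiple of [1 - r z] with [r < 1], whose logarithm is a
    uniformly convergent series. A function of several coordinates also sees the borders between the
    words [zeta^l(b)]. The windows across the borders are discarded, which spoils a proportion of
    order [L / theta^l] of the positions for windows of length [L]. So [l] is fixed before the scale
    [k] grows, and the cocycle starts at level [l]; its bound is uniform in the sequence and depends
    on the frequency alone. *)

Lemma letter_case (P : letter -> Prop) : P l0 -> P l1 -> forall b, P b.
Proof.
move=> P0 P1 [[|[|n]] hn] //.
- by have -> : Ordinal hn = l0 by apply: val_inj.
- by have -> : Ordinal hn = l1 by apply: val_inj.
Qed.

(** * The spectral cocycle *)

Section TwistedSums.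
Context (F : comNzRingType) (zeta : substitution).
Implicit Types (w V : letter -> F) (u v : seq letter) (b c : letter).

Definition phase w u : F := \prod_(b <- u) w b.

(** Horner form: the letter at a position contributes [V b] times the phases of all letters before
    it. With [V = letter_ind c] and [u = zeta b] this is the entry of the spectral cocycle in row
    [b] and column [c]. *)
Fixpoint tsum w V u : F := if u is b :: u' then V b + w b * tsum w V u' else 0.

Definition letter_ind c : letter -> F := fun b => (b == c)%:R.

Definition next_phase w : letter -> F := fun b => phase w (zeta b).

Definition next_sum w V : letter -> F := fun b => tsum w V (zeta b).

Lemma phase_cat w u v : phase w (u ++ v) = phase w u * phase w v.
Proof. by rewrite /phase big_cat. Qed.

Lemma tsum_cat w V u v : tsum w V (u ++ v) = tsum w V u + phase w u * tsum w V v.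
Proof.
elim: u => [|b u IH] /=; first by rewrite /phase big_nil add0r mul1r.
by rewrite IH /phase big_cons; ring.
Qed.

(** Renormalization: the image of a letter acts as a single letter that carries the total phase and
    the total sum of its image. *)
Lemma tsum_subst w V u :
  tsum w V (subst_word zeta u) = tsum (next_phase w) (next_sum w V) u.
Proof.
rewrite /subst_word; elim: u => [//|b u IH].
by rewrite /= tsum_cat IH.
Qed.

Lemma tsum_split w V u :
  tsum w V u = V l0 * tsum w (letter_ind l0) u + V l1 * tsum w (letter_ind l1) u.
Proof.
elim: u => [|b u IH] /=; first by rewrite !mulr0 addr0.
rewrite IH /letter_ind; elim/letter_case: b => /=; rewrite /l0 /l1 /=; ring.
Qed.

(** Because of this telescoping, the cocycle sends the vector [1 - w] to one minus the next
    phases. *)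
Lemma tsum_telescope w u : tsum w (fun b => 1 - w b) u = 1 - phase w u.
Proof.
elim: u => [|b u IH] /=; first by rewrite /phase big_nil subrr.
by rewrite IH /phase big_cons; ring.
Qed.

Lemma next_phase_split w b : 1 - next_phase w b =
  (1 - w l0) * tsum w (letter_ind l0) (zeta b) +
  (1 - w l1) * tsum w (letter_ind l1) (zeta b).
Proof. by rewrite -tsum_telescope (tsum_split w (fun b => 1 - w b)). Qed.

Definition cross w V : F := V l0 * (1 - w l1) - V l1 * (1 - w l0).

Definition cocycle_det w : F :=
  tsum w (letter_ind l0) (zeta l0) * tsum w (letter_ind l1) (zeta l1) -
  tsum w (letter_ind l1) (zeta l0) * tsum w (letter_ind l0) (zeta l1).

(* The spectral cocycle maps the vectors [V] and [1 - w] to their successors, so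
   their determinant is multiplied by the determinant of the cocycle. *)
Lemma cross_next w V :
  cross (next_phase w) (next_sum w V) = cocycle_det w * cross w V.
Proof.
rewrite /cross !next_phase_split /next_sum (tsum_split w V (zeta l0)).
by rewrite (tsum_split w V (zeta l1)) /cocycle_det; ring.
Qed.

(** Numerator of the increment of [V l0 / (1 - w l0)] in one step. Apart from an entry of the
    cocycle only [cross] occurs, so the growth of [V] is governed by the determinant. *)
Lemma next_sum_slope w V :
  next_sum w V l0 * (1 - w l0) - V l0 * (1 - next_phase w l0) =
  - (tsum w (letter_ind l1) (zeta l0) * cross w V).
Proof.
rewrite /cross !next_phase_split /next_sum (tsum_split w V (zeta l0)).
by ring.
Qed.

(** Applying [cross_next] to an indicator vector turns the determinant into a commutator of the two
    images: a difference of two polynomials with coefficients 0 and 1, whose terms can be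
    counted. *)
Lemma cocycle_det_commute0 w : cocycle_det w * (1 - w l1) =
  tsum w (letter_ind l0) (zeta l0 ++ zeta l1) -
  tsum w (letter_ind l0) (zeta l1 ++ zeta l0).
Proof.
have := cross_next w (letter_ind l0).
rewrite {2}/cross /letter_ind /= mul1r mul0r subr0 => <-.
rewrite !tsum_cat /cross /next_sum /next_phase /letter_ind; ring.
Qed.

Lemma cocycle_det_commute1 w : - cocycle_det w * (1 - w l0) =
  tsum w (letter_ind l1) (zeta l0 ++ zeta l1) -
  tsum w (letter_ind l1) (zeta l1 ++ zeta l0).
Proof.
have := cross_next w (letter_ind l1).
rewrite {2}/cross /letter_ind /= mul1r mul0r sub0r mulrN mulNr => <-.
rewrite !tsum_cat /cross /next_sum /next_phase /letter_ind; ring.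
Qed.

End TwistedSums.

(** * Parsing factors of concatenated blocks *)

Section Parsing.
Context (A B : eqType) (s : A -> seq B).
Implicit Types (u q : seq A) (v p t x y : seq B).

(** Levi's lemma on words. *)
Lemma cat_eq_cat x y v t : x ++ y = v ++ t ->
  (exists e, v = x ++ e /\ y = e ++ t) \/ (exists e, x = v ++ e /\ t = e ++ y).
Proof.
elim: x v => [|a x IH] [|b v] /=.
- by move=> ->; left; exists [::].
- by move=> ->; left; exists (b :: v).
- by move=> <-; right; exists (a :: x).
- by move=> [-> /IH [[e [-> ->]]|[e [-> ->]]]]; [left|right]; exists e.
Qed.

Lemma prefix_flatten u v : prefix v (flatten (map s u)) ->
  exists q p, [/\ v = flatten (map s q) ++ p, prefix q u &
    p = [::] \/ exists b, prefix p (s b)].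
Proof.
elim: u v => [|b u IH] v /prefixP[t] /=.
  by case: v => // _; exists [::], [::]; split => //; left.
move=> /cat_eq_cat [[e [-> h]]|[e [h _]]].
  have /IH[q [p [-> hq hp]]] : prefix e (flatten (map s u)).
    by rewrite h prefix_prefix.
  by exists (b :: q), p; split => //=; rewrite ?catA ?eqxx.
by exists [::], v; split => //; right; exists b; rewrite h prefix_prefix.
Qed.

(** The end pieces are only required to be factors of blocks, since a short [v] may lie strictly
    inside one block; in that case [q] is empty. *)
Lemma infix_flatten u v : infix v (flatten (map s u)) ->
  exists x q p, [/\ v = x ++ flatten (map s q) ++ p, infix q u,
    x = [::] \/ exists b, infix x (s b) & p = [::] \/ exists b, infix p (s b)].
Proof.
elim: u => [|b u IH] /infixP[p [t]] /=.
  case: v => [_|? ?]; last by case: p.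
  by exists [::], [::], [::]; split => //; left.
move=> /cat_eq_cat [[e [_ h]]|[e [h1 h2]]].
  have /IH[x [q [p' [-> hq hx hp]]]] : infix v (flatten (map s u)).
    by apply/infixP; exists e, t.
  by exists x, q, p'; split => //; rewrite hq orbT.
move/esym: h2 => /cat_eq_cat [[f [hv hf]]|[f [he _]]].
  have /prefix_flatten[q [p' [ef hq hp]]] : prefix f (flatten (map s u)).
    by rewrite hf prefix_prefix.
  exists e, q, p'; split => //; first by rewrite hv ef.
  - by rewrite (prefixW hq) orbT.
  - by right; exists b; rewrite h1; apply/infixP; exists p, [::]; rewrite cats0.
  - by case: hp => [|[c hc]]; [left|right; exists c; apply: prefixW].
exists v, [::], [::]; rewrite /= cats0; split => //.
- by right; exists b; rewrite h1 he; apply/infixP; exists p, f.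
- by left.
Qed.
End Parsing.

(** * The modulus of complex numbers *)

Section Modulus.
Context (R : realType).
Implicit Types (x y z : R[i]).

(** The norm of [R[i]] takes its values in [R[i]]; [nsq] and [cmod] are real-valued, so that they
    can be compared and integrated in [R]. *)
Definition nsq z : R := complex.Re z ^+ 2 + complex.Im z ^+ 2.
Definition cmod z : R := Num.sqrt (nsq z).

Lemma nsq_ge0 z : 0 <= nsq z.
Proof. by rewrite addr_ge0 ?sqr_ge0. Qed.

Lemma nsqM y z : nsq (y * z) = nsq y * nsq z.
Proof. by case: y z => [a b] [c d]; rewrite /nsq /=; ring. Qed.

Lemma nsqN z : nsq (- z) = nsq z.
Proof. by case: z => a b; rewrite /nsq /= !sqrrN. Qed.

Lemma nsq0 : nsq 0 = 0. Proof. by rewrite /nsq /= expr0n addr0. Qed.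

Lemma nsq1 : nsq 1 = 1. Proof. by rewrite /nsq /= expr1n expr0n addr0. Qed.

Lemma nsq_eq0 z : (nsq z == 0) = (z == 0).
Proof.
case: z => a b; rewrite /nsq /= paddr_eq0 ?sqr_ge0 // !sqrf_eq0.
by rewrite eq_complex.
Qed.

Lemma nsqV z : nsq z^-1 = (nsq z)^-1.
Proof.
have [->|z0] := eqVneq z 0; first by rewrite invr0 nsq0 invr0.
have n0 : nsq z != 0 by rewrite nsq_eq0.
by apply: (mulfI n0); rewrite -nsqM !divff // nsq1.
Qed.

Lemma nsqD_le y z : nsq (y + z) <= 2 * nsq y + 2 * nsq z.
Proof.
case: y z => [a b] [c d]; rewrite /nsq /=.
have := sqr_ge0 (a - c); have := sqr_ge0 (b - d); nra.
Qed.

Lemma nsq_prod (I : Type) (r : seq I) (f : I -> R[i]) :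
  nsq (\prod_(i <- r) f i) = \prod_(i <- r) nsq (f i).
Proof. by rewrite (big_morph nsq nsqM nsq1). Qed.

Lemma nsq_conj z : nsq (conjc z) = nsq z.
Proof. by case: z => a b; rewrite /nsq /= sqrrN. Qed.

Lemma mulcJ_nsq z : z * conjc z = (nsq z)%:C%C.
Proof. by case: z => a b; rewrite /nsq; apply/eqP; rewrite eq_complex /=; apply/andP; split; apply/eqP; ring. Qed.

Lemma cmod_ge0 z : 0 <= cmod z. Proof. exact: sqrtr_ge0. Qed.

Lemma cmod_sqr z : cmod z ^+ 2 = nsq z.
Proof. by rewrite sqr_sqrtr ?nsq_ge0. Qed.

Lemma cmodM y z : cmod (y * z) = cmod y * cmod z.
Proof. by rewrite /cmod nsqM sqrtrM ?nsq_ge0. Qed.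

Lemma cmodN z : cmod (- z) = cmod z. Proof. by rewrite /cmod nsqN. Qed.
Lemma cmod0 : cmod 0 = 0. Proof. by rewrite /cmod nsq0 sqrtr0. Qed.
Lemma cmod1 : cmod 1 = 1. Proof. by rewrite /cmod nsq1 sqrtr1. Qed.

Lemma cmodV z : cmod z^-1 = (cmod z)^-1.
Proof. by rewrite /cmod nsqV sqrtrV ?nsq_ge0. Qed.

Lemma cmodD y z : cmod (y + z) <= cmod y + cmod z.
Proof. by case: y z => [a b] [c d]; exact: (@le_normcD R (Complex a b) (Complex c d)). Qed.

Lemma cmodB y z : cmod (y - z) <= cmod y + cmod z.
Proof. by rewrite -(cmodN z) cmodD. Qed.

Lemma cmod_sum (I : Type) (r : seq I) (f : I -> R[i]) :
  cmod (\sum_(i <- r) f i) <= \sum_(i <- r) cmod (f i).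
Proof.
elim: r => [|i r IH]; first by rewrite !big_nil cmod0.
by rewrite !big_cons (le_trans (cmodD _ _)) // lerD2l.
Qed.

Lemma ReJ_nsq z : nsq z = 1 -> complex.Re z <= 1 /\ - 1 <= complex.Re z.
Proof.
case: z => a b; rewrite /nsq /= => h.
have := sqr_ge0 b; split; nra.
Qed.

End Modulus.

(** * Geometric means and Mahler measures *)

Section GeometricMean.
Context (R : realType).
Implicit Types (x y : nat -> R) (t : R).

(* The upper limit of the geometric means of [x] is at most [t]. *)
Definition gmean_le x t := forall s, t < s ->
  \forall n \near \oo, \prod_(j < n) x j <= s ^+ n.

Lemma gmean_near x t : (forall s, t < s -> gmean_le x s) -> gmean_le x t.
Proof.
move=> h s ts; have := h ((t + s) / 2); apply; lra.
Qed.

Lemma gmean_mono x y t : (forall j, 0 <= x j <= y j) -> gmean_le y t -> gmean_le x t.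
Proof.
move=> h hy s ts; near=> n.
apply: (@le_trans _ _ (\prod_(j < n) y j)); last by near: n; exact: hy.
by apply: ler_prod => i _; exact: h.
Unshelve. all: by end_near. Qed.

Lemma gmeanM x y s t : (forall j, 0 <= x j) -> (forall j, 0 <= y j) ->
  0 < s -> 0 < t ->
  gmean_le x s -> gmean_le y t -> gmean_le (fun j => x j * y j) (s * t).
Proof.
move=> x0 y0 s0 t0 hx hy r str.
have st0 : 0 < s * t by exact: mulr_gt0.
have r0 : 0 < r by exact: lt_trans str.
(* The slack between [r] and [s * t] is shared equally by the two factors. *)
set q := Num.sqrt (r / (s * t)).
have q1 : 1 < q.
  by rewrite -sqrtr1 /q ltr_sqrt ?divr_gt0 // ltr_pdivlMr // mul1r.
have qE : r = (s * q) * (t * q).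
  rewrite mulrACA -expr2 sqr_sqrtr ?divr_ge0 ?ltW //.
  by rewrite mulrC divfK // gt_eqF.
near=> n; rewrite big_split /= qE exprMn ler_pM ?prodr_ge0 //.
- by near: n; apply: hx; rewrite ltr_pMr.
- by near: n; apply: hy; rewrite ltr_pMr.
Unshelve. all: by end_near. Qed.

Lemma gmean_cst t : 0 <= t -> gmean_le (fun=> t) t.
Proof.
move=> t0 s ts; apply: nearW => n.
by rewrite prodr_const card_ord lerXn2r ?nnegrE ?(ltW ts) ?(le_trans t0 (ltW ts)).
Qed.

Lemma gmean_arith x t : (forall j, 0 <= x j) ->
  (fun n => n%:R^-1 * \sum_(j < n) x j) @ \oo --> t -> gmean_le x t.
Proof.
move=> x0 hx s ts; near=> n.
have /leifP := leif_AGM (A := xpredT) (fun (i : 'I_n) _ => x0 i).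
set b := [forall i in _, _] => h.
have {h} h : \prod_(j < n) x j <= ((\sum_(j < n) x j) / n%:R) ^+ n.
  by case: b h => [/eqP|/ltW]; rewrite cardT size_enum_ord // => ->.
have hm : (\sum_(j < n) x j) / n%:R <= s.
  by rewrite mulrC; near: n; exact: cvgr_le hx _ ts.
have m0 : 0 <= (\sum_(j < n) x j) / n%:R by rewrite divr_ge0 ?sumr_ge0.
by apply: (le_trans h); rewrite lerXn2r ?nnegrE // (le_trans m0).
Unshelve. all: by end_near. Qed.
End GeometricMean.

Section LogSeries.
Context (R : realType).
Implicit Types (u : R[i]) (r s : R).

Lemma nsq_oneBscale u r : nsq u = 1 ->
  nsq (1 - r%:C%C * u) = 1 - 2 * r * complex.Re u + r ^+ 2.
Proof.
case: u => a b; rewrite /nsq /= => h.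
have -> : r ^+ 2 = r ^+ 2 * (a ^+ 2 + b ^+ 2) by rewrite h mulr1.
ring.
Qed.

Lemma ReX_rec u k : nsq u = 1 -> complex.Re (u ^+ k.+2) =
  2 * complex.Re u * complex.Re (u ^+ k.+1) - complex.Re (u ^+ k).
Proof.
move=> h; rewrite !exprS; case: (u ^+ k) => c d; case: u h => a b.
rewrite /nsq /= => h.
have hc : (a ^+ 2 + b ^+ 2) * c = c by rewrite h mul1r.
by rewrite -[X in _ = _ - X]hc; ring.
Qed.

(** The sum is the truncated series of the derivative of [- ln |1 - s u|]. By the recurrence
    [ReX_rec], multiplying it by [|1 - s u|^2] telescopes to the exact numerator and two remainder
    terms. *)
Lemma dlog_partial u s K : nsq u = 1 ->
  (\sum_(k < K) s ^+ k * complex.Re (u ^+ k.+1)) *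
    (1 - 2 * s * complex.Re u + s ^+ 2) =
  complex.Re u - s - s ^+ K * complex.Re (u ^+ K.+1)
  + s ^+ K.+1 * complex.Re (u ^+ K).
Proof.
move=> h; elim: K => [|K IH].
  by rewrite big_ord0 mul0r !expr0 !expr1 /=; ring.
rewrite big_ord_recr /= mulrDl IH ReX_rec // !exprS; ring.
Qed.

Lemma absRe_le1 u : nsq u = 1 -> `|complex.Re u| <= 1.
Proof. by move=> /ReJ_nsq[h1 h2]; rewrite ler_norml h1 h2. Qed.

Lemma nsqX u k : nsq u = 1 -> nsq (u ^+ k) = 1.
Proof.
move=> h; elim: k => [|k IH]; first by rewrite expr0 nsq1.
by rewrite exprS nsqM h IH mulr1.
Qed.

(** Truncated series of [- ln |1 - r u|] in [r], for [u] on the unit circle; its constant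
    coefficient is zero. *)
Definition log_poly u K : {poly R} :=
  \poly_(k < K.+1) (if k is k'.+1 then complex.Re (u ^+ k) / k%:R else 0).

Lemma deriv_log_poly u K s :
  (log_poly u K)^`().[s] = \sum_(k < K) s ^+ k * complex.Re (u ^+ k.+1).
Proof.
have -> : (log_poly u K)^`() = \poly_(k < K) (complex.Re (u ^+ k.+1)).
  apply/polyP => i; rewrite coef_deriv !coef_poly ltnS.
  case: ifP => //=; last by rewrite mul0rn.
  by move=> _; rewrite -[LHS]mulr_natr divfK // pnatr_eq0.
by rewrite horner_poly; apply: eq_bigr => i _; rewrite mulrC.
Qed.

Lemma log_poly0 u K : (log_poly u K).[0] = 0.
Proof. by rewrite horner_coef0 coef_poly. Qed.

(** Mean value theorem for the remainder [F], which vanishes at 0: [dlog_partial] puts its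
    derivative in closed form, and the denominator is at least [(1 - r) ^+ 2] on the whole
    interval. *)
Lemma log_series_bound u r K : nsq u = 1 -> 0 < r -> r < 1 ->
  `|ln (nsq (1 - r%:C%C * u)) / 2 + (log_poly u K).[r]| <=
  2 * r ^+ K / (1 - r) ^+ 2.
Proof.
move=> h r0 r1; rewrite nsq_oneBscale //.
set c := complex.Re u.
have [c1 c2] := ReJ_nsq h; rewrite -/c in c1 c2.
pose g s := 1 - 2 * s * c + s ^+ 2.
have gpos s : 0 <= s -> s < 1 -> (1 - s) ^+ 2 <= g s.
  by move=> s0 s1; rewrite /g; nra.
have gpos0 s : 0 <= s -> s < 1 -> 0 < g s.
  move=> s0 s1; apply: lt_le_trans (gpos s s0 s1).
  by rewrite exprn_gt0 // subr_gt0.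
pose F s := ln (g s) / 2 + (log_poly u K).[s].
pose dF s := (s - c) / g s + (log_poly u K)^`().[s].
have gp s : g s = (1 - (2 * c) *: 'X + 'X^2 : {poly R}).[s].
  by rewrite /g !hornerE /=; ring.
have dg s : is_derive s (1 : R) g (2 * (s - c)).
  have dp : (1 - (2 * c) *: 'X + 'X^2 : {poly R})^`().[s] = 2 * (s - c).
    by rewrite derivD derivB derivZ derivX derivXn -[1]polyC1 derivC !hornerE /=; ring.
  rewrite -dp (_ : g = horner (1 - (2 * c) *: 'X + 'X^2)).
    exact: is_derive_poly.
  by apply/funext => x; rewrite gp.
have dFE s : 0 <= s -> s < 1 -> is_derive s (1 : R) F (dF s).
  move=> s0 s1.
  have g0 := gpos0 s s0 s1.
  have d1 : is_derive s (1 : R) (@ln R \o g) ((g s)^-1 * (2 * (s - c))).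
    by apply: is_derive1_comp; exact: is_derive1_ln.
  have d2 := is_deriveZ (2^-1 : R) d1.
  have d3 := is_deriveD d2 (is_derive_poly (log_poly u K) s).
  rewrite (_ : F = 2^-1 *: (@ln R \o g : R -> R) + horner (log_poly u K)); last first.
    by apply/funext => x; rewrite /F /= mulrC.
  rewrite (_ : dF s = 2^-1 *: ((g s)^-1 * (2 * (s - c))) + (log_poly u K)^`().[s]) //.
  rewrite /dF; congr (_ + _); rewrite /GRing.scale /=.
  by field; rewrite gt_eqF.
have [||x xi Fx] := @MVT R F dF 0 r r0.
- by move=> x xi; apply: dFE; move: xi; rewrite in_itv /= => /andP[? ?]; lra.
- apply: derivable_within_continuous => x; rewrite in_itv /= => /andP[x0 x1].
  by have [] := dFE x x0 (le_lt_trans x1 r1).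
move: xi; rewrite in_itv /= => /andP[x0 xr].
have x1 : x < 1 by exact: lt_trans r1.
have F0 : F 0 = 0.
  by rewrite /F log_poly0 (_ : g 0 = 1) ?ln1 /g; lra.
move: Fx; rewrite F0 !subr0 -/(F r) => ->.
have gx := gpos0 x (ltW x0) x1.
have -> : dF x = (x ^+ K.+1 * complex.Re (u ^+ K) -
                   x ^+ K * complex.Re (u ^+ K.+1)) / g x.
  have gn : g x != 0 by rewrite gt_eqF.
  apply: (mulIf gn).
  rewrite /dF mulrDl !divfK ?gt_eqF // deriv_log_poly dlog_partial // -/c.
  by rewrite /c; ring.
rewrite normrM [`|_ / _|]normrM normfV (gtr0_norm r0) (gtr0_norm gx).
have num : `|x ^+ K.+1 * complex.Re (u ^+ K) - x ^+ K * complex.Re (u ^+ K.+1)|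
    <= 2 * r ^+ K.
  apply: (le_trans (ler_normB _ _)); rewrite !normrM.
  have xK : `|x ^+ K| <= r ^+ K.
    by rewrite normrX gtr0_norm // lerXn2r ?nnegrE ?ltW.
  have xK1 : `|x ^+ K.+1| <= r ^+ K.
    rewrite exprS normrM gtr0_norm //; apply: le_trans xK.
    by rewrite ler_piMl // ltW.
  have := absRe_le1 (nsqX K h); have := absRe_le1 (nsqX K.+1 h).
  move: xK xK1 (normr_ge0 (x ^+ K)) (normr_ge0 (x ^+ K.+1)).
  move: (normr_ge0 (complex.Re (u ^+ K))) (normr_ge0 (complex.Re (u ^+ K.+1))).
  nra.
have gr : (1 - r) ^+ 2 <= g x.
  apply: le_trans (gpos x (ltW x0) x1).
  by rewrite lerXn2r ?nnegrE; lra.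
have r10 : 0 < (1 - r) ^+ 2 by rewrite exprn_gt0 // subr_gt0.
apply: (le_trans (ler_piMr _ (ltW r1))); first by rewrite divr_ge0 // ltW.
apply: ler_pM => //; first by rewrite invr_ge0 ltW.
by rewrite lef_pV2 ?posrE.
Qed.

Lemma nsq_log_bounds r eps : 0 < r -> r < 1 -> 0 < eps ->
  exists K, forall u, nsq u = 1 ->
    expR (- 2 * (log_poly u K).[r] - eps) <= nsq (1 - r%:C%C * u) /\
    nsq (1 - r%:C%C * u) <= expR (- 2 * (log_poly u K).[r] + eps).
Proof.
move=> r0 r1 e0.
have r10 : 0 < (1 - r) ^+ 2 by rewrite exprn_gt0 // subr_gt0.
have hr : (fun n => r ^+ n : R^o) @ \oo --> (0 : R).
  by apply: cvg_expr; rewrite gtr0_norm.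
have del0 : 0 < eps / 4 * (1 - r) ^+ 2 by rewrite mulr_gt0 // divr_gt0.
have [K _ hK] := cvgr_lt (0 : R) hr _ del0.
have {}hK : r ^+ K < eps / 4 * (1 - r) ^+ 2 by exact: (hK K (leqnn K)).
exists K => u hu.
have := log_series_bound K hu r0 r1.
have gp : 0 < nsq (1 - r%:C%C * u).
  rewrite nsq_oneBscale //; have [c1 c2] := ReJ_nsq hu; nra.
have : 2 * r ^+ K / (1 - r) ^+ 2 <= eps / 2.
  by rewrite ler_pdivrMr //; nra.
move=> h1 h2; have {h1 h2} := le_trans h2 h1.
rewrite ler_norml => /andP[h1 h2].
by split; rewrite -[X in X <= _]lnK ?posrE ?expR_gt0 // -[X in _ <= X]lnK ?posrE ?expR_gt0 // ler_expR ?expRK; lra.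
Qed.

(** The series has no constant term, so the vanishing Weyl sums average it away. The factor [sg] is
    [- 2] for [nsq (1 - r v)] and [2] for its inverse. *)
Lemma gmean_log_aux (v : nat -> R[i]) r eps (sg : R) :
  (forall j, nsq (v j) = 1) ->
  (forall k, (0 < k)%N ->
    (fun n => n%:R^-1 * \sum_(j < n) complex.Re (v j ^+ k)) @ \oo --> (0 : R)) ->
  0 < eps -> forall K, gmean_le (fun j => expR (sg * (log_poly (v j) K).[r] + eps)) (expR eps).
Proof.
move=> hv hm e0 K s es.
have s0 : 0 < s by apply: lt_trans es; exact: expR_gt0.
have hcv : (fun n => sg * (n%:R^-1 * \sum_(j < n) (log_poly (v j) K).[r])) @ \oo --> (0 : R).
  rewrite [X in _ --> X](_ : _ = sg * 0); last by rewrite mulr0.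
  apply: cvgMr.
  rewrite (_ : (fun n => _) = fun n => \sum_(k < K.+1)
    ((if (k : nat) is k'.+1 then r ^+ k / k%:R else 0) *
     (n%:R^-1 * \sum_(j < n) complex.Re (v j ^+ k)))); last first.
    apply/funext => n; rewrite mulr_sumr.
    under eq_bigr do rewrite horner_poly mulr_sumr.
    rewrite exchange_big /=; apply: eq_bigr => -[[|k] hk] _ /=.
      by rewrite [RHS]mul0r big1 // => j _; rewrite mul0r mulr0.
    by rewrite !mulr_sumr; apply: eq_bigr => j _; ring.
  rewrite [X in _ --> X](_ : _ = \sum_(k < K.+1) 0); last by rewrite big1.
  apply: cvg_big => [|[[|k] hk] _ /=]; first exact: add_continuous.
    by under eq_fun do rewrite mul0r; exact: cvg_cst.
  rewrite [X in _ --> X](_ : _ = r ^+ k.+1 / k.+1%:R * 0); last by rewrite mulr0.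
  by apply: cvgMr; exact: hm.
have ls : eps < ln s by rewrite -(expRK eps) ltr_ln ?posrE ?expR_gt0.
near=> n.
have n0 : (0 < n)%N by near: n; exists 1%N.
have hS : sg * (n%:R^-1 * \sum_(j < n) (log_poly (v j) K).[r]) < ln s - eps.
  near: n; apply: cvgr_lt hcv _ _; lra.
rewrite -expR_sum big_split /= -mulr_sumr sumr_const card_ord.
rewrite -[s]lnK ?posrE // -expRM_natr ler_expR.
set S := \sum_(j < n) _ in hS *.
have -> : sg * S = sg * (n%:R^-1 * S) * n%:R.
  by field; rewrite pnatr_eq0 -lt0n.
rewrite -[eps *+ n]mulr_natr -mulrDl ler_wpM2r //; lra.
Unshelve. all: by end_near. Qed.
End LogSeries.

Section MoreGeometricMean.
Context (R : realType).
Implicit Types (x y : nat -> R) (t : R).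

Lemma gmean_ext x y t : x =1 y -> gmean_le y t -> gmean_le x t.
Proof. by move=> /funext ->. Qed.

Lemma gmean_le_trans x s t : s <= t -> gmean_le x s -> gmean_le x t.
Proof. by move=> st h r tr; apply: h; exact: le_lt_trans tr. Qed.

Lemma gmean_prod (I : eqType) (l : seq I) (x : I -> nat -> R) t : 0 < t ->
  (forall e, e \in l -> forall j, 0 <= x e j) ->
  (forall e, e \in l -> gmean_le (x e) t) ->
  gmean_le (fun j => \prod_(e <- l) x e j) (t ^+ size l).
Proof.
move=> t0; elim: l => [|e l IH] x0 h.
  apply: gmean_ext (fun j => big_nil _ _ _ _) _.
  by rewrite expr0; exact: (gmean_cst ler01).
apply: gmean_ext (fun j => big_cons _ _ _ _ _ _) _.
have hl f : f \in l -> f \in e :: l by rewrite in_cons => ->; rewrite orbT.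
have he : e \in e :: l by rewrite mem_head.
rewrite /= exprS; apply: gmeanM => //.
- by move=> j; apply: x0.
- by move=> j; rewrite big_seq prodr_ge0 // => f /hl /x0.
- by rewrite exprn_gt0.
- exact: h.
- by apply: IH => f /hl; [exact: x0|exact: h].
Qed.
End MoreGeometricMean.

Section Monomials.
Context (F : comNzRingType).
Implicit Types (w : letter -> F) (m : nat * nat).

Definition mon w m : F := w l0 ^+ m.1 * w l1 ^+ m.2.

Lemma mon00 w : mon w (0%N, 0%N) = 1. Proof. by rewrite /mon !expr0 mulr1. Qed.

Lemma monX w m k : mon w m ^+ k = mon w (m.1 * k, m.2 * k)%N.
Proof. by rewrite /mon exprMn -!exprM. Qed.

End Monomials.

Section Equidistribution.
Context (R : realType).
Implicit Types (w : nat -> letter -> R[i]).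

Definition mean_to (x : nat -> R) (l : R) :=
  (fun n => n%:R^-1 * \sum_(j < n) x j) @ \oo --> l.

(** Weyl's criterion on the torus, with conjugation in place of negative exponents. Real parts
    suffice because the polynomials to be averaged have real coefficients. *)
Definition equid w := forall m m' : nat * nat, m != m' ->
  mean_to (fun j => complex.Re (mon (w j) m * conjc (mon (w j) m'))) 0.

Definition unit_phases w := forall j b, nsq (w j b) = 1.

Lemma nsq_mon w m j : unit_phases w -> nsq (mon (w j) m) = 1.
Proof. by move=> h; rewrite /mon nsqM !nsqX ?h // mulr1. Qed.

Lemma mean_to_ext x y l : x =1 y -> mean_to y l -> mean_to x l.
Proof. by move=> /funext ->. Qed.

Lemma mean_to_sum (I : Type) (l : seq I) (x : I -> nat -> R) (c : I -> R) :
  (forall i, mean_to (x i) (c i)) ->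
  mean_to (fun j => \sum_(i <- l) x i j) (\sum_(i <- l) c i).
Proof.
move=> h; rewrite /mean_to.
rewrite (_ : (fun n => _) = fun n => \sum_(i <- l) n%:R^-1 * \sum_(j < n) x i j).
  by apply: cvg_big => [|i _]; [exact: add_continuous|exact: h].
by apply/funext => n; rewrite exchange_big mulr_sumr.
Qed.

Lemma mean_to_scale (x : nat -> R) c a :
  mean_to x c -> mean_to (fun j => a * x j) (a * c).
Proof.
move=> h; rewrite /mean_to.
rewrite (_ : (fun n => _) = fun n => a * (n%:R^-1 * \sum_(j < n) x j)).
  exact: cvgMr.
by apply/funext => n; rewrite -mulr_sumr mulrCA.
Qed.

Lemma mean_to_cst c : mean_to (fun=> c) c.
Proof.
apply: (@cvg_trans _ ((fun=> c) @ \oo)); last exact: cvg_cst.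
apply: near_eq_cvg; near=> n; rewrite sumr_const card_ord -[c *+ n]mulr_natl.
rewrite mulKf // pnatr_eq0 -lt0n; near: n; by exists 1%N.
Unshelve. all: by end_near. Qed.

Lemma mean_toD (x y : nat -> R) c d :
  mean_to x c -> mean_to y d -> mean_to (fun j => x j + y j) (c + d).
Proof.
move=> hx hy; rewrite /mean_to.
rewrite (_ : (fun n => _) = fun n => n%:R^-1 * \sum_(j < n) x j +
  n%:R^-1 * \sum_(j < n) y j); first exact: cvgD.
by apply/funext => n; rewrite big_split /= mulrDr.
Qed.

Definition tpoly (L : seq (R * (nat * nat))) (w : letter -> R[i]) : R[i] :=
  \sum_(t <- L) (t.1)%:C%C * mon w t.2.

Lemma Re_sum (I : Type) (l : seq I) (f : I -> R[i]) :
  complex.Re (\sum_(i <- l) f i) = \sum_(i <- l) complex.Re (f i).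
Proof. by apply: (big_morph (@complex.Re R)) => // -[a b] [c d]. Qed.

Lemma Re_scale (a : R) (z : R[i]) : complex.Re (a%:C%C * z) = a * complex.Re z.
Proof. by case: z => c d /=; rewrite mul0r subr0. Qed.

Lemma conjc_sum (I : Type) (l : seq I) (f : I -> R[i]) :
  conjc (\sum_(i <- l) f i) = \sum_(i <- l) conjc (f i).
Proof.
by apply: (big_morph conjc) => [[a b] [c d]|]; rewrite /conjc /= ?oppr0 // opprD.
Qed.

Lemma conjcM (y z : R[i]) : conjc (y * z) = conjc y * conjc z.
Proof.
by case: y z => [a b] [c d]; apply/eqP; rewrite eq_complex /=; apply/andP; split; apply/eqP; ring.
Qed.

Lemma nsq_tpoly L (w : letter -> R[i]) : nsq (tpoly L w) =
  \sum_(s <- L) \sum_(t <- L)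
    s.1 * t.1 * complex.Re (mon w s.2 * conjc (mon w t.2)).
Proof.
have -> : nsq (tpoly L w) = complex.Re (tpoly L w * conjc (tpoly L w)).
  by rewrite mulcJ_nsq.
rewrite {1}/tpoly mulr_suml Re_sum; apply: eq_bigr => s _.
rewrite /tpoly conjc_sum mulr_sumr Re_sum; apply: eq_bigr => t _.
rewrite conjcM conjc_real.
rewrite [X in complex.Re X](_ : _ = (s.1)%:C%C * ((t.1)%:C%C *
  (mon w s.2 * conjc (mon w t.2)))); last by ring.
by rewrite !Re_scale mulrA.
Qed.

(** Only pairs of equal monomials survive in the mean, which leaves the squared L2 norm of the
    polynomial on the torus; [L] may repeat an exponent. *)
Lemma mean_to_tpoly L w : equid w -> unit_phases w ->
  mean_to (fun j => nsq (tpoly L (w j)))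
    (\sum_(s <- L) \sum_(t <- L) s.1 * t.1 * (s.2 == t.2)%:R).
Proof.
move=> hw hu; apply: mean_to_ext (fun j => nsq_tpoly L (w j)) _.
apply: mean_to_sum => s; apply: mean_to_sum => t; apply: mean_to_scale.
have [->|st] := eqVneq s.2 t.2; last exact: hw.
rewrite (_ : _%:R = 1) //; apply: (mean_to_ext (y := fun=> 1)); last exact: mean_to_cst.
move=> j.
by rewrite mulcJ_nsq nsq_mon.
Qed.

Definition signed_list (X Y : seq (nat * nat)) : seq (R * (nat * nat)) :=
  [seq (1, m) | m <- X] ++ [seq (- 1, m) | m <- Y].

Lemma tpoly_signed X Y (w : letter -> R[i]) : tpoly (signed_list X Y) w =
  \sum_(m <- X) mon w m - \sum_(m <- Y) mon w m.
Proof.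
rewrite /tpoly /signed_list big_cat !big_map /=; congr (_ + _).
  by apply: eq_bigr => m _; rewrite mul1r.
by rewrite -sumrN; apply: eq_bigr => m _; rewrite rmorphN mulN1r.
Qed.

Lemma sum_eq_count (X Y : seq (nat * nat)) : uniq X ->
  \sum_(s <- X) \sum_(t <- X) ((s == t)%:R : R) = (size X)%:R.
Proof.
move=> uX; rewrite -sum1_size natr_sum big_seq [RHS]big_seq; apply: eq_bigr => s sX.
rewrite -natr_sum; congr (_%:R).
under eq_bigr do rewrite eq_sym.
by rewrite -big_mkcond sum1_count count_uniq_mem // sX.
Qed.

(** An exponent common to [X] and [Y] cancels, so coincidences can only lower the norm. *)
Lemma signed_norm X Y : uniq X -> uniq Y ->
  \sum_(s <- signed_list X Y) \sum_(t <- signed_list X Y)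
    s.1 * t.1 * ((s.2 == t.2)%:R : R) <= (size X + size Y)%:R.
Proof.
move=> uX uY; rewrite /signed_list big_cat !big_map /=.
under eq_bigr do rewrite big_cat !big_map /=.
under [X in _ + X]eq_bigr do rewrite big_cat !big_map /=.
rewrite !big_split /= natrD -(sum_eq_count X uX) -(sum_eq_count Y uY).
have n0 (Z T : seq (nat * nat)) :
    \sum_(s <- Z) \sum_(t <- T) 1 * -1 * ((s == t)%:R : R) <= 0.
  apply: sumr_le0 => s _; apply: sumr_le0 => t _.
  by rewrite mul1r mulN1r oppr_le0.
have n1 (Z T : seq (nat * nat)) :
    \sum_(s <- Z) \sum_(t <- T) -1 * 1 * ((s == t)%:R : R) <= 0.
  apply: sumr_le0 => s _; apply: sumr_le0 => t _.
  by rewrite mulr1 mulN1r oppr_le0.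
have e1 : \sum_(s <- X) \sum_(t <- X) 1 * 1 * ((s == t)%:R : R) =
    \sum_(s <- X) \sum_(t <- X) (s == t)%:R.
  by do 2 (apply: eq_bigr => ? _); rewrite !mul1r.
have e2 : \sum_(s <- Y) \sum_(t <- Y) -1 * -1 * ((s == t)%:R : R) =
    \sum_(s <- Y) \sum_(t <- Y) (s == t)%:R.
  by do 2 (apply: eq_bigr => ? _); rewrite mulrNN !mul1r.
have := n0 X Y; have := n1 Y X; rewrite e1 e2; lra.
Qed.

(** A positive substitute for [|1 - z|^2]: the added constant is the one for which the result is
    [|1 - r z|^2 / r] on the unit circle. *)
Definition reg (r : R) (z : R[i]) : R := nsq (1 - z) + (1 - r) ^+ 2 / r.

Lemma regE r z : 0 < r -> nsq z = 1 -> reg r z = nsq (1 - r%:C%C * z) / r.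
Proof.
move=> r0 hz; rewrite /reg nsq_oneBscale //.
have -> : nsq (1 - z) = 2 - 2 * complex.Re z.
  by have := nsq_oneBscale 1 hz; rewrite mul1r => ->; rewrite expr1n; ring.
by field; rewrite gt_eqF.
Qed.

Lemma equid_mon w e : equid w -> e != (0%N, 0%N) ->
  forall k, (0 < k)%N -> (fun n => n%:R^-1 *
    \sum_(j < n) complex.Re (mon (w j) e ^+ k)) @ \oo --> (0 : R).
Proof.
move=> hw e0 k k0.
have /hw : ((e.1 * k)%N, (e.2 * k)%N) != (0%N, 0%N).
  by apply: contra e0; case: e => a b; rewrite !xpair_eqE !muln_eq0 (gtn_eqF k0) !orbF.
by apply: (mean_to_ext (x := fun j => complex.Re (mon (w j) e ^+ k))) => j; rewrite mon00 conjc1 mulr1 monX.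
Qed.

Lemma gmean_nsq w e r : equid w -> unit_phases w -> e != (0%N, 0%N) ->
  0 < r -> r < 1 ->
  gmean_le (fun j => nsq (1 - r%:C%C * mon (w j) e)) 1 /\
  gmean_le (fun j => (nsq (1 - r%:C%C * mon (w j) e))^-1) 1.
Proof.
move=> hw hu e0 r0 r1.
have hm := equid_mon hw e0.
have hv j : nsq (mon (w j) e) = 1 by exact: nsq_mon.
split; apply: gmean_near => s s1.
  have ls : 0 < ln s by exact: ln_gt0.
  have [K hK] := nsq_log_bounds r0 r1 ls.
  apply: (@gmean_mono _ _ (fun j => expR (- 2 * (log_poly (mon (w j) e) K).[r] + ln s))).
    by move=> j; rewrite nsq_ge0; have [] := hK _ (hv j).
  have := gmean_log_aux r (- 2) hv hm ls K.
  by rewrite lnK // posrE (lt_trans _ s1).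
have ls : 0 < ln s by exact: ln_gt0.
have [K hK] := nsq_log_bounds r0 r1 ls.
apply: (@gmean_mono _ _ (fun j => expR (2 * (log_poly (mon (w j) e) K).[r] + ln s))).
  move=> j; rewrite invr_ge0 nsq_ge0 /=; have [h _] := hK _ (hv j).
  have -> : 2 * (log_poly (mon (w j) e) K).[r] + ln s =
    - (- 2 * (log_poly (mon (w j) e) K).[r] - ln s) by ring.
  rewrite expRN lef_pV2 // posrE ?expR_gt0 //.
  by apply: lt_le_trans h; exact: expR_gt0.
have := gmean_log_aux r 2 hv hm ls K.
by rewrite lnK // posrE (lt_trans _ s1).
Qed.

Lemma gmean_reg w e r : equid w -> unit_phases w -> e != (0%N, 0%N) ->
  0 < r -> r < 1 ->
  gmean_le (fun j => reg r (mon (w j) e)) r^-1 /\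
  gmean_le (fun j => (reg r (mon (w j) e))^-1) 1.
Proof.
move=> hw hu e0 r0 r1; have [h1 h2] := gmean_nsq hw hu e0 r0 r1.
have hv j : nsq (mon (w j) e) = 1 by exact: nsq_mon.
split.
  apply: gmean_ext (fun j => regE r0 (hv j)) _.
  rewrite -[X in gmean_le _ X]mul1r; apply: gmeanM => // [j|j||].
  - exact: nsq_ge0.
  - by rewrite invr_ge0 ltW.
  - by rewrite invr_gt0.
  - by apply: gmean_cst; rewrite invr_ge0 ltW.
apply: (@gmean_ext _ _ (fun j => (nsq (1 - r%:C%C * mon (w j) e))^-1 * r)).
  by move=> j; rewrite regE // invfM invrK.
apply: gmean_le_trans (_ : 1 * r <= 1) _; first by rewrite mul1r ltW.
apply: gmeanM => // [j|j|].
- by rewrite invr_ge0 nsq_ge0.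
- exact: ltW.
- by apply: gmean_cst; exact: ltW.
Qed.

Lemma prod_shift_le (I : Type) (l : seq I) (d : I -> R) (del : R) :
  (forall i, 0 <= d i <= 4) -> 0 <= del <= 1 ->
  \prod_(i <- l) (d i + del) <= \prod_(i <- l) d i + del * 6 ^+ size l.
Proof.
move=> hd /andP[del0 del1].
suff : 0 <= \prod_(i <- l) d i <= 6 ^+ size l /\
  \prod_(i <- l) (d i + del) <= \prod_(i <- l) d i + del * 6 ^+ size l by case.
elim: l => [|i l [/andP[p0 p6] IH]].
  by rewrite !big_nil expr0 ler01 lexx; split => //; lra.
rewrite !big_cons /= exprS; have /andP[i0 i4] := hd i.
split.
  by rewrite mulr_ge0 //= ler_pM //; lra.
apply: (@le_trans _ _ ((d i + del) * (\prod_(j <- l) d j + del * 6 ^+ size l))).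
  by rewrite ler_wpM2l // addr_ge0.
set P := \prod_(j <- l) d j in p0 p6 *; set S := 6 ^+ size l in p6 *.
have S0 : 0 <= S by rewrite exprn_ge0.
have h1 : d i * S <= 4 * S by rewrite ler_wpM2r.
have h2 : del * S <= S by rewrite ler_piMl.
(* The 6 is 4 + 1 + 1, from [d i <= 4], [P <= S] and [del <= 1]. *)
have h3 : del * (d i * S + P + del * S) <= del * (6 * S).
  by rewrite ler_wpM2l //; lra.
by apply: le_trans (_ : _ <= d i * P + del * (d i * S + P + del * S)) _; [lra|lra].
Qed.

Lemma nsq_oneB_le4 (z : R[i]) : nsq z = 1 -> 0 <= nsq (1 - z) <= 4.
Proof.
move=> hz; rewrite nsq_ge0 /=.
have := nsqD_le 1 (- z); rewrite nsqN hz nsq1; lra.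
Qed.

Section Mahler.
Variable zeta : substitution.

(* The polynomial identity bounds the Mahler measure of the determinant of the
   spectral cocycle by the L2 norm of its numerator, as each factor [1 - mon w e]
   has Mahler measure 1. *)
Definition mahler_data X Y num den :=
  [/\ uniq X, uniq Y, (0%N, 0%N) \notin num, (0%N, 0%N) \notin den &
   forall w : letter -> R[i],
    cocycle_det zeta w * \prod_(e <- den) (1 - mon w e) =
    (\sum_(m <- X) mon w m - \sum_(m <- Y) mon w m) *
      \prod_(e <- num) (1 - mon w e)].

(** The factors of [den] can come arbitrarily close to 0, so a small constant is added to each
    before dividing. As the determinant is bounded by [K], this costs an error that is absorbed by
    adding [eta] to the squared numerator, whose arithmetic mean then bounds its geometric mean. *)
Lemma mahler_gmean w X Y num den K : equid w -> unit_phases w ->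
  mahler_data X Y num den ->
  (forall j, nsq (cocycle_det zeta (w j)) <= K) ->
  gmean_le (fun j => nsq (cocycle_det zeta (w j))) (size X + size Y)%:R.
Proof.
move=> hw hu [uX uY num0 den0 hid] hK; apply: gmean_near => s.
set M : R := (size X + size Y)%:R => Ms.
have M0 : 0 <= M by rewrite ler0n.
have s0 : 0 < s by exact: le_lt_trans Ms.
pose eta := (s - M) / 2; have eta0 : 0 < eta by rewrite /eta; lra.
have K0 : 0 <= K by apply: le_trans (hK 0%N); exact: nsq_ge0.
set kap := s / (M + eta).
have kap1 : 1 < kap by rewrite /kap ltr_pdivlMr /eta; lra.
(* This radius is close enough to 1 for one factor [rn^-1] per element of [num] to fit between
   [M + eta] and [s]. *)
pose rn := expR (- (ln kap / (size num).+1%:R)).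
have lk : 0 < ln kap by exact: ln_gt0.
have rn0 : 0 < rn by exact: expR_gt0.
have rn1 : rn < 1 by rewrite /rn expR_lt1 oppr_lt0 divr_gt0.
have rnk : (M + eta) * rn^-1 ^+ size num <= s.
  rewrite (_ : s = (M + eta) * kap); last first.
    by rewrite /kap mulrC divfK // gt_eqF // /eta; lra.
  rewrite ler_wpM2l //; first by rewrite /eta; lra.
  rewrite /rn -expRN opprK -expRM_natr -[leRHS]lnK ?posrE; last by lra.
  rewrite ler_expR -mulrA ler_piMr // ?ltW //.
  by rewrite mulrC ltr_pdivrMr // mul1r ltr_nat.
set deln := (1 - rn) ^+ 2 / rn.
have deln0 : 0 < deln by rewrite divr_gt0 // exprn_gt0 // subr_gt0.
(* The error of shifting the factors of [den] has to stay below [eta] times the product of [reg rn]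
   over [num], which is at least [deln ^+ size num]. *)
have [del [del0 del1 hdel]] : exists del : R,
    [/\ 0 < del, del <= 1 & K * (del * 6 ^+ size den) <= eta * deln ^+ size num].
  set D := eta * deln ^+ size num.
  have D0 : 0 < D by rewrite mulr_gt0 // exprn_gt0.
  pose E := K * 6 ^+ size den.
  have E0 : 0 <= E by rewrite mulr_ge0 // exprn_ge0.
  exists (Num.min 1 (D / (E + 1))); split.
  - by rewrite lt_min ltr01 divr_gt0 // ltr_wpDl.
  - by rewrite ge_min lexx.
  - rewrite mulrCA; apply: (@le_trans _ _ (D / (E + 1) * E)).
      by rewrite ler_wpM2r // ge_min lexx orbT.
    by rewrite mulrAC ler_pdivrMr ?ltr_wpDl // ler_wpM2l ?ltW // ltrDl.
(* With this radius the constant in [reg rd] is at most [del]. *)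
pose rd := 1 - del / 2.
have rd0 : 0 < rd by rewrite /rd; lra.
have rd1 : rd < 1 by rewrite /rd; lra.
have deld : 0 <= (1 - rd) ^+ 2 / rd <= del.
  rewrite divr_ge0 ?sqr_ge0 ?(ltW rd0) //= ler_pdivrMr // /rd; nra.
have num00 e : e \in num -> e != (0%N, 0%N).
  by move=> en; apply: contraNneq num0 => <-.
have den00 e : e \in den -> e != (0%N, 0%N).
  by move=> en; apply: contraNneq den0 => <-.
pose P j := nsq (tpoly (signed_list X Y) (w j)).
have regp r z : 0 < r -> r < 1 -> 0 < reg r z.
  move=> r0 r1; rewrite /reg ltr_wpDl ?nsq_ge0 // divr_gt0 //.
  by rewrite exprn_gt0 // subr_gt0.
apply: (@gmean_mono _ _ (fun j => ((P j + eta) *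
    \prod_(e <- num) reg rn (mon (w j) e)) *
    \prod_(e <- den) (reg rd (mon (w j) e))^-1)).
  move=> j; rewrite nsq_ge0 /= prodfV ler_pdivlMr; last first.
    by apply: prodr_gt0 => e _; exact: regp.
  have hd4 e : 0 <= nsq (1 - mon (w j) e) <= 4.
    by apply: nsq_oneB_le4; exact: nsq_mon.
  have deld1 : 0 <= (1 - rd) ^+ 2 / rd <= 1.
    by case/andP: deld => -> /= /le_trans; apply.
  have := prod_shift_le den hd4 deld1.
  move/(ler_wpM2l (nsq_ge0 (cocycle_det zeta (w j)))) => h.
  apply: (le_trans h); rewrite mulrDr -nsq_prod -nsqM hid nsqM -tpoly_signed.
  rewrite -/(P j) nsq_prod [leRHS]mulrDl lerD //.
    rewrite ler_wpM2l ?nsq_ge0 //; apply: ler_prod => e _.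
    by rewrite nsq_ge0 /= /reg lerDl ltW.
  apply: (@le_trans _ _ (K * (del * 6 ^+ size den))).
    case/andP: deld => d0 d1.
    apply: ler_pM => //; first exact: nsq_ge0.
      by rewrite mulr_ge0 // exprn_ge0.
    by rewrite ler_wpM2r // exprn_ge0.
  apply: (le_trans hdel); rewrite ler_wpM2l ?(ltW eta0) //.
  rewrite -(iter_mulr_1 (size num)) -(count_predT num) -big_const_seq.
  apply: ler_prod => e _.
  by rewrite (ltW deln0) /= /reg lerDr nsq_ge0.
apply: gmean_le_trans rnk _.
rewrite -[_ * _ ^+ size num]mulr1.
apply: gmeanM => //.
- move=> j; apply: mulr_ge0; first by rewrite addr_ge0 ?nsq_ge0 // ltW.
  by apply: prodr_ge0 => e _; rewrite ltW // regp.
- move=> j; apply: prodr_ge0 => e _; rewrite invr_ge0 ltW //; exact: regp.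
- by rewrite mulr_gt0 ?exprn_gt0 ?invr_gt0 //; lra.
- apply: gmeanM.
  + by move=> j; rewrite addr_ge0 ?nsq_ge0 // ltW.
  + by move=> j; apply: prodr_ge0 => e _; rewrite ltW // regp.
  + by lra.
  + by rewrite exprn_gt0 // invr_gt0.
  + have hle := signed_norm uX uY; rewrite -/M -(lerD2r eta) in hle.
    apply: gmean_le_trans hle _; apply: gmean_arith.
      by move=> j; rewrite addr_ge0 ?nsq_ge0 // ltW.
    have hh := mean_toD (mean_to_tpoly (L := signed_list X Y) hw hu) (@mean_to_cst eta).
    exact: hh.
  + apply: gmean_prod; first by rewrite invr_gt0.
      by move=> e _ j; rewrite ltW // regp.
    by move=> e /num00 e0; have [] := gmean_reg hw hu e0 rn0 rn1.
- rewrite -[X in gmean_le _ X](expr1n _ (size den)).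
  apply: gmean_prod => //.
    by move=> e _ j; rewrite invr_ge0 ltW // regp.
  by move=> e /den00 e0; have [] := gmean_reg hw hu e0 rd0 rd1.
Qed.
End Mahler.
End Equidistribution.

(** * Growth of the twisted sums *)

Section ExponentialGrowth.
Context (R : realType).
Implicit Types (x y : nat -> R) (M t : R).

(** Upper exponential rate at most [M]. Unlike in [gmean_le], the bound holds for all [n], at the
    price of a constant. *)
Definition growth_le x M := forall r, M < r -> exists C, forall n, x n <= C * r ^+ n.

Lemma growth_mono x y M c : 0 <= c -> (forall n, x n <= c * y n) ->
  growth_le y M -> growth_le x M.
Proof.
move=> c0 h hy r /hy[C hC]; exists (c * C) => n.
by apply: (le_trans (h n)); rewrite -mulrA ler_wpM2l.
Qed.

Lemma growthD x y M : growth_le x M -> growth_le y M ->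
  growth_le (fun n => x n + y n) M.
Proof.
move=> hx hy r Mr; have [C hC] := hx r Mr; have [D hD] := hy r Mr.
by exists (C + D) => n; rewrite mulrDl lerD.
Qed.

Lemma growth_bounded C M : 1 <= M -> 0 <= C -> growth_le (fun=> C) M.
Proof.
move=> M1 C0 r Mr; exists C => n; rewrite ler_peMr // exprn_ege1 //.
by apply: le_trans M1 _; exact: ltW.
Qed.

Lemma growth_gmean x t : (forall j, 0 <= x j) -> 0 <= t -> gmean_le x t ->
  growth_le (fun n => \prod_(j < n) x j) t.
Proof.
move=> x0 t0 h r tr; have r0 : 0 < r by exact: le_lt_trans tr.
have [n0 _ hn0] := h r tr.
have p0 n : 0 <= (\prod_(j < n) x j) / r ^+ n.
  by rewrite divr_ge0 ?prodr_ge0 // exprn_ge0 // ltW.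
exists (1 + \sum_(i < n0) (\prod_(j < i) x j) / r ^+ i) => n.
have [nn|nn] := leqP n0 n.
  apply: (le_trans (hn0 n nn)); rewrite ler_peMl ?exprn_ge0 ?(ltW r0) //.
  by rewrite lerDl sumr_ge0.
rewrite -ler_pdivrMr ?exprn_gt0 // (bigD1 (Ordinal nn)) //= addrCA lerDl.
by apply: addr_ge0 => //; apply: sumr_ge0 => i _; exact: p0.
Qed.

Lemma growth_sqrt x t : (forall j, 0 <= x j) -> 0 <= t ->
  growth_le (fun n => x n ^+ 2) t -> growth_le x (Num.sqrt t).
Proof.
move=> x0 t0 h r tr; have r0 : 0 < r by apply: le_lt_trans tr; exact: sqrtr_ge0.
have [|C hC] := h (r ^+ 2).
  by rewrite -(sqr_sqrtr t0) ltrXn2r ?nnegrE ?sqrtr_ge0 // ltW.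
have C0 : 0 <= C.
  by have := hC 0%N; rewrite expr0 mulr1; apply: le_trans; exact: sqr_ge0.
exists (Num.sqrt C) => n.
rewrite -(@ler_pXn2r _ 2) ?nnegrE ?x0 ?mulr_ge0 ?sqrtr_ge0 ?exprn_ge0 ?(ltW r0) //.
by rewrite exprMn sqr_sqrtr // exprAC; exact: hC.
Qed.

Lemma bernoulli_le (e : R) n : 0 <= e -> 1 + n%:R * e <= (1 + e) ^+ n.
Proof.
move=> e0; elim: n => [|n IH]; first by rewrite mul0r addr0 expr0.
rewrite exprS; apply: le_trans (_ : (1 + e) * (1 + n%:R * e) <= _).
  rewrite -natr1; have : 0 <= n%:R * e * e by rewrite !mulr_ge0.
  lra.
by rewrite ler_wpM2l // addr_ge0.
Qed.

(** The gap between [M] and [r] swallows the factor [n.+1]: by Bernoulli's inequality it is at most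
    a constant times [(1 + e) ^+ n]. *)
Lemma growth_linear x M : 0 <= M -> (forall n, 0 <= x n) -> growth_le x M ->
  growth_le (fun n => n.+1%:R * x n) M.
Proof.
move=> M0 x0 h r Mr; pose s := (M + r) / 2.
have s0 : 0 < s by rewrite /s; lra.
have [|C hC] := h s; first by rewrite /s; lra.
pose e := r / s - 1.
have e0 : 0 < e by rewrite /e subr_gt0 ltr_pdivlMr // mul1r /s; lra.
have C0 : 0 <= C by have := hC 0%N; rewrite expr0 mulr1; exact: le_trans.
exists ((1 + e^-1) * C) => n.
have -> : r = s * (1 + e) by rewrite /e addrCA subrr addr0 mulrC divfK // gt_eqF.
clearbody e; clear Mr.
have h1 : n.+1%:R <= (1 + e^-1) * (1 + e) ^+ n.
  apply: le_trans (_ : (1 + e^-1) * (1 + n%:R * e) <= _); last first.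
    by rewrite ler_wpM2l ?bernoulli_le ?addr_ge0 ?invr_ge0 ?(ltW e0).
  have -> : (1 + e^-1) * (1 + n%:R * e) = n%:R + 1 + n%:R * e + e^-1.
    by field; rewrite gt_eqF.
  rewrite -natr1; have : 0 <= n%:R * e by rewrite mulr_ge0 // ltW.
  have : 0 <= e^-1 by rewrite invr_ge0 ltW.
  lra.
rewrite exprMn.
have -> : (1 + e^-1) * C * (s ^+ n * (1 + e) ^+ n) =
  ((1 + e^-1) * (1 + e) ^+ n) * (C * s ^+ n) by ring.
by apply: ler_pM.
Qed.

Lemma growth_sum x M : 1 <= M -> (forall n, 0 <= x n) -> growth_le x M ->
  growth_le (fun n => \sum_(j < n.+1) x j) M.
Proof.
move=> M1 x0 h r Mr; pose s := (M + r) / 2.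
have s1 : 1 <= s by rewrite /s; lra.
have [|C hC] := h s; first by rewrite /s; lra.
have C0 : 0 <= C by have := hC 0%N; rewrite expr0 mulr1; exact: le_trans.
have sn0 n : 0 <= C * s ^+ n by rewrite mulr_ge0 // exprn_ge0 //; lra.
have [|||D hD] := @growth_linear (fun n => C * s ^+ n) s _ sn0 _ r.
- by lra.
- by move=> q sq; exists C => n; rewrite ler_wpM2l // lerXn2r ?nnegrE; lra.
- by rewrite /s; lra.
exists D => n; apply: le_trans (hD n).
rewrite mulr_natl -[X in _ *+ X]card_ord -sumr_const ler_sum // => j _.
apply: (le_trans (hC j)); rewrite ler_wpM2l //.
by apply: ler_weXn2l => //; rewrite -ltnS.
Qed.
End ExponentialGrowth.

Section TwistedGrowth.
Context (R : realType) (zeta : substitution).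
Variables (w V : nat -> letter -> R[i]).
Hypothesis wS : forall j, w j.+1 = next_phase zeta (w j).
Hypothesis VS : forall j, V j.+1 = next_sum zeta (w j) (V j).
Hypothesis wu : unit_phases w.

Lemma nsq_phase j u : nsq (phase (w j) u) = 1.
Proof. by rewrite /phase nsq_prod big1. Qed.

Lemma cmod_phase j u : cmod (phase (w j) u) = 1.
Proof. by rewrite /cmod nsq_phase sqrtr1. Qed.

Lemma cmod_tsum j (U : letter -> R[i]) u m :
  (forall b, cmod (U b) <= m) -> cmod (tsum (w j) U u) <= (size u)%:R * m.
Proof.
move=> hm; elim: u => [|b u IH] /=; first by rewrite cmod0 mul0r.
apply: (le_trans (cmodD _ _)); rewrite cmodM {2}/cmod wu sqrtr1 mul1r.
by rewrite -natr1 mulrDl mul1r addrC lerD.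
Qed.

Lemma cmod_tsum_ind j c u : cmod (tsum (w j) (letter_ind _ c) u) <= (size u)%:R.
Proof.
rewrite -[leRHS]mulr1; apply: cmod_tsum => b.
by rewrite /letter_ind; case: eqP => _; rewrite ?cmod1 ?cmod0.
Qed.

Lemma cocycle_det_bounded : exists K : R, forall j, nsq (cocycle_det zeta (w j)) <= K.
Proof.
pose B : R := (size (zeta l0) + size (zeta l1))%:R.
have B0 : 0 <= B by rewrite ler0n.
have h0 : (size (zeta l0))%:R <= B by rewrite ler_nat leq_addr.
have h1 : (size (zeta l1))%:R <= B by rewrite ler_nat leq_addl.
exists ((B * B + B * B) ^+ 2) => j; rewrite -cmod_sqr.
rewrite lerXn2r ?nnegrE ?cmod_ge0 ?addr_ge0 ?mulr_ge0 //.
apply: (le_trans (cmodB _ _)); rewrite !cmodM.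
by apply: lerD; apply: ler_pM; rewrite ?cmod_ge0 // (le_trans (cmod_tsum_ind _ _ _)).
Qed.

Lemma cross_prod n : nsq (cross (w n) (V n)) =
  nsq (cross (w 0%N) (V 0%N)) * \prod_(j < n) nsq (cocycle_det zeta (w j)).
Proof.
elim: n => [|n IH]; first by rewrite big_ord0 mulr1.
by rewrite wS VS cross_next nsqM IH big_ord_recr /=; ring.
Qed.

Variables (c t : R).
Hypothesis c0 : 0 < c.
Hypothesis w_far : forall j b, c <= cmod (1 - w j b) * j.+1%:R ^+ 2.
Hypothesis t1 : 1 <= t.
Hypothesis det_gmean : gmean_le (fun j => nsq (cocycle_det zeta (w j))) t.

Let M := Num.sqrt t.

Let M1 : 1 <= M.
Proof. by rewrite -[leLHS]sqrtr1 ler_wsqrtr. Qed.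

Let M0 : 0 <= M. Proof. exact: le_trans M1. Qed.

Lemma cross_growth : growth_le (fun n => cmod (cross (w n) (V n))) M.
Proof.
apply: growth_sqrt; [by move=> j; exact: cmod_ge0|exact: le_trans t1|].
apply: (@growth_mono _ _ (fun n => \prod_(j < n) nsq (cocycle_det zeta (w j)))
   _ (nsq (cross (w 0%N) (V 0%N)))).
- exact: nsq_ge0.
- by move=> n; rewrite cmod_sqr cross_prod.
apply: (growth_gmean (x := fun j => nsq (cocycle_det zeta (w j)))) => //; [by move=> j; exact: nsq_ge0|exact: le_trans t1].
Qed.

Lemma oneBw_neq0 j b : 1 - w j b != 0.
Proof.
apply/eqP => h; have := w_far j b.
by rewrite h cmod0 mul0r leNgt c0.
Qed.

Lemma oneBw_inv j b : cmod (1 - w j b)^-1 <= j.+1%:R ^+ 2 / c.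
Proof.
have m0 : 0 < cmod (1 - w j b).
  rewrite lt_neqAle cmod_ge0 andbT eq_sym -sqrf_eq0 cmod_sqr nsq_eq0.
  exact: oneBw_neq0.
by rewrite cmodV ler_pdivlMr // mulrC ler_pdivrMr // mulrC; exact: w_far.
Qed.

Let slope n := cmod (V n l0 / (1 - w n l0)).

(** Four nested linear factors rather than a fourth power, so that [growth_linear] applies four
    times. *)
Let pterm j := j.+1%:R * (j.+1%:R * (j.+1%:R * (j.+1%:R *
  cmod (cross (w j) (V j))))).

(** This is [next_sum_slope] over its two denominators. Each inverse costs a square over [c], and
    [n + 2 <= 2 (n + 1)] produces the 4. *)
Lemma slope_step n : slope n.+1 <=
  slope n + (size (zeta l0))%:R * 4 / c ^+ 2 * pterm n.
Proof.
have -> : slope n.+1 = cmod (V n l0 / (1 - w n l0) -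
    tsum (w n) (letter_ind _ l1) (zeta l0) * cross (w n) (V n) *
    ((1 - w n l0)^-1 * (1 - w n.+1 l0)^-1)).
  rewrite /slope; congr cmod; rewrite VS.
  have := next_sum_slope zeta (w n) (V n); rewrite -wS => /eqP.
  have a0 := oneBw_neq0 n l0; have b0 := oneBw_neq0 n.+1 l0.
  move: (next_sum zeta (w n) (V n) l0) (V n l0) (1 - w n l0) (1 - w n.+1 l0) a0 b0.
  move=> x y a b a0 b0; rewrite subr_eq => /eqP e.
  apply: (mulIf a0); apply: (mulIf b0).
  by rewrite mulrAC divfK // e; field; rewrite a0 b0.
apply: (le_trans (cmodB _ _)); rewrite lerD2l !cmodM.
have := cmod_tsum_ind n l1 (zeta l0).
set T := cmod (tsum _ _ _); set X := cmod (cross _ _) => hT.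
have hi := oneBw_inv n l0; have hj := oneBw_inv n.+1 l0.
have hj' : cmod (1 - w n.+1 l0)^-1 <= 4 * n.+1%:R ^+ 2 / c.
  apply: (le_trans hj); rewrite ler_pM2r ?invr_gt0 //.
  rewrite -[4](_ : 2 ^+ 2 = 4); last by rewrite expr2; lra.
  rewrite -exprMn lerXn2r ?nnegrE ?mulr_ge0 ?ler0n //.
  by rewrite -!natr1; have := ler0n R n; lra.
have -> : (size (zeta l0))%:R * 4 / c ^+ 2 * pterm n =
  ((size (zeta l0))%:R * X) * ((n.+1%:R ^+ 2 / c) * (4 * n.+1%:R ^+ 2 / c)).
  by rewrite /pterm -/X; field; rewrite gt_eqF.
by apply: ler_pM; rewrite ?mulr_ge0 ?cmod_ge0 //; apply: ler_pM; rewrite ?cmod_ge0.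
Qed.

Lemma pterm_ge0 n : 0 <= pterm n.
Proof. by rewrite !mulr_ge0 ?ler0n ?cmod_ge0. Qed.

Lemma pterm_growth : growth_le pterm M.
Proof.
by do 4 (apply: growth_linear => //; first by move=> n; rewrite ?mulr_ge0 ?ler0n ?cmod_ge0); exact: cross_growth.
Qed.

Lemma slope_growth : growth_le slope M.
Proof.
set D := (size (zeta l0))%:R * 4 / c ^+ 2.
have D0 : 0 <= D by rewrite divr_ge0 ?exprn_ge0 ?mulr_ge0 ?ler0n ?(ltW c0).
have h n : slope n <= slope 0 + D * \sum_(j < n.+1) pterm j.
  apply: (@le_trans _ _ (slope 0 + D * \sum_(j < n) pterm j)); last first.
    by rewrite big_ord_recr /= lerD2l ler_wpM2l // lerDl pterm_ge0.
  elim: n => [|n IH]; first by rewrite big_ord0 mulr0 addr0.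
  apply: (le_trans (slope_step n)); rewrite big_ord_recr /= [X in _ <= _ + X]mulrDr addrA -/D.
  by rewrite lerD2r.
apply: (@growth_mono _ _ (fun n => slope 0 + D * \sum_(j < n.+1) pterm j) _ 1) => //.
  by move=> n; rewrite mul1r.
apply: growthD; first by apply: growth_bounded => //; exact: cmod_ge0.
apply: (growth_mono D0 (fun n => lexx _)).
by apply: growth_sum => //; [exact: pterm_ge0|exact: pterm_growth].
Qed.

Lemma oneBw_le2 j b : cmod (1 - w j b) <= 2.
Proof.
apply: (le_trans (cmodB _ _)); rewrite cmod1 /cmod wu sqrtr1; lra.
Qed.

Lemma V0_growth : growth_le (fun n => cmod (V n l0)) M.
Proof.
apply: growth_mono _ _ slope_growth => [|n]; first exact: ler0n 2.
rewrite /slope cmodM mulrCA -[leLHS]mulr1 ler_wpM2l ?cmod_ge0 //.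
rewrite cmodV ler_pdivlMr ?mul1r ?oneBw_le2 //.
rewrite lt_neqAle cmod_ge0 andbT eq_sym -sqrf_eq0 cmod_sqr nsq_eq0.
exact: oneBw_neq0.
Qed.

(** The second coordinate is recovered from the first one and [cross], with one more division by
    [1 - w l0]. *)
Lemma V1_growth : growth_le (fun n => cmod (V n l1)) M.
Proof.
have h n : cmod (V n l1) <= c^-1 * (n.+1%:R * (n.+1%:R *
    (2 * cmod (V n l0) + cmod (cross (w n) (V n))))).
  have -> : V n l1 = (V n l0 * (1 - w n l1) - cross (w n) (V n)) / (1 - w n l0).
    by rewrite /cross; field; exact: oneBw_neq0.
  rewrite cmodM mulrC.
  have -> : c^-1 * (n.+1%:R * (n.+1%:R *
    (2 * cmod (V n l0) + cmod (cross (w n) (V n))))) = n.+1%:R ^+ 2 / c *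
    (2 * cmod (V n l0) + cmod (cross (w n) (V n))) by ring.
  apply: ler_pM; rewrite ?cmod_ge0 ?oneBw_inv //.
  apply: (le_trans (cmodB _ _)); rewrite lerD2r cmodM mulrC.
  by rewrite ler_wpM2r ?cmod_ge0 ?oneBw_le2.
have ci : 0 <= c^-1 by rewrite invr_ge0 ltW.
apply: (growth_mono ci h).
have p n : 0 <= 2 * cmod (V n l0) + cmod (cross (w n) (V n)).
  by rewrite addr_ge0 ?mulr_ge0 ?cmod_ge0.
apply: growth_linear => // [n|]; first by rewrite mulr_ge0.
apply: growth_linear => //; apply: growthD; last exact: cross_growth.
exact: growth_mono (ler0n _ 2) (fun n => lexx _) V0_growth.
Qed.

(** Summing over the levels makes the quantity monotone in [n], so that it bounds the contributions
    of all levels of a parsed word at once. *)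
Definition levels n := \sum_(j < n.+1) (cmod (V j l0) + cmod (V j l1)).

Lemma levels_growth : growth_le levels M.
Proof.
apply: (growth_sum (x := fun j => cmod (V j l0) + cmod (V j l1))) => //; first by move=> n; rewrite addr_ge0 ?cmod_ge0.
exact: growthD V0_growth V1_growth.
Qed.

End TwistedGrowth.

Section SubwordBound.
Context (R : realType) (zeta : substitution).
Variables (w V : nat -> letter -> R[i]).
Hypothesis wS : forall j, w j.+1 = next_phase zeta (w j).
Hypothesis VS : forall j, V j.+1 = next_sum zeta (w j) (V j).
Hypothesis wu : unit_phases w.

Local Notation sub k := (iter k (subst_word zeta)).

Lemma subst_word_cat u v : subst_word zeta (u ++ v) = subst_word zeta u ++ subst_word zeta v.
Proof. by rewrite /subst_word map_cat flatten_cat. Qed.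

Lemma iter_subst_cat k u v : sub k (u ++ v) = sub k u ++ sub k v.
Proof. by elim: k => //= k ->; rewrite subst_word_cat. Qed.

Lemma iter_subst_flatten k u : sub k u = flatten [seq sub k [:: b] | b <- u].
Proof.
elim: u => [|b u IH] /=; first by elim: k => //= k ->.
by rewrite -IH -iter_subst_cat.
Qed.

Lemma tsum_iter k u : tsum (w 0%N) (V 0%N) (sub k u) = tsum (w k) (V k) u.
Proof.
elim: k u => [//|k IH] u.
by rewrite iterSr IH tsum_subst wS VS.
Qed.

Local Notation lev := (levels V).

Lemma levels_ge j k : (j <= k)%N -> forall b, cmod (V j b) <= lev k.
Proof.
move=> jk b; rewrite /levels -ltnS in jk *.
rewrite (bigD1 (Ordinal jk)) //= -[leLHS]addr0 lerD //; last first.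
  by rewrite sumr_ge0 // => i _; rewrite addr_ge0 ?cmod_ge0.
by elim/letter_case: b; rewrite ?lerDl ?lerDr ?cmod_ge0.
Qed.

Lemma levels_ge0 k : 0 <= lev k.
Proof. by rewrite sumr_ge0 // => i _; rewrite addr_ge0 ?cmod_ge0. Qed.

Let image_size : nat := (1 + (size (zeta l0) + size (zeta l1)))%N.

Let image_size_ge b : (size (zeta b) <= image_size)%N.
Proof. by elim/letter_case: b; rewrite /image_size; lia. Qed.

Let lsum j := cmod (V j l0) + cmod (V j l1).

Let lsum_ge0 j : 0 <= lsum j. Proof. by rewrite addr_ge0 ?cmod_ge0. Qed.

Let lsum_ge j b : cmod (V j b) <= lsum j.
Proof. by elim/letter_case: b; rewrite /lsum ?lerDl ?lerDr ?cmod_ge0. Qed.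

(** Dumont-Thomas decomposition: a prefix of [zeta^k(zeta(b))] is the [k]-th image of a prefix of
    [zeta(b)] followed by a prefix of some [zeta^k(d)]. Each level thus contributes at most
    [image_size] letters. *)
Lemma prefix_bound_sum k b v : prefix v (sub k [:: b]) ->
  cmod (tsum (w 0%N) (V 0%N) v) <= lsum 0 + image_size%:R * \sum_(j < k) lsum j.
Proof.
elim: k b v => [|k IH] b v.
  rewrite big_ord0 mulr0 addr0.
  case: v => [|a [|a' v]] /=; first by rewrite cmod0 lsum_ge0.
    by move=> /andP[/eqP -> _]; rewrite mulr0 addr0 lsum_ge.
  by rewrite andbF.
rewrite iterSr (_ : subst_word zeta [:: b] = zeta b); last first.
  by rewrite /subst_word /= cats0.
rewrite iter_subst_flatten.
move=> /prefix_flatten[q [p [-> hq hp]]].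
rewrite tsum_cat -iter_subst_flatten tsum_iter.
apply: (le_trans (cmodD _ _)); rewrite cmodM (cmod_phase wu) mul1r.
rewrite big_ord_recr /= mulrDr addrA addrC lerD //; last first.
  case: hp => [->|[d /IH //]].
  by rewrite /= cmod0 addr_ge0 ?lsum_ge0 ?mulr_ge0 ?ler0n ?sumr_ge0.
apply: (le_trans (cmod_tsum wu _ _ (@lsum_ge k))).
rewrite ler_wpM2r ?lsum_ge0 // ler_nat (leq_trans _ (image_size_ge b)) //.
exact: size_prefix.
Qed.

Lemma prefix_bound k b v : prefix v (sub k [:: b]) ->
  cmod (tsum (w 0%N) (V 0%N) v) <= image_size.+1%:R * lev k.
Proof.
move=> /prefix_bound_sum h; apply: (le_trans h).
have h0 : lsum 0 <= lev k.
  by rewrite /levels big_ord_recl lerDl sumr_ge0 // => j _; exact: lsum_ge0.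
have h1 : \sum_(j < k) lsum j <= lev k.
  by rewrite /levels [leRHS]big_ord_recr /= lerDl lsum_ge0.
by rewrite -natr1 mulrDl mul1r addrC lerD // ler_wpM2l ?ler0n.
Qed.

(** Up to a phase of modulus 1, the sum along a factor is the difference of the sums along two
    prefixes. *)
Lemma infix_bound k b v : infix v (sub k [:: b]) ->
  cmod (tsum (w 0%N) (V 0%N) v) <= 2 * (image_size.+1%:R * lev k).
Proof.
move=> /infixP[x [y e]].
have /prefix_bound hx : prefix x (sub k [:: b]) by rewrite e prefix_prefix.
have /prefix_bound hxv : prefix (x ++ v) (sub k [:: b]).
  by rewrite e catA prefix_prefix.
have -> : cmod (tsum (w 0%N) (V 0%N) v) =
    cmod (tsum (w 0%N) (V 0%N) (x ++ v) - tsum (w 0%N) (V 0%N) x).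
  by rewrite tsum_cat addrC addKr cmodM (cmod_phase wu) mul1r.
by apply: (le_trans (cmodB _ _)); rewrite mulr_natl mulr2n lerD.
Qed.

(** The size inequality serves to bound the number of letters of [q] once the lengths of iterated
    words are known. *)
Lemma subword_bound k U u : infix u (sub k U) ->
  exists q, (size (sub k q) <= size u)%N /\ cmod (tsum (w 0%N) (V 0%N) u) <= (4 * image_size.+1%:R + (size q)%:R) * lev k.
Proof.
rewrite iter_subst_flatten => /infix_flatten[x [q [p [-> _ hx hp]]]].
exists q; rewrite -iter_subst_flatten; split.
  by rewrite !size_cat addnCA leq_addr.
have hb y : y = [::] \/ (exists b, infix y (sub k [:: b])) ->
    cmod (tsum (w 0%N) (V 0%N) y) <= 2 * (image_size.+1%:R * lev k).
  case=> [->|[b /infix_bound //]].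
  by rewrite /= cmod0 !mulr_ge0 ?ler0n ?levels_ge0.
rewrite !tsum_cat tsum_iter.
apply: (le_trans (cmodD _ _)); rewrite cmodM (cmod_phase wu) mul1r.
have h1 := hb x hx; have h2 := hb p hp.
have : cmod (tsum (w k) (V k) q + phase (w 0) (sub k q) * tsum (w 0) (V 0) p) <=
   (size q)%:R * lev k + 2 * (image_size.+1%:R * lev k).
  apply: (le_trans (cmodD _ _)); rewrite cmodM (cmod_phase wu) mul1r lerD //.
  by apply: cmod_tsum => //; exact: levels_ge.
lra.
Qed.
End SubwordBound.

(** * The conditions (i)-(iii) *)

Section Marks.
Context (R : realType).
Implicit Types (w : letter -> R[i]) (u : seq letter) (m e : nat * nat).

Definition next_mark m (b : letter) : nat * nat :=
  if b == l0 then (m.1.+1, m.2) else (m.1, m.2.+1).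

(** Exponents of the monomials of [tsum w (letter_ind _ c) u], shifted by [m]: each occurrence of
    [c] records how many letters of either kind precede it. *)
Fixpoint marks (c : letter) m u : seq (nat * nat) :=
  if u is b :: u' then
    (if b == c then [:: m] else [::]) ++ marks c (next_mark m b) u'
  else [::].

Lemma mon_next_mark w m b : mon w (next_mark m b) = mon w m * w b.
Proof. by rewrite /mon /next_mark; elim/letter_case: b => /=; rewrite exprSr; ring. Qed.

Lemma sum_marks w c m u : \sum_(e <- marks c m u) mon w e =
  mon w m * tsum w (letter_ind _ c) u.
Proof.
elim: u m => [|b u IH] m /=; first by rewrite big_nil mulr0.
rewrite big_cat IH mon_next_mark /letter_ind mulrDr mulrA; congr (_ + _).
by case: eqP => _; rewrite ?big_nil ?big_seq1 ?mulr0 ?mulr1.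
Qed.

Lemma size_marks c m u : size (marks c m u) = count_mem c u.
Proof. by elim: u m => [//|b u IH] m /=; rewrite size_cat IH; case: eqP. Qed.

Lemma marks_ge c m u e : e \in marks c m u -> (m.1 + m.2 <= e.1 + e.2)%N.
Proof.
elim: u m => [//|b u IH] m /=; rewrite mem_cat => /orP[|/IH].
  by case: eqP => // _; rewrite inE => /eqP ->.
by rewrite /next_mark; case: eqP => _ /=; lia.
Qed.

(** The total degree increases with every letter. Hence the monomials are distinct, and the squared
    L2 norm is their number. *)
Lemma marks_uniq c m u : uniq (marks c m u).
Proof.
elim: u m => [//|b u IH] m /=.
rewrite cat_uniq IH andbT; case: eqP => _ //=; last by rewrite has_sym.
apply/negP => /hasP[e he]; rewrite inE => /eqP ee; move: he; rewrite ee => /marks_ge.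
by rewrite /next_mark; case: eqP => _ /=; lia.
Qed.

End Marks.

Section MahlerData.
Context (R : realType) (zeta : substitution).
Implicit Types (w : letter -> R[i]).

(** Each list has one term per letter [l0] in the two images together, whence the factor 2 in
    condition (i). *)
Lemma mahler_large0 : mahler_data R zeta
  (marks l0 (0, 0)%N (zeta l0 ++ zeta l1)) (marks l0 (0, 0)%N (zeta l1 ++ zeta l0))
  [::] [:: (0, 1)%N].
Proof.
split=> //; [exact: marks_uniq|exact: marks_uniq|] => w.
rewrite !big_nil big_seq1 !sum_marks mon00 !mul1r mulr1 -cocycle_det_commute0.
by rewrite /mon /= expr0 mul1r expr1.
Qed.

Lemma mahler_large1 : mahler_data R zeta
  (marks l1 (0, 0)%N (zeta l1 ++ zeta l0)) (marks l1 (0, 0)%N (zeta l0 ++ zeta l1))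
  [::] [:: (1, 0)%N].
Proof.
split=> //; [exact: marks_uniq|exact: marks_uniq|] => w.
rewrite !big_nil big_seq1 !sum_marks mon00 !mul1r mulr1.
rewrite -[RHS]opprB -cocycle_det_commute1 mulNr opprK.
by rewrite /mon /= expr0 mulr1 expr1.
Qed.

Lemma phase_nseq w n b : phase w (nseq n b) = w b ^+ n.
Proof. by elim: n => [|n IH]; rewrite /phase ?big_nil //= big_cons -/(phase _ _) IH exprS. Qed.

Lemma tsum_nseq w n c : tsum w (letter_ind _ c) (nseq n c) * (1 - w c) = 1 - w c ^+ n.
Proof.
elim: n => [|n IH] /=; first by rewrite mul0r expr0 subrr.
by rewrite mulrDl -mulrA IH /letter_ind eqxx exprS mulr1n; ring.
Qed.

Lemma tsum_absent w c u : c \notin u -> tsum w (letter_ind _ c) u = 0.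
Proof.
elim: u => [//|b u IH]; rewrite in_cons negb_or eq_sym => /andP[bc /IH /= ->].
by rewrite /letter_ind (negPf bc) mulr0 addr0.
Qed.

(** As [l1] does not occur in [zeta l1], the determinant is a product. Its factor from [zeta l1] is
    a geometric sum, of Mahler measure 1, so only the letters [l1] of [zeta l0] are counted. *)
Lemma mahler_zero C : zeta l1 = nseq C l0 -> (0 < C)%N ->
  mahler_data R zeta [::] (marks l1 (0, 0)%N (zeta l0)) [:: (C, 0)%N] [:: (1, 0)%N].
Proof.
move=> z1 C0; split => //; first exact: marks_uniq.
  by rewrite inE xpair_eqE eqxx andbT eq_sym -lt0n.
move=> w; rewrite big_nil !big_seq1 sum_marks mon00 mul1r sub0r /cocycle_det z1.
rewrite (tsum_absent w (c := l1)) ?mulr0 ?sub0r; last first.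
  by rewrite mem_nseq negb_and orbT.
rewrite /mon /= expr0 !mulr1 expr1 -tsum_nseq; ring.
Qed.

(** With images made of two runs all sums are geometric, and clearing the denominators [1 - w l0]
    and [1 - w l1] leaves six monomials: the 6 of condition (iii). *)
Lemma mahler_block A B C D : zeta l0 = nseq A l0 ++ nseq B l1 ->
  zeta l1 = nseq C l1 ++ nseq D l0 ->
  (0 < A)%N -> (0 < B)%N -> (0 < C)%N -> (0 < D)%N ->
  mahler_data R zeta [:: (0, 0); (A, B + C); (A + D, C)]%N
    [:: (A, 0); (A + D, B + C); (0, C)]%N [::] [:: (0, 1); (1, 0)]%N.
Proof.
move=> z0 z1 A0 B0 C0 D0; split => //.
- rewrite /= !inE !xpair_eqE; lia.
- rewrite /= !inE !xpair_eqE; lia.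
move=> w; rewrite !big_cons !big_nil !addr0 !mulr1 mulrA.
have -> : 1 - mon w (0, 1)%N = 1 - w l1 by rewrite /mon /= expr0 mul1r expr1.
have -> : 1 - mon w (1, 0)%N = 1 - w l0 by rewrite /mon /= expr0 mulr1 expr1.
rewrite cocycle_det_commute0 z0 z1 !tsum_cat !phase_cat !phase_nseq.
have a n : tsum w (letter_ind _ l0) (nseq n l1) = 0.
  by apply: tsum_absent; rewrite mem_nseq negb_and orbT.
rewrite !a !mulr0 !add0r !addr0 mulrBl !mulrDl -!mulrA !tsum_nseq.
rewrite /mon /= !expr0 !exprD; ring.
Qed.

Lemma matrix_count A B C D : (subst_matrix zeta)^T = matrix22 A B C D ->
  [/\ count_mem l0 (zeta l0) = A, count_mem l1 (zeta l0) = B,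
      count_mem l0 (zeta l1) = C & count_mem l1 (zeta l1) = D].
Proof.
move=> /matrixP h.
have := h l0 l0; have := h l0 l1; have := h l1 l0; have := h l1 l1.
by rewrite !mxE /=; do 4 case=> ?.
Qed.

Lemma nseq_absent u : count_mem l1 u = 0%N -> u = nseq (count_mem l0 u) l0.
Proof.
elim: u => [//|b u IH] /=; elim/letter_case: b => //= /IH e.
by rewrite {1}e.
Qed.

End MahlerData.

(** * Lengths of iterated words *)

Section Lengths.
Context (zeta : substitution).
Local Notation A := (count_mem l0 (zeta l0)).
Local Notation B := (count_mem l1 (zeta l0)).
Local Notation C := (count_mem l0 (zeta l1)).
Local Notation D := (count_mem l1 (zeta l1)).

Definition len n (b : letter) : nat := size (iter n (subst_word zeta) [:: b]).

Lemma size_iter n u : size (iter n (subst_word zeta) u) =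
  (count_mem l0 u * len n l0 + count_mem l1 u * len n l1)%N.
Proof.
elim: u => [|b u IH]; first by elim: n => //= n /size0nil ->.
have -> : iter n (subst_word zeta) (b :: u) =
    iter n (subst_word zeta) [:: b] ++ iter n (subst_word zeta) u.
  elim: n {IH} => //= n ->; by rewrite /subst_word map_cat flatten_cat.
rewrite size_cat IH -/(len n b) /=; elim/letter_case: b => /=; rewrite /l0 /l1 /=; lia.
Qed.

Lemma lenS0 n : len n.+1 l0 = (A * len n l0 + B * len n l1)%N.
Proof. by rewrite {1}/len iterSr size_iter /subst_word /= cats0. Qed.

Lemma lenS1 n : len n.+1 l1 = (C * len n l0 + D * len n l1)%N.
Proof. by rewrite {1}/len iterSr size_iter /subst_word /= cats0. Qed.

Lemma len_gt0 n b : (0 < len n b)%N.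
Proof.
elim: n b => [//|n IH] b; rewrite /len iterSr size_iter.
rewrite (_ : subst_word zeta [:: b] = zeta b); last by rewrite /subst_word /= cats0.
have : (0 < count_mem l0 (zeta b) + count_mem l1 (zeta b))%N.
  case: (zeta b) (subst_neq0 zeta b) => // a u _.
  by elim/letter_case: a => /=; rewrite /l0 /l1 /=; lia.
by rewrite !addn_gt0 !muln_gt0 !IH !andbT.
Qed.

Definition combo (h : int * int) (n : nat) : int :=
  h.1 * (len n l0)%:Z + h.2 * (len n l1)%:Z.

(** Cayley-Hamilton for the substitution matrix. *)
Lemma combo_rec h n : combo h n.+2 =
  (A + D)%:Z * combo h n.+1 - (A%:Z * D%:Z - B%:Z * C%:Z) * combo h n.
Proof.
rewrite /combo (lenS0 n.+1) (lenS1 n.+1) !lenS0 !lenS1 !PoszD !PoszM !PoszD !PoszM.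
ring.
Qed.

Hypothesis irr : forall p q : int, q != 0 ->
  p ^+ 2 - (A + D)%:Z * p * q + (A%:Z * D%:Z - B%:Z * C%:Z) * q ^+ 2 != 0.

(** If both values vanished, the two images would have the same length, and this length would be an
    integer eigenvalue. *)
Lemma combo_init_neq0 h : h != (0, 0) -> combo h 0 = 0 -> combo h 1 != 0.
Proof.
case: h => p q h0; rewrite /combo /= lenS0 lenS1 /len /= !mulr1 !muln1 => e.
have {}e : q = - p by apply/eqP; rewrite -subr_eq0 opprK addrC e.
rewrite e; rewrite e xpair_eqE oppr_eq0 andbb in h0.
have := irr ((A + B)%:Z) (oner_neq0 _); apply: contraNneq => h1.
have {}h1 : (A + B)%:Z = (C + D)%:Z.
  apply/eqP; rewrite -subr_eq0; apply/eqP/(mulfI h0); rewrite mulr0 -h1; ring.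
rewrite mulr1 expr1n mulr1; apply/eqP.
have -> : (A + D)%:Z = (A + B)%:Z - B%:Z + D%:Z by rewrite !PoszD; ring.
have -> : C%:Z = (A + B)%:Z - D%:Z by rewrite h1 PoszD; ring.
by rewrite PoszD; ring.
Qed.

Context (R : realType) (theta : R).
Hypothesis th1 : 1 < theta.
Hypothesis th_root : theta ^+ 2 - (A + D)%:R * theta + (A%:R * D%:R - B%:R * C%:R) = 0.

Let th2 := (A + D)%:R - theta.
Hypothesis th2_lt : `|th2| < theta.

Let th2_root : th2 ^+ 2 - (A + D)%:R * th2 + (A%:R * D%:R - B%:R * C%:R) = 0.
Proof. by rewrite -[RHS]th_root /th2; ring. Qed.

(** Binet's formula, multiplied by [theta - th2] to avoid a division. If [e] were 0 with [combo h 0]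
    nonzero, the root [th2] would be a quotient of two integers, against irreducibility. *)
Lemma combo_closed h : h != (0, 0) -> exists e f : R, e != 0 /\
  forall n, (theta - th2) * (combo h n)%:~R = e * theta ^+ n - f * th2 ^+ n.
Proof.
move=> h0; set a := fun n => (combo h n)%:~R : R.
have arec n : a n.+2 = (theta + th2) * a n.+1 - theta * th2 * a n.
  have -> : theta + th2 = (A + D)%:R by rewrite /th2; ring.
  have -> : theta * th2 = A%:R * D%:R - B%:R * C%:R.
    by rewrite /th2; have := th_root; move=> /eqP; rewrite addr_eq0 => /eqP; lra.
  by rewrite /a combo_rec rmorphB !rmorphM rmorphB !rmorphM.
have he n : a n.+1 - th2 * a n = (a 1%N - th2 * a 0%N) * theta ^+ n.
  elim: n => [|n IH]; first by rewrite expr0 mulr1.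
  by rewrite exprS mulrCA -IH arec; ring.
have hf n : a n.+1 - theta * a n = (a 1%N - theta * a 0%N) * th2 ^+ n.
  elim: n => [|n IH]; first by rewrite expr0 mulr1.
  by rewrite exprS mulrCA -IH arec; ring.
exists (a 1%N - th2 * a 0%N), (a 1%N - theta * a 0%N); split; last first.
  by move=> n; rewrite -he -hf /a; ring.
apply/eqP => e0.
have [a0|a0] := eqVneq (combo h 0) 0.
  have := combo_init_neq0 h0 a0.
  by move: e0; rewrite /a a0 mulr0 subr0 => /eqP; rewrite intr_eq0 => ->.
have /eqP := irr (combo h 1) a0; apply.
apply: (@intr_inj R); rewrite rmorphD rmorphB !rmorphM rmorphB !rmorphM /=.
have e1 : a 1%N = th2 * a 0%N by apply/eqP; rewrite -subr_eq0 e0.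
rewrite -/(a 1%N) -/(a 0%N) e1 [RHS]mulr0z.
have := th2_root => /(congr1 (fun x => x * a 0%N ^+ 2)); rewrite mul0r => <-.
by rewrite -[(A + D)%:~R]/((A + D)%:R) ; ring.
Qed.

(** The second eigenvalue may have modulus below 1; the maximum makes the bounding powers
    nondecreasing. *)
Let mu := Num.max 1 `|th2|.

Let mu_lt : mu < theta. Proof. by rewrite gt_max th1. Qed.

Let mu1 : 1 <= mu. Proof. by rewrite le_max lexx. Qed.

Let th20 : 0 < theta - th2.
Proof. by rewrite subr_gt0; apply: le_lt_trans th2_lt; exact: ler_norm. Qed.

Let th2X i j : (i <= j)%N -> `|th2 ^+ i| <= mu ^+ j.
Proof.
move=> ij; rewrite normrX; apply: (@le_trans _ _ (mu ^+ i)).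
  have ht : `|th2| <= mu by rewrite /mu le_max lexx orbT.
  by apply: lerXn2r => //; rewrite nnegrE ?normr_ge0 //; exact: le_trans ht.
by rewrite ler_weXn2l.
Qed.

Lemma mu_small (d : R) : 0 < d -> exists n0, forall n, (n0 <= n)%N ->
  mu ^+ n <= d * theta ^+ n.
Proof.
move=> d0; have t0 : 0 < theta by exact: lt_trans th1.
have hc : (fun n => (mu / theta) ^+ n : R^o) @ \oo --> (0 : R).
  apply: cvg_expr; rewrite ger0_norm; last by rewrite divr_ge0 ?ltW // (lt_le_trans _ mu1).
  by rewrite ltr_pdivrMr // mul1r.
have [n0 _ h] := cvgr_le (0 : R) hc _ d0.
exists n0 => n /h /=.
by rewrite expr_div_n ler_pdivrMr // exprn_gt0.
Qed.

(** If two values agreed, a fixed multiple of [theta ^+ j] would be bounded by [mu ^+ j]. Only the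
    larger index has to be large, which is the form used in [coincidences]. *)
Lemma combo_inj h : h != (0, 0) -> exists n0, forall i j, (i < j)%N ->
  (n0 <= j)%N -> combo h i != combo h j.
Proof.
move=> /combo_closed[e [f [e0 hef]]].
have t0 : 0 < theta by exact: lt_trans th1.
pose d := `|e| * (1 - theta^-1) / (2 * `|f| + 1).
have f0 : 0 < 2 * `|f| + 1 by have := normr_ge0 f; lra.
have i1 : theta^-1 < 1 by rewrite invf_lt1.
have d0 : 0 < d by rewrite divr_gt0 // mulr_gt0 ?normr_gt0 // subr_gt0.
have [n0 hn0] := mu_small d0.
exists n0 => i j ij /hn0 hj; apply/eqP => eij.
have : e * (theta ^+ j - theta ^+ i) = f * (th2 ^+ j - th2 ^+ i).
  by have := hef i; rewrite eij hef => hh; lra.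
move=> /(congr1 (fun x : R => `|x|)); rewrite !normrM.
have h1 : theta ^+ j * (1 - theta^-1) <= `|theta ^+ j - theta ^+ i|.
  apply: le_trans (ler_norm _); rewrite mulrBr mulr1 lerD2l lerN2.
  case: j ij {hj eij} => // j ij; rewrite exprSr mulfK ?gt_eqF //.
  by apply: ler_weXn2l => //; exact: ltW.
have h2 : `|th2 ^+ j - th2 ^+ i| <= 2 * mu ^+ j.
  by rewrite (le_trans (ler_normB _ _)) // mulr_natl mulr2n lerD ?th2X // ltnW.
have h3 : `|e| * (theta ^+ j * (1 - theta^-1)) <= `|e| * `|theta ^+ j - theta ^+ i|.
  by rewrite ler_wpM2l.
have h4 : `|f| * `|th2 ^+ j - th2 ^+ i| <= `|f| * (2 * mu ^+ j) by rewrite ler_wpM2l.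
have mj : 0 < mu ^+ j by rewrite exprn_gt0 // (lt_le_trans _ mu1).
have h5 : (2 * `|f| + 1) * mu ^+ j <= `|e| * (theta ^+ j * (1 - theta^-1)).
  rewrite -ler_pdivlMl //; apply: (le_trans hj); rewrite /d.
  by rewrite le_eqVlt; apply/orP; left; apply/eqP; field; rewrite !gt_eqF.
move=> eq; move: h3 h4 h5; rewrite eq; lra.
Qed.

Lemma len_combo b : exists h, h != (0, 0) /\ forall n, combo h n = (len n b)%:Z.
Proof.
elim/letter_case: b.
  by exists (1, 0); split => // n; rewrite /combo mul1r mul0r addr0.
by exists (0, 1); split => // n; rewrite /combo mul1r mul0r add0r.
Qed.

Lemma len_growth b : exists c d : R, 0 < c /\ forall n,
  c * theta ^+ n <= (len n b)%:R <= d * theta ^+ n.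
Proof.
have [h [/combo_closed[e [f [e0 hef]]] hl]] := len_combo b.
have t0 : 0 < theta by exact: lt_trans th1.
have f0 : 0 < 2 * `|f| + 1 by have := normr_ge0 f; lra.
have ee0 : 0 < `|e| by rewrite normr_gt0.
have [|n0 hn0] := @mu_small (`|e| / (2 * `|f| + 1)); first by rewrite divr_gt0.
have hef' n : (theta - th2) * (len n b)%:R = e * theta ^+ n - f * th2 ^+ n.
  by rewrite -hef hl.
have tn n : 0 < theta ^+ n by rewrite exprn_gt0.
(* The second value covers [n < n0], where only the positivity of the length is used. *)
pose c := Num.min (`|e| / 2 / (theta - th2)) (theta ^- n0).
exists c, ((`|e| + `|f|) / (theta - th2)); split.
  by rewrite lt_min !divr_gt0 //= invr_gt0.
move=> n; apply/andP; split; last first.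
  rewrite mulrAC ler_pdivlMr // mulrC hef' (le_trans (ler_norm _)) //.
  rewrite (le_trans (ler_normB _ _)) // mulrDl !normrM lerD //.
    by rewrite (gtr0_norm (tn n)).
  rewrite ler_wpM2l // (le_trans (th2X (leqnn n))) // lerXn2r ?nnegrE ?(ltW t0) //.
    exact: le_trans mu1.
  exact: ltW.
have [nn|nn] := leqP n0 n.
  apply: (@le_trans _ _ (`|e| / 2 / (theta - th2) * theta ^+ n)).
    by rewrite ler_wpM2r ?(ltW (tn n)) // ge_min lexx.
  rewrite mulrAC ler_pdivrMr //.
  have -> : (len n b)%:R * (theta - th2) = `|e * theta ^+ n - f * th2 ^+ n|.
    by rewrite -hef' ger0_norm ?mulr_ge0 ?ler0n ?(ltW th20) // mulrC.
  have := lerB_dist (e * theta ^+ n) (f * th2 ^+ n).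
  apply: le_trans; rewrite !normrM (gtr0_norm (tn n)).
  have := hn0 n nn; rewrite mulrAC ler_pdivlMr // => h1.
  have h2 : `|f| * `|th2 ^+ n| <= `|f| * mu ^+ n by rewrite ler_wpM2l ?th2X.
  have : 0 <= mu ^+ n by rewrite exprn_ge0 // (le_trans _ mu1).
  lra.
apply: (@le_trans _ _ 1); last by rewrite ler1n len_gt0.
apply: (@le_trans _ _ (theta ^- n0 * theta ^+ n)).
  by rewrite ler_wpM2r ?(ltW (tn n)) // ge_min lexx orbT.
rewrite ler_pdivrMl // mulr1; apply: ler_weXn2l; [exact: ltW|exact: ltnW].
Qed.

End Lengths.

(** * The characteristic polynomial and its two roots *)

Lemma det2 (F : comNzRingType) (M : 'M[F]_2) :
  \det M = M l0 l0 * M l1 l1 - M l0 l1 * M l1 l0.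
Proof.
rewrite (expand_det_row _ ord0) !big_ord_recl big_ord0 addr0 /cofactor !det_mx11 !mxE /=.
rewrite /bump /= addn0 expr0 mul1r expr1 mulN1r mulrN.
by congr (_ * M _ _ - M _ _ * M _ _); apply: val_inj.
Qed.

Lemma char_poly2 (F : comNzRingType) (M : 'M[F]_2) x : (char_poly M).[x] =
  x ^+ 2 - (M l0 l0 + M l1 l1) * x + (M l0 l0 * M l1 l1 - M l0 l1 * M l1 l0).
Proof.
rewrite /char_poly det2 /char_poly_mx !mxE /= !mulr1n !mulr0n.
rewrite !sub0r !hornerE /=; ring.
Qed.

Section PerronFrobenius.
Context (R : realType) (zeta : substitution) (theta : R).
Local Notation A := (count_mem l0 (zeta l0)).
Local Notation B := (count_mem l1 (zeta l0)).
Local Notation C := (count_mem l0 (zeta l1)).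
Local Notation D := (count_mem l1 (zeta l1)).

Lemma subst_matrix_char (K : fieldType) x :
  (char_poly (map_mx intr (subst_matrix zeta) : 'M[K]_2)).[x] =
  x ^+ 2 - (A + D)%:R * x + (A%:R * D%:R - B%:R * C%:R).
Proof. by rewrite char_poly2 !mxE natrD -!pmulrn; ring. Qed.

(** A zero would make [p / q] a rational root of an irreducible quadratic polynomial; the
    homogeneous form stays within the integers. *)
Lemma char_irreducible : irreducible_over_rat (subst_matrix zeta)^T ->
  forall p q : int, q != 0 ->
  p ^+ 2 - (A + D)%:Z * p * q + (A%:Z * D%:Z - B%:Z * C%:Z) * q ^+ 2 != 0.
Proof.
rewrite /irreducible_over_rat.
set P := char_poly _ => -[sP irrP] p q q0; apply/eqP => h.
have Q0 : (q%:~R : rat) != 0 by rewrite intr_eq0.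
have rt : root P (p%:~R / q%:~R).
  rewrite rootE /P char_poly2 !mxE.
  have /(congr1 (fun z : int => z%:~R : rat)) := h.
  rewrite rmorphD rmorphB !rmorphM rmorphB !rmorphM /= mulr0z => hh.
  apply/eqP; apply: (mulIf (mulf_neq0 Q0 Q0)); rewrite mul0r -hh -!pmulrn natrD.
  by field.
have := irrP ('X - (p%:~R / q%:~R)%:P); rewrite size_XsubC dvdp_XsubCl => /(_ isT rt).
move/eqp_size; rewrite size_XsubC /P size_char_poly; done.
Qed.

Hypothesis irr : irreducible_over_rat (subst_matrix zeta)^T.
Hypothesis pf : perron_frobenius_eigenvalue (subst_matrix zeta) theta.

Lemma perron_root :
  theta ^+ 2 - (A + D)%:R * theta + (A%:R * D%:R - B%:R * C%:R) = 0.
Proof.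
case: pf => _; rewrite eigenvalue_root_char rootE subst_matrix_char => /eqP h _.
exact: h.
Qed.

Lemma perron_second : `|(A + D)%:R - theta| < theta.
Proof.
have r := perron_root.
case: pf => th0 _ hz.
set th2 := (A + D)%:R - theta.
have th2_root : th2 ^+ 2 - (A + D)%:R * th2 + (A%:R * D%:R - B%:R * C%:R) = 0.
  by rewrite -[RHS]r /th2; ring.
(* The dominance of [theta] concerns the other eigenvalues only. A double root would be the rational
   number [(A + D) / 2]. *)
have ne : th2 != theta.
  apply/eqP => e.
  have e2 : (A + D)%:R = 2 * theta :> R by move: e; rewrite /th2; lra.
  have := @char_irreducible irr (A + D)%:Z 2 isT => /eqP; apply.
  apply: (@intr_inj R); rewrite rmorphD rmorphB !rmorphM rmorphB !rmorphM /= mulr0z.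
  rewrite -!pmulrn e2; move: r; rewrite e2 => r.
  have := congr1 (fun x => 4 * x) r; rewrite mulr0 => <-; ring.
have : `|th2%:C%C| < theta%:C%C.
  apply: hz.
    rewrite eigenvalue_root_char rootE subst_matrix_char.
    apply/eqP; transitivity ((th2 ^+ 2 - (A + D)%:R * th2 +
      (A%:R * D%:R - B%:R * C%:R))%:C%C : R[i]); last by rewrite th2_root.
    move: (th2) => x; by rewrite !(rmorphD, rmorphN, rmorphM, rmorph_nat) /= expr2.
  by apply: contra ne => /eqP/complexI ->.
by rewrite normc_def /= expr0n addr0 sqrtr_sqr ltcR.
Qed.

End PerronFrobenius.

(** The number of terms bounds the geometric mean of the squared modulus of the determinant, so it
    is compared with [theta] and not with its square root. *)
Lemma conditions_mahler (R : realType) (zeta : substitution) (theta : R) :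
  perron_frobenius_eigenvalue (subst_matrix zeta) theta ->
  large_min_condition zeta theta \/ zero_entry_condition zeta \/
    block_condition zeta theta ->
  1 < theta /\ exists X Y num den,
    mahler_data R zeta X Y num den /\ (size X + size Y)%:R < theta.
Proof.
move=> pf [|[|]].
- move=> [A [B [C [D [[A0 B0 C0 D0] /matrix_count[hA hB hC hD] hth]]]]].
  split.
    apply: lt_trans hth; rewrite -natrM ltr1n; lia.
  have [AB|BA] := leqP (A + C) (B + D).
    exists (marks l0 (0, 0)%N (zeta l0 ++ zeta l1)),
      (marks l0 (0, 0)%N (zeta l1 ++ zeta l0)), [::], [:: (0, 1)%N].
    split; first exact: mahler_large0.
    rewrite !size_marks !count_cat hA hC.
    by move: hth; rewrite (minn_idPl AB) -natrM; congr (_%:R < _); lia.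
  exists (marks l1 (0, 0)%N (zeta l1 ++ zeta l0)),
      (marks l1 (0, 0)%N (zeta l0 ++ zeta l1)), [::], [:: (1, 0)%N].
  split; first exact: mahler_large1.
  rewrite !size_marks !count_cat hB hD.
  by move: hth; rewrite (minn_idPr (ltnW BA)) -natrM; congr (_%:R < _); lia.
- move=> [A [B [C [[A0 B0 C0] /matrix_count[hA hB hC hD] hth]]]].
  (* Here [theta * (theta - A) = B * C]. If [theta <= B], then [theta - A >= C], hence
     [B >= A + C]. *)
  have Bth : B%:R < theta.
    have := perron_root pf; rewrite hA hB hC hD addn0 mulr0 => r.
    have [th0 _ _] := pf; rewrite ltNge; apply/negP => thB.
    have h1 : theta * C%:R <= B%:R * C%:R by rewrite ler_wpM2r.
    have h2 : A%:R + C%:R <= theta.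
      by rewrite -(ler_pM2l th0); lra.
    have : (A + C)%:R <= B%:R :> R by rewrite natrD (le_trans h2).
    by rewrite ler_nat leqNgt hth.
  split; first by apply: le_lt_trans Bth; rewrite ler1n.
  exists [::], (marks l1 (0, 0)%N (zeta l0)), [:: (C, 0)%N], [:: (1, 0)%N].
  rewrite size_marks hB; split => //; apply: mahler_zero => //.
  by rewrite -hC; exact: nseq_absent.
- move=> [A [B [C [D [[A0 B0 C0 D0] z0 z1 hth]]]]].
  split; first by lra.
  exists [:: (0, 0); (A, B + C); (A + D, C)]%N,
    [:: (A, 0); (A + D, B + C); (0, C)]%N, [::], [:: (0, 1); (1, 0)]%N.
  by split; first exact: mahler_block.
Qed.

(** * Characters of the circle and Parseval's identity *)

Section Waves.
Context (R : realType).
Implicit Types (s t : R) (k l : int).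

Lemma circle_expD s t : circle_exp (s + t) = circle_exp s * circle_exp t :> R[i].
Proof.
rewrite /circle_exp mulrDr cosD sinD; apply/eqP; rewrite eq_complex /=.
by apply/andP; split; apply/eqP; ring.
Qed.

Lemma circle_expN t : circle_exp (- t) = conjc (circle_exp t) :> R[i].
Proof. by rewrite /circle_exp mulrN cosN sinN. Qed.

Lemma nsq_circle_exp t : nsq (circle_exp t) = 1.
Proof. by rewrite /nsq /= cos2Dsin2. Qed.

Lemma circle_exp0 : circle_exp (0 : R) = 1.
Proof. by rewrite /circle_exp mulr0 cos0 sin0. Qed.

Definition wave k t : R[i] := circle_exp (k%:~R * t).

Lemma waveD k l t : wave (k + l) t = wave k t * wave l t.
Proof. by rewrite /wave intrD mulrDl circle_expD. Qed.

Lemma waveN k t : wave (- k) t = conjc (wave k t).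
Proof. by rewrite /wave intrN mulNr circle_expN. Qed.

Lemma wave0 t : wave 0 t = 1.
Proof. by rewrite /wave mul0r circle_exp0. Qed.

Lemma waveM k n t : wave (k * n%:Z) t = wave k t ^+ n.
Proof.
elim: n => [|n IH]; first by rewrite mulr0 wave0 expr0.
by rewrite exprS -IH -waveD -[in LHS]addn1 PoszD mulrDr mulr1 addrC.
Qed.

Lemma nsq_wave k t : nsq (wave k t) = 1. Proof. exact: nsq_circle_exp. Qed.

Lemma wave_conj k l t : wave k t * conjc (wave l t) = wave (k - l) t.
Proof. by rewrite waveD waveN. Qed.

End Waves.

Section NsqSum.
Context (R : realType).

Lemma nsq_sum_expand n (c z : 'I_n -> R[i]) : nsq (\sum_(j < n) c j * z j) =
  \sum_(i < n) \sum_(j < n)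
    (complex.Re (c i * conjc (c j)) * complex.Re (z i * conjc (z j)) -
     complex.Im (c i * conjc (c j)) * complex.Im (z i * conjc (z j))).
Proof.
pose S := \sum_(j < n) c j * z j; rewrite -/S.
have -> : nsq S = complex.Re (S * conjc S) by rewrite mulcJ_nsq.
rewrite {1}/S mulr_suml Re_sum; apply: eq_bigr => i _.
rewrite /S conjc_sum mulr_sumr Re_sum; apply: eq_bigr => j _.
rewrite conjcM; move: (c i) (c j) (z i) (z j) => [a1 b1] [a2 b2] [a3 b3] [a4 b4] /=.
ring.
Qed.
End NsqSum.

Section HasIntegral.
Context d (T : measurableType d) (R : realType) (m : {measure set T -> \bar R}).
Implicit Types (f g : T -> R).

Definition has_int f (v : R) :=
  m.-integrable setT (EFin \o f) /\ \int[m]_x f x = v.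

Lemma has_int_EFin f v : has_int f v -> (\int[m]_x (f x)%:E)%E = v%:E.
Proof.
by move=> [fi <-]; rewrite /Rintegral fineK // integrable_fin_num.
Qed.

Lemma has_intD f g u v : has_int f u -> has_int g v ->
  has_int (fun x => f x + g x) (u + v).
Proof.
move=> [fi <-] [gi <-]; split; last by rewrite RintegralD.
by have := integrableD measurableT fi gi.
Qed.

Lemma has_intZ a f v : has_int f v -> has_int (fun x => a * f x) (a * v).
Proof.
move=> [fi <-]; split; last by rewrite RintegralZl.
by have := integrableZl measurableT a fi.
Qed.

Lemma has_intB f g u v : has_int f u -> has_int g v ->
  has_int (fun x => f x - g x) (u - v).
Proof.
move=> hf /(has_intZ (-1)) hg; have := has_intD hf hg; rewrite mulN1r.
by under eq_fun do rewrite mulN1r.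
Qed.

Lemma has_int0 : has_int (fun=> 0) 0.
Proof.
split; last by rewrite /Rintegral integral0.
by apply: (eq_integrable measurableT) (integrable0 m _).
Qed.

Lemma has_int_sum (I : Type) (r : seq I) (f : I -> T -> R) (v : I -> R) :
  (forall i, has_int (f i) (v i)) ->
  has_int (fun x => \sum_(i <- r) f i x) (\sum_(i <- r) v i).
Proof.
move=> h; elim: r => [|i r IH].
  by rewrite big_nil; under eq_fun do rewrite big_nil; exact: has_int0.
by rewrite big_cons; under eq_fun do rewrite big_cons; exact: has_intD.
Qed.

(** The integral depends on the measure only through the correlations of the [z i]. This serves for
    the Lebesgue, the spectral and the shift-invariant measure alike. *)
Lemma has_int_nsq n (c : 'I_n -> R[i]) (z : 'I_n -> T -> R[i])
    (rho iota : 'I_n -> 'I_n -> R) :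
  (forall i j, has_int (fun x => complex.Re (z i x * conjc (z j x))) (rho i j)) ->
  (forall i j, has_int (fun x => complex.Im (z i x * conjc (z j x))) (iota i j)) ->
  has_int (fun x => nsq (\sum_(j < n) c j * z j x))
   (\sum_(i < n) \sum_(j < n) (complex.Re (c i * conjc (c j)) * rho i j -
     complex.Im (c i * conjc (c j)) * iota i j)).
Proof.
move=> hr hi; under eq_fun do rewrite nsq_sum_expand.
by do 2 (apply: has_int_sum => ?); apply: has_intB; exact: has_intZ.
Qed.
End HasIntegral.

Section Circle.
Context (R : realType).

Definition circle_prob : probability (measurableTypeR R) R := uniform_prob (@ltr01 R).
Local Notation nu := circle_prob.

Lemma circle_prob_null (U : set (measurableTypeR R)) : measurable U ->
  nu U = lebesgue_measure (U `&` `[0, 1]).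
Proof.
move=> mU; have -> : nu U = (\int[nu]_x (\1_U x)%:E)%E.
  by rewrite integral_indic // setIT.
rewrite integral_uniform; first last.
- by move=> x; rewrite lee_fin.
- exact/measurable_EFinP/measurable_indic.
by rewrite subr0 invr1 mul1e integral_indic.
Qed.

Lemma circle_ftc (f F : R -> R) : (forall x, 0 <= f x) -> continuous f ->
  (forall x, is_derive x (1 : R) F (f x)) ->
  (\int[nu]_x (f x)%:E)%E = (F 1 - F 0)%:E.
Proof.
move=> f0 cf dF.
have mf : measurable_fun setT f by exact: continuous_measurable_fun.
rewrite integral_uniform; first last.
- by move=> x; rewrite lee_fin.
- exact/measurable_EFinP.
rewrite subr0 invr1 mul1e (@continuous_FTC2 _ f F) ?ltr01 //.
- exact: continuous_subspaceT.
- split.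
  + by move=> x _; have [] := dF x.
  + apply: cvg_at_right_filter; apply: differentiable_continuous.
    by apply/derivable1_diffP; have [] := dF 0.
  + apply: cvg_at_left_filter; apply: differentiable_continuous.
    by apply/derivable1_diffP; have [] := dF 1.
- by move=> x _; rewrite derive1E; have [] := dF x.
Qed.
End Circle.

Section CircleIntegrals.
Context (R : realType).
Local Notation nu := (@circle_prob R).

Lemma has_int_ext (f g : R -> R) u v : (forall x, g x = f x) -> v = u ->
  has_int nu f u -> has_int nu g v.
Proof. by move=> /funext -> ->. Qed.

Lemma has_int_cst (f : R -> R) c : (forall x, f x = c) -> has_int nu f c.
Proof.
move=> h; have -> : f = cst c by apply/funext.
split; first by apply: finite_measure_integrable_cst.
by rewrite Rintegral_cst //= probability_setT mulr1.
Qed.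

Lemma has_int_ftc (f F : R -> R) : (forall x, 0 <= f x) -> continuous f ->
  (forall x, is_derive x (1 : R) F (f x)) -> has_int nu f (F 1 - F 0).
Proof.
move=> f0 cf dF; have h := circle_ftc f0 cf dF.
split; last by rewrite /Rintegral h.
apply/integrableP; split.
  apply/measurable_EFinP; exact: continuous_measurable_fun.
under eq_integral do rewrite /= ger0_norm //.
by rewrite h ltry.
Qed.

Lemma wave_continuous (k : int) :
  continuous (fun x : R => cos (2 * pi * (k%:~R * x))) /\
  continuous (fun x : R => sin (2 * pi * (k%:~R * x))).
Proof.
have h : continuous (fun x : R => 2 * pi * (k%:~R * x)).
  by move=> x; do 2 (apply: cvgMr); exact: cvg_id.
split=> x; apply: continuous_comp; [exact: h|exact: continuous_cos|exact: h|exact: continuous_sin].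
Qed.

Lemma is_derive_scaled (a x : R) : is_derive x (1 : R) (fun y : R => 2 * pi * (a * y)) (2 * pi * a).
Proof.
have := is_deriveZ (2 * pi * a) (is_derive_id x (1 : R)).
rewrite /GRing.scale /= mulr1; congr (is_derive _ _ _ _).
by apply/funext => y; rewrite mulrA.
Qed.

Lemma sin_int (k : int) : sin (2 * pi * k%:~R) = 0 :> R.
Proof.
have hn n : sin (2 * pi * n%:R) = 0 :> R.
  elim: n => [|n IH]; first by rewrite mulr0 sin0.
  rewrite -[n.+1%:R]natr1 mulrDr mulr1 sinD IH mul0r add0r [2 * pi]mulr_natl sin2pi mulr0.
  by [].
case: k => n; first exact: hn.
by rewrite NegzE intrN mulrN sinN hn oppr0.
Qed.

Lemma cos_int (k : int) : cos (2 * pi * k%:~R) = 1 :> R.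
Proof.
have hn n : cos (2 * pi * n%:R) = 1 :> R.
  elim: n => [|n IH]; first by rewrite mulr0 cos0.
  rewrite -[n.+1%:R]natr1 mulrDr mulr1 cosD IH [2 * pi]mulr_natl cos2pi sin2pi.
  by rewrite mulr1 mulr0 subr0.
case: k => n; first exact: hn.
by rewrite NegzE intrN mulrN cosN hn.
Qed.

Lemma has_int_wave (k : int) :
  has_int nu (fun x => complex.Re (wave k x)) (k == 0)%:R /\
  has_int nu (fun x => complex.Im (wave k x)) 0.
Proof.
have [->|k0] := eqVneq k 0.
  by split; apply: has_int_cst => x; rewrite wave0.
have [cc cs] := wave_continuous k.
have kR : (k%:~R : R) != 0 by rewrite intr_eq0.
have tp : (2 * pi * k%:~R : R) != 0 by rewrite !mulf_neq0 // gt_eqF // pi_gt0.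
have c1 : has_int nu (fun=> 1 : R) 1 by apply: has_int_cst.
split.
- pose F x : R := x + (2 * pi * k%:~R)^-1 * sin (2 * pi * (k%:~R * x)).
  (* Adding 1 makes the integrand nonnegative, as [has_int_ftc] requires; it is subtracted again at
     the end. *)
  have hf : has_int nu (fun x => 1 + cos (2 * pi * (k%:~R * x))) 1.
    rewrite [X in has_int _ _ X](_ : _ = F 1 - F 0); last first.
      by rewrite /F !mulr0 sin0 !mulr1 sin_int !mulr0 !addr0 subr0.
    apply: has_int_ftc.
  + by move=> x; have := cos_geN1 (2 * pi * (k%:~R * x)); lra.
  + move=> x; apply: cvgD; [exact: cvg_cst|exact: cc].
  + move=> x.
    have d1 : is_derive x (1 : R) (@sin R \o (fun y : R => 2 * pi * (k%:~R * y)))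
        (cos (2 * pi * (k%:~R * x)) * (2 * pi * k%:~R)).
      by apply: is_derive1_comp; exact: is_derive_scaled.
    have d2 := is_deriveD (is_derive_id x (1 : R)) (is_deriveZ (2 * pi * k%:~R)^-1 d1).
    rewrite (_ : 1 + cos _ = 1 + (2 * pi * k%:~R)^-1 *: (cos (2 * pi * (k%:~R * x)) * (2 * pi * k%:~R))) //.
    by rewrite /GRing.scale /=; congr (_ + _); rewrite [RHS]mulrCA mulVf ?mulr1.
  by apply: has_int_ext (has_intB hf c1) => [x|]; rewrite ?subrr // addrAC subrr add0r.
- pose F x : R := x - (2 * pi * k%:~R)^-1 * cos (2 * pi * (k%:~R * x)).
  have hf : has_int nu (fun x => 1 + sin (2 * pi * (k%:~R * x))) 1.
    rewrite [X in has_int _ _ X](_ : _ = F 1 - F 0); last first.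
      by rewrite /F !mulr0 cos0 !mulr1 cos_int !mulr1; ring.
    apply: has_int_ftc.
  + by move=> x; have := sin_geN1 (2 * pi * (k%:~R * x)); lra.
  + move=> x; apply: cvgD; [exact: cvg_cst|exact: cs].
  + move=> x.
    have d1 : is_derive x (1 : R) (@cos R \o (fun y : R => 2 * pi * (k%:~R * y)))
        (- sin (2 * pi * (k%:~R * x)) * (2 * pi * k%:~R)).
      by apply: is_derive1_comp; exact: is_derive_scaled.
    have d2 := is_deriveB (is_derive_id x (1 : R)) (is_deriveZ (2 * pi * k%:~R)^-1 d1).
    rewrite (_ : 1 + sin _ = 1 - (2 * pi * k%:~R)^-1 *: (- sin (2 * pi * (k%:~R * x)) * (2 * pi * k%:~R))) //.
    by rewrite /GRing.scale /=; congr (_ + _); rewrite mulNr mulrN opprK [RHS]mulrCA mulVf ?mulr1.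
  by apply: has_int_ext (has_intB hf c1) => [x|]; rewrite ?subrr // addrAC subrr add0r.
Qed.

Lemma parseval n (a : 'I_n -> int) (c : 'I_n -> R[i]) :
  has_int nu (fun x => nsq (\sum_(j < n) c j * wave (a j) x))
    (\sum_(i < n) \sum_(j < n | a i == a j) complex.Re (c i * conjc (c j))).
Proof.
have := @has_int_nsq _ _ _ nu n c (fun j => wave (a j))
  (fun i j => (a i == a j)%:R) (fun _ _ => 0).
have -> : \sum_(i < n) \sum_(j < n) (complex.Re (c i * conjc (c j)) * (a i == a j)%:R -
     complex.Im (c i * conjc (c j)) * 0) =
   \sum_(i < n) \sum_(j < n | a i == a j) complex.Re (c i * conjc (c j)).
  apply: eq_bigr => i _; rewrite [RHS]big_mkcond; apply: eq_bigr => j _.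
  by rewrite mulr0 subr0; case: eqP => _; rewrite ?mulr1 ?mulr0.
apply=> i j; under eq_fun do rewrite wave_conj; have [h1 h2] := has_int_wave (a i - a j).
  by rewrite -subr_eq0.
exact: h2.
Qed.

Lemma parseval_inj n (a : 'I_n -> int) (c : 'I_n -> R[i]) : injective a ->
  has_int nu (fun x => nsq (\sum_(j < n) c j * wave (a j) x)) (\sum_(j < n) nsq (c j)).
Proof.
move=> ia; have := parseval a c.
have -> // : \sum_(i < n) \sum_(j < n | a i == a j) complex.Re (c i * conjc (c j)) =
   \sum_(j < n) nsq (c j).
apply: eq_bigr => i _; rewrite (big_pred1 i) ?mulcJ_nsq // => j.
by apply/eqP/eqP => [/ia ->|->].
Qed.

Lemma measurable_nsq_wave n (a : 'I_n -> int) (c : 'I_n -> R[i]) :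
  measurable_fun setT (fun x : R => nsq (\sum_(j < n) c j * wave (a j) x)).
Proof. by have [/measurable_int/measurable_EFinP] := parseval a c. Qed.

Lemma inv_squares_bound n : \sum_(0 <= k < n) ((k.+1%:R ^+ 2)^-1 : R) <= 2.
Proof.
case: n => [|n]; first by rewrite big_geq.
suff h : \sum_(0 <= k < n.+1) ((k.+1%:R ^+ 2)^-1 : R) <= 2 - n.+1%:R^-1.
  by apply: (le_trans h); rewrite gerBl invr_ge0.
elim: n => [|n IH].
  by rewrite big_nat1 expr1n invr1; lra.
rewrite big_nat_recr //=; apply: (le_trans (lerD IH (lexx _))).
have n1 : 0 < n.+1%:R :> R by rewrite ltr0n.
have -> : n.+2%:R = n.+1%:R + 1 :> R by rewrite -[n.+2%:R]natr1.
move: (n.+1%:R) n1 => x x0.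
have x1 : 0 < x + 1 by lra.
have -> : 2 - x^-1 + ((x + 1) ^+ 2)^-1 = 2 - (x + 1)^-1 - (x * (x + 1) ^+ 2)^-1.
  by field; rewrite !gt_eqF.
by rewrite gerBl invr_ge0 mulr_ge0 ?exprn_ge0 // ltW.
Qed.

(** The integrals are summable, so the series of the [X n] is finite almost everywhere and its terms
    tend to 0. *)
Lemma ae_cvg0 (X : nat -> R -> R) (C : R) :
  (forall n, measurable_fun setT (X n)) -> (forall n x, 0 <= X n x) ->
  (forall n, (\int[nu]_x (X n x)%:E <= (C / n.+1%:R ^+ 2)%:E)%E) ->
  {ae nu, forall x, X ^~ x @ \oo --> 0}.
Proof.
move=> mX X0 hX.
have C0 : 0 <= C.
  have := hX 0%N; rewrite expr1n divr1 => h; rewrite -lee_fin; apply: le_trans h.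
  by apply: integral_ge0 => x _; rewrite lee_fin.
have fin : (\int[nu]_x (\sum_(0 <= n <oo) (X n x)%:E) <= (C * 2)%:E)%E.
  rewrite integral_nneseries; first last.
  - by move=> n x _; rewrite lee_fin.
  - by move=> n; apply/measurable_EFinP; exact: mX.
  - exact: measurableT.
  apply: lime_le.
    by apply: is_cvg_nneseries => n _ _; apply: integral_ge0 => x _; rewrite lee_fin.
  apply: nearW => n; apply: (@le_trans _ _ (\sum_(0 <= k < n) (C / k.+1%:R ^+ 2)%:E)%E).
    by apply: lee_sum => k _; exact: hX.
  rewrite sumEFin lee_fin -mulr_sumr ler_wpM2l //; exact: inv_squares_bound.
have mS : measurable_fun setT (fun x => \sum_(0 <= n <oo) (X n x)%:E)%E.
  by apply: ge0_emeasurable_sum => n; [move=> x _ _; rewrite lee_fin|move=> _; apply/measurable_EFinP; exact: mX].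
have S0 x : (0 <= \sum_(0 <= n <oo) (X n x)%:E)%E.
  by apply: nneseries_ge0 => n _ _; rewrite lee_fin.
have int : nu.-integrable setT (fun x => \sum_(0 <= n <oo) (X n x)%:E)%E.
  apply/integrableP; split => //.
  under eq_integral do rewrite gee0_abs //.
  by apply: le_lt_trans fin _; rewrite ltry.
have := integrable_ae measurableT int; apply: filterS => x /(_ I) xfin.
apply: cvg_series_cvg_0; apply: nnseries_is_cvg => //.
by rewrite ltey_eq xfin.
Qed.
End CircleIntegrals.

(** * Almost everywhere equidistribution *)

Section Interpolation.
Context (R : realType).

Lemma between_squares n : (0 < n)%N -> exists k, (k.+1 ^ 2 <= n < k.+2 ^ 2)%N.
Proof.
elim: n => [//|[|n] IH _]; first by exists 0%N.
have [//|k /andP[h1 h2]] := IH.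
have [h|h] := ltnP n.+2 (k.+2 ^ 2)%N; first by exists k; rewrite h (leq_trans h1).
by exists k.+1; rewrite h /=; rewrite -!mulnn in h h2 *; lia.
Qed.

(** Squares are sparse enough for second moments to be summable along them, and dense enough that
    the terms between the last square and [n] are negligible. *)
Lemma mean_to_squares (x : nat -> R) : (forall j, `|x j| <= 1) ->
  (fun k => (\sum_(j < k.+1 ^ 2) x j) ^+ 2 / k.+1%:R ^+ 4) @ \oo --> (0 : R) ->
  mean_to x 0.
Proof.
move=> x1 hX; rewrite /mean_to; apply/cvgrPdist_le => e e0.
have [|k0 _ hk0] := cvgr_lt (0 : R) hX ((e / 2) ^+ 2).
  by rewrite exprn_gt0 // divr_gt0.
(* With [6 / e <= k.+1], the at most [3 * k.+1] terms after the last square cost no more than half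
   of [e * k.+1 ^+ 2]. *)
have [k1 hk1] : exists k1 : nat, 6 / e <= k1%:R.
  exists (Num.bound (6 / e)); apply: ltW; apply: archi_boundP.
  by rewrite divr_ge0 // ltW.
near=> n.
have n1 : ((maxn k0 k1).+1 ^ 2 <= n)%N.
  by near: n; exists ((maxn k0 k1).+1 ^ 2)%N.
have n0 : (0 < n)%N by apply: leq_trans n1; rewrite expn_gt0.
have [k /andP[kn nk]] := between_squares n0.
have kk : (maxn k0 k1 <= k)%N.
  rewrite -!mulnn in n1 nk *; nia.
have Sk : `|\sum_(j < k.+1 ^ 2) x j| <= e / 2 * k.+1%:R ^+ 2.
  have := hk0 k (leq_trans (leq_maxl _ _) kk) => /=.
  rewrite ltr_pdivrMr ?exprn_gt0 // => h.
  rewrite -(@ler_pXn2r _ 2) ?nnegrE ?mulr_ge0 ?exprn_ge0 ?divr_ge0 ?(ltW e0) //.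
  by rewrite real_normK ?num_real // exprMn -exprM ltW.
have Sn : `|\sum_(j < n) x j| <= `|\sum_(j < k.+1 ^ 2) x j| + (n - k.+1 ^ 2)%:R.
  have -> : \sum_(j < n) x j = \sum_(j < k.+1 ^ 2) x j + \sum_(k.+1 ^ 2 <= j < n) x j.
    by rewrite -!(big_mkord xpredT x) -big_cat_nat.
  apply: (le_trans (ler_normD _ _)); rewrite lerD2l.
  apply: (le_trans (ler_norm_sum _ _ _)).
  apply: le_trans (_ : _ <= \sum_(k.+1 ^ 2 <= j < n) 1) _; first exact: ler_sum.
  by rewrite sumr_const_nat.
have kR : 6 / e <= k.+1%:R.
  apply: (le_trans hk1); rewrite ler_nat; apply: leqW.
  exact: leq_trans (leq_maxr _ _) kk.
have gap : ((n - k.+1 ^ 2)%:R : R) <= 3 * k.+1%:R.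
  by rewrite -natrM ler_nat; rewrite -!mulnn in nk *; lia.
have nR : 0 < n%:R :> R by rewrite ltr0n.
have kn' : k.+1%:R ^+ 2 <= n%:R :> R by rewrite -natrX ler_nat.
rewrite sub0r normrN normrM normfV (gtr0_norm nR) mulrC ler_pdivrMr //.
apply: (le_trans Sn); apply: (le_trans (lerD Sk gap)).
have k3 : 3 * k.+1%:R <= e / 2 * k.+1%:R ^+ 2.
  have k0' : 0 <= k.+1%:R :> R by rewrite ler0n.
  rewrite ler_pdivrMr // in kR.
  have := ler_wpM2r k0' kR; rewrite expr2; lra.
apply: le_trans (_ : e * k.+1%:R ^+ 2 <= _); first by lra.
by rewrite ler_wpM2l // ltW.
Unshelve. all: by end_near. Qed.
End Interpolation.

Section AlmostEverywhere.
Context (R : realType).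
Local Notation nu := (@circle_prob R).

Lemma ae_circleS (P Q : R -> Prop) : (forall x, P x -> Q x) ->
  {ae nu, forall x, P x} -> {ae nu, forall x, Q x}.
Proof. exact: (@filterS _ _ (ae_filter_ringOfSetsType nu) P Q). Qed.

Lemma ae_circleI (P Q : R -> Prop) : {ae nu, forall x, P x} ->
  {ae nu, forall x, Q x} -> {ae nu, forall x, P x /\ Q x}.
Proof. exact: (@filterI _ _ (ae_filter_ringOfSetsType nu) P Q). Qed.

Lemma nsq_sum_wave_int n (a : 'I_n -> int) :
  (\int[nu]_x (nsq (\sum_(j < n) wave (a j) x))%:E)%E =
  (\sum_(i < n) \sum_(j < n) (a i == a j)%:R)%:E.
Proof.
have E x : nsq (\sum_(j < n) wave (a j) x) =
    nsq (\sum_(j < n) (fun=> 1) j * wave (a j) x) :> R.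
  by congr nsq; apply: eq_bigr => j _; rewrite mul1r.
under eq_integral do rewrite E.
rewrite (has_int_EFin (parseval a (fun=> 1))); congr (_%:E); apply: eq_bigr => i _.
rewrite [LHS]big_mkcond; apply: eq_bigr => j _; case: eqP => _ //=.
by rewrite mulr1 mul0r subr0.
Qed.

Lemma measurable_nsq_sum_wave n (a : 'I_n -> int) :
  measurable_fun setT (fun x : R => nsq (\sum_(j < n) wave (a j) x)).
Proof.
have := measurable_nsq_wave a (fun=> 1 : R[i]).
congr (measurable_fun _ _); apply/funext => x.
by congr nsq; apply: eq_bigr => j _; rewrite mul1r.
Qed.

Lemma int_nsq_div n (a : 'I_n -> int) (c : R) : 0 < c ->
  (\int[nu]_x (nsq (\sum_(j < n) wave (a j) x) / c)%:E)%E =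
  ((\sum_(i < n) \sum_(j < n) (a i == a j)%:R) / c)%:E.
Proof.
move=> c0; under eq_integral do rewrite mulrC EFinM.
rewrite ge0_integralZl //; first by rewrite nsq_sum_wave_int -EFinM mulrC.
- by apply/measurable_EFinP; exact: measurable_nsq_sum_wave.
- by move=> x _; rewrite lee_fin nsq_ge0.
- by rewrite lee_fin invr_ge0 ltW.
Qed.

(** Off the diagonal, a coincidence forces both indices below [n0]. *)
Lemma coincidences (a : nat -> int) n0 n :
  (forall i j, (i < j)%N -> (n0 <= j)%N -> a i != a j) ->
  \sum_(i < n) \sum_(j < n) ((a i == a j)%:R : R) <= n%:R + n0%:R ^+ 2.
Proof.
move=> h.
have hle (i j : 'I_n) : ((a i == a j)%:R : R) <= (i == j)%:R + (i < n0)%:R * (j < n0)%:R.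
  have [->|ij] := eqVneq i j; first by rewrite eqxx lerDl mulr_ge0.
  rewrite add0r; case: eqP => // e; last by rewrite mulr_ge0.
  have hi : (i < n0)%N.
    rewrite ltnNge; apply/negP => ni.
    have [lt|lt|/val_inj eq] := ltngtP i j.
    - by have := h i j lt (leq_trans ni (ltnW lt)); rewrite e eqxx.
    - by have := h j i lt ni; rewrite e eqxx.
    - by rewrite eq eqxx in ij.
  have hj : (j < n0)%N.
    rewrite ltnNge; apply/negP => nj.
    have := h i j (leq_trans hi nj) nj; by rewrite e eqxx.
  by rewrite hi hj mulr1.
apply: (@le_trans _ _ (\sum_(i < n) \sum_(j < n) ((i == j)%:R + (i < n0)%:R * (j < n0)%:R))).
  by apply: ler_sum => i _; apply: ler_sum => j _; exact: hle.
under eq_bigr do rewrite big_split /=.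
rewrite big_split /= lerD //.
  rewrite le_eqVlt; apply/orP; left; apply/eqP.
  rewrite -[in RHS](card_ord n) -sumr_const; apply: eq_bigr => i _.
  rewrite (bigD1 i) //= eqxx big1 ?addr0 // => j ji.
  by rewrite eq_sym (negPf ji).
have s : \sum_(i < n) ((i < n0)%:R : R) <= n0%:R.
  rewrite -natr_sum ler_nat -big_mkcond sum1_card /=.
  rewrite -[X in (_ <= X)%N](size_iota 0 n0).
  rewrite cardE -(size_map val); apply: uniq_leq_size.
    by rewrite (map_inj_uniq val_inj) enum_uniq.
  by move=> i /mapP[j]; rewrite mem_enum mem_iota add0n => jn ->.
under eq_bigr do rewrite -mulr_sumr.
rewrite -mulr_suml expr2; apply: ler_pM => //; apply: sumr_ge0 => *; exact: ler0n.
Qed.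

Lemma absRe_nsq (z : R[i]) : complex.Re z ^+ 2 <= nsq z.
Proof. by rewrite /nsq lerDl sqr_ge0. Qed.

(* The Davenport-Erdos-LeVeque argument along the squares. *)
Lemma ae_mean_wave (a : nat -> int) :
  (exists n0, forall i j, (i < j)%N -> (n0 <= j)%N -> a i != a j) ->
  {ae nu, forall x, mean_to (fun j => complex.Re (wave (a j) x)) 0}.
Proof.
move=> [n0 hn0].
pose X k (x : R) := nsq (\sum_(j < k.+1 ^ 2) wave (a j) x) / k.+1%:R ^+ 4.
have kp k : 0 < k.+1%:R ^+ 4 :> R by rewrite exprn_gt0.
have : {ae nu, forall x, X ^~ x @ \oo --> 0}.
  apply: (@ae_cvg0 _ _ (1 + n0%:R ^+ 2)).
  - move=> k; apply: measurable_funM; last exact: measurable_cst.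
    exact: measurable_nsq_sum_wave.
  - by move=> k x; rewrite divr_ge0 ?nsq_ge0 // ltW.
  - move=> k; rewrite /X int_nsq_div // lee_fin.
    rewrite ler_pdivrMr // -[4%N]/(2 + 2)%N exprD mulrA divfK; last first.
      by rewrite gt_eqF // exprn_gt0.
    apply: (le_trans (coincidences (k.+1 ^ 2) hn0)).
    rewrite natrX mulrDl mul1r lerD2l ler_peMr ?exprn_ge0 //.
    by rewrite expr_ge1 // ler1n.
apply: ae_circleS => x hx; apply: mean_to_squares.
  by move=> j; apply: absRe_le1; exact: nsq_wave.
apply: (squeeze_cvgr _ (cvg_cst (0 : R)) hx).
apply: nearW => k; rewrite divr_ge0 ?sqr_ge0 ?(ltW (kp k)) //=.
rewrite /X ler_pM2r ?invr_gt0 //.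
have := absRe_nsq (\sum_(j < k.+1 ^ 2) wave (a j) x); rewrite Re_sum; exact.
Qed.

(** If the first [N] powers of [z] all stay near 1, their sum is at least half of [N]. Read
    backwards, a small geometric sum keeps [z] away from 1. *)
Lemma geometric_far (z : R[i]) N : nsq z = 1 -> cmod (1 - z) * N%:R <= 2^-1 ->
  N%:R ^+ 2 / 4 <= nsq (\sum_(k < N) z ^+ k).
Proof.
move=> hz hN.
have hk k : cmod (1 - z ^+ k) <= k%:R * cmod (1 - z).
  elim: k => [|k IH]; first by rewrite expr0 subrr cmod0 mul0r.
  have -> : 1 - z ^+ k.+1 = (1 - z) + z * (1 - z ^+ k) by rewrite exprS; ring.
  apply: (le_trans (cmodD _ _)); rewrite cmodM {2}/cmod hz sqrtr1 mul1r.
  by rewrite -natr1 mulrDl mul1r addrC lerD.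
have h1 : cmod (N%:R - \sum_(k < N) z ^+ k) <= N%:R / 2.
  have -> : N%:R - \sum_(k < N) z ^+ k = \sum_(k < N) (1 - z ^+ k).
    by rewrite sumrB sumr_const card_ord.
  apply: (le_trans (cmod_sum _ _)).
  apply: (@le_trans _ _ (\sum_(k < N) (2^-1 : R))).
    apply: ler_sum => k _; apply: (le_trans (hk k)); apply: le_trans hN.
    by rewrite mulrC ler_wpM2l ?cmod_ge0 // ler_nat ltnW.
  by rewrite sumr_const card_ord mulr_natl.
have cN : cmod (N%:R : R[i]) = N%:R.
  rewrite /cmod /nsq.
  have -> : (N%:R : R[i]) = (N%:R)%:C%C by rewrite rmorph_nat.
  by rewrite /= expr0n addr0 sqrtr_sqr ger0_norm.
have h2 : N%:R / 2 <= cmod (\sum_(k < N) z ^+ k).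
  have := cmodD (N%:R - \sum_(k < N) z ^+ k) (\sum_(k < N) z ^+ k).
  rewrite subrK cN; lra.
rewrite -cmod_sqr (_ : N%:R ^+ 2 / 4 = (N%:R / 2) ^+ 2); last by field.
by rewrite lerXn2r ?nnegrE ?cmod_ge0 // divr_ge0.
Qed.

(** The second moment of a sum of [N] distinct waves is [N]; with [N = n.+1 ^ 2] the normalized
    moments are [1 / n.+1 ^ 2], hence summable. The frequency [b n] may vary with [n]. *)
Lemma ae_wave_cvg0 (b : nat -> int) (C : R) : (forall n, b n != 0) ->
  {ae nu, forall x, (fun n => nsq (\sum_(k < n.+1 ^ 2) wave (b n) x ^+ k) /
     n.+1%:R ^+ 4) @ \oo --> 0}.
Proof.
move=> b0; have kp k : 0 < k.+1%:R ^+ 4 :> R by rewrite exprn_gt0.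
have E n x : nsq (\sum_(k < n.+1 ^ 2) wave (b n) x ^+ k) =
  nsq (\sum_(k < n.+1 ^ 2) wave (b n * k%:Z) x) :> R.
  by congr nsq; apply: eq_bigr => k _; rewrite waveM.
apply: (@ae_cvg0 _ _ 1).
- move=> n; under eq_fun do rewrite E.
  apply: measurable_funM; last exact: measurable_cst.
  exact: (measurable_nsq_sum_wave (fun k : 'I_(n.+1 ^ 2) => b n * k%:Z)).
- by move=> n x; rewrite divr_ge0 ?nsq_ge0 // ltW.
- move=> n; under eq_integral do rewrite E.
  rewrite (int_nsq_div (fun k : 'I_(n.+1 ^ 2) => b n * k%:Z)) // lee_fin.
  rewrite ler_pdivrMr // -[4%N]/(2 + 2)%N exprD mulrA divfK; last first.
    by rewrite gt_eqF // exprn_gt0.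
  rewrite mul1r -natrX -[leRHS]addr0 -[X in _ + X](expr0n R 2).
  apply: (@coincidences (fun k => b n * k%:Z) 0%N) => i j ij _.
  by apply: contraTneq ij => /(mulfI (b0 n)) [->]; rewrite ltnn.
Qed.

(** Where the wave equals 1, the averages of [ae_wave_cvg0] are constantly 1. *)
Lemma ae_wave_neq1 (a : int) : a != 0 -> {ae nu, forall x : R, wave a x != 1}.
Proof.
move=> a0; have := @ae_wave_cvg0 (fun=> a) 0 (fun=> a0).
apply: ae_circleS => x hx; apply/eqP => h1.
have : (fun n => nsq (\sum_(k < n.+1 ^ 2) wave a x ^+ k) / n.+1%:R ^+ 4) @ \oo --> (1 : R).
  rewrite (_ : (fun n => _) = fun=> 1); first exact: cvg_cst.
  apply/funext => n; under eq_bigr do rewrite h1 expr1n.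
  rewrite sumr_const card_ord.
  have -> : ((n.+1 ^ 2)%:R : R[i]) = ((n.+1 ^ 2)%:R)%:C%C by rewrite rmorph_nat.
  by rewrite /nsq /= expr0n addr0 natrX -exprM divff // gt_eqF // exprn_gt0.
by move=> /(cvg_unique (@Rhausdorff R) hx)/esym/eqP; rewrite oner_eq0.
Qed.

(** The square in [j.+1 ^+ 2] is the number of powers summed in [ae_wave_cvg0]. The finitely many
    first levels need only that the waves differ from 1. *)
Lemma ae_wave_far (a : nat -> int) : (forall j, a j != 0) ->
  {ae nu, forall x : R, exists c, 0 < c /\
    forall j, c <= cmod (1 - wave (a j) x) * j.+1%:R ^+ 2}.
Proof.
move=> a0.
have h1 := @ae_wave_cvg0 a 0 a0.
have h2 : {ae nu, forall x : R, forall j, wave (a j) x != 1}.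
  by apply/ae_foralln => j; exact: ae_wave_neq1.
apply: ae_circleS (ae_circleI h1 h2) => x [hx hn].
pose y j := cmod (1 - wave (a j) x) * j.+1%:R ^+ 2.
have y0 j : 0 < y j.
  rewrite mulr_gt0 ?exprn_gt0 // lt_neqAle cmod_ge0 andbT eq_sym -sqrf_eq0.
  by rewrite cmod_sqr nsq_eq0 subr_eq0 eq_sym.
have [|j0 _ hj0] := cvgr_lt (0 : R) hx (4^-1); first by rewrite invr_gt0.
have far j : (j0 <= j)%N -> 2^-1 <= y j.
  move=> /hj0 /= h; rewrite leNgt; apply/negP => /ltW.
  rewrite /y -natrX => /(geometric_far (nsq_wave _ _)).
  move: h; rewrite ltr_pdivrMr ?exprn_gt0 // natrX -exprM mulrC => h /le_lt_trans /(_ h).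
  by rewrite mulrC ltxx.
have [c [c0 hc]] : exists c, 0 < c /\ forall j, (j < j0)%N -> c <= y j.
  elim: j0 {hj0 far} => [|j0 [c [c0 hc]]]; first by exists 1.
  exists (Num.min c (y j0)); split; first by rewrite lt_min c0 y0.
  move=> j; rewrite ltnS leq_eqVlt => /orP[/eqP ->|/hc h].
    by rewrite ge_min lexx orbT.
  by rewrite ge_min h.
exists (Num.min c 2^-1); split; first by rewrite lt_min c0 invr_gt0 ltr0n.
move=> j; have [jj|jj] := ltnP j j0.
  by rewrite ge_min (hc _ jj).
by rewrite ge_min (far _ jj) orbT.
Qed.

End AlmostEverywhere.

Section Phases.
Context (R : realType) (zeta : substitution).
Local Notation nu := (@circle_prob R).

(** The orbit starts at level [l] because windows of several coordinates are first collected inside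
    the words [zeta^l(b)]. The sign agrees with the twist in the Fejer kernel. *)
Definition phases l (x : R) (j : nat) (b : letter) : R[i] :=
  wave (- (len zeta (l + j) b)%:Z) x.

Fixpoint vsum (w : nat -> letter -> R[i]) (V0 : letter -> R[i]) j :=
  if j is i.+1 then next_sum zeta (w i) (vsum w V0 i) else V0.

Lemma phases_unit l x : unit_phases (phases l x).
Proof. by move=> j b; exact: nsq_wave. Qed.

Lemma phase_phases l x j u : phase (phases l x j) u =
  wave (- (count_mem l0 u * len zeta (l + j) l0 +
           count_mem l1 u * len zeta (l + j) l1)%:Z) x.
Proof.
elim: u => [|b u IH]; first by rewrite /phase big_nil /= oppr0 wave0.
rewrite /phase big_cons -/(phase _ _) IH /phases -waveD; congr wave.
by elim/letter_case: b => /=; rewrite /l0 /l1 /= !PoszD !PoszM; ring.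
Qed.

Lemma phasesS l x j b : phases l x j.+1 b = next_phase zeta (phases l x j) b.
Proof.
rewrite /next_phase phase_phases /phases addnS; congr (wave (- (_)%:Z) _).
by elim/letter_case: b; rewrite ?lenS0 ?lenS1.
Qed.

Lemma mon_phases l x j m m' :
  mon (phases l x j) m * conjc (mon (phases l x j) m') =
  wave (combo zeta (m'.1%:Z - m.1%:Z, m'.2%:Z - m.2%:Z) (l + j)) x.
Proof.
rewrite /mon /phases -!waveM -!waveD -waveN -waveD; congr wave.
by rewrite /combo /=; ring.
Qed.

Variable theta : R.
Hypothesis irr : irreducible_over_rat (subst_matrix zeta)^T.
Hypothesis pf : perron_frobenius_eigenvalue (subst_matrix zeta) theta.
Hypothesis th1 : 1 < theta.

Let char_irr := char_irreducible irr.
Let second_lt := perron_second irr pf.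

(** Weyl's criterion concerns countably many pairs of exponents, enumerated by [pickle]; each pair
    leads to a sequence [combo], whose values are eventually distinct by irreducibility. *)
Lemma ae_equid l : {ae nu, forall x, equid (phases l x)}.
Proof.
pose P (n : nat) (x : R) :=
  if unpickle n is Some (m, m') then
    m != m' -> mean_to (fun j => complex.Re
       (mon (phases l x j) m * conjc (mon (phases l x j) m'))) 0
  else True.
have hP : {ae nu, forall x, forall n, P n x}.
  apply/ae_foralln => n; rewrite /P.
  case: (unpickle n) => [[m m']|]; last exact: aeW.
  have [e|mm] := eqVneq m m'; first by apply: aeW.
  pose h := (m'.1%:Z - m.1%:Z, m'.2%:Z - m.2%:Z).
  have h0 : h != (0, 0).
    apply: contra mm; rewrite /h xpair_eqE !subr_eq0 => /andP[/eqP[e1] /eqP[e2]].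
    by clear h; case: m m' e1 e2 => [a b] [c d] /= -> ->.
  have [n0 hn0] := combo_inj char_irr th1 (perron_root pf) second_lt h0.
  have := @ae_mean_wave R (fun j => combo zeta h (l + j)).
  move=> /(_ _)/ae_circleS; apply.
    move=> x hx _; apply: mean_to_ext hx => j.
    by rewrite mon_phases.
  exists n0 => i j ij nj; apply: hn0; first by rewrite ltn_add2l.
  exact: leq_trans (leq_addl _ _).
apply: ae_circleS hP => x hx m m' mm.
by have := hx (pickle (m, m')); rewrite /P pickleK; apply.
Qed.

Lemma ae_far l : {ae nu, forall x, exists c, 0 < c /\
  forall j b, c <= cmod (1 - phases l x j b) * j.+1%:R ^+ 2}.
Proof.
have hb b : {ae nu, forall x : R, exists c, 0 < c /\
    forall j, c <= cmod (1 - phases l x j b) * j.+1%:R ^+ 2}.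
  apply: (@ae_wave_far R (fun j => - (len zeta (l + j) b)%:Z)) => j.
  by rewrite oppr_eq0 -lt0n len_gt0.
apply: ae_circleS (ae_circleI (hb l0) (hb l1)) => x [[c [c0 hc]] [d [d0 hd]]].
exists (Num.min c d); split; first by rewrite lt_min c0.
move=> j; elim/letter_case.
- by apply: le_trans (hc j); rewrite ge_min lexx.
- by apply: le_trans (hd j); rewrite ge_min lexx orbT.
Qed.

Hypothesis cond : large_min_condition zeta theta \/ zero_entry_condition zeta \/
    block_condition zeta theta.

(** The exceptional set depends on the phases only, so the initial vector may be any function of the
    frequency. *)
Lemma ae_levels l (V0 : R -> letter -> R[i]) : {ae nu, forall x,
  (fun k => levels (vsum (phases l x) (V0 x)) k ^+ 2 / theta ^+ k) @ \oo --> 0}.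
Proof.
have [_ [X [Y [num [den [hm hlt]]]]]] := conditions_mahler pf cond.
apply: ae_circleS (ae_circleI (ae_equid l) (ae_far l)) => x [he [c [c0 hc]]].
set w := phases l x; set V := vsum w (V0 x).
have wS j : w j.+1 = next_phase zeta (w j) by apply/funext => b; exact: phasesS.
have VS j : V j.+1 = next_sum zeta (w j) (V j) by [].
have wu : unit_phases w := phases_unit l x.
have [K hK] := cocycle_det_bounded zeta wu.
have hg := mahler_gmean he wu hm hK.
set t0 : R := (size X + size Y)%:R in hlt hg.
(* The lemmas on growth need a rate of at least 1. *)
pose t := Num.max 1 t0.
have t1 : 1 <= t by rewrite le_max lexx.
have tth : t < theta by rewrite gt_max th1.
have hgt : gmean_le (fun j => nsq (cocycle_det zeta (w j))) t.
  by apply: gmean_le_trans hg; rewrite le_max lexx orbT.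
have hL := levels_growth wS VS wu c0 hc t1 hgt.
pose s := (t + theta) / 2.
have s1 : t < s < theta by rewrite /s; apply/andP; split; lra.
have /andP[ts sth] := s1.
have s0 : 0 < s by lra.
have [|C hC] := hL (Num.sqrt s); first by rewrite ltr_sqrt.
have th0 : 0 < theta by lra.
have lev0 k : 0 <= levels V k by exact: levels_ge0.
have hb k : 0 <= levels V k ^+ 2 / theta ^+ k <= C ^+ 2 * (s / theta) ^+ k.
  rewrite divr_ge0 ?sqr_ge0 ?exprn_ge0 ?(ltW th0) //=.
  rewrite expr_div_n mulrA ler_pM2r ?invr_gt0 ?exprn_gt0 //.
  apply: le_trans (_ : (C * Num.sqrt s ^+ k) ^+ 2 <= _).
    by rewrite lerXn2r ?nnegrE // (le_trans (lev0 k)).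
  by rewrite exprMn exprAC sqr_sqrtr // ltW.
apply: (squeeze_cvgr _ (cvg_cst (0 : R)) _).
  by apply: nearW; exact: hb.
rewrite [X in _ --> X](_ : _ = C ^+ 2 * 0); last by rewrite mulr0.
apply: cvgMr; apply: cvg_expr.
rewrite ger0_norm; last by rewrite divr_ge0 ?(ltW s0) ?(ltW th0).
by rewrite ltr_pdivrMr // mul1r.
Qed.

End Phases.

(** * Measurability, and separation from the Lebesgue measure *)

Section ComplexMeasurable.
Context d (T : measurableType d) (R : realType).
Implicit Types f g : T -> R[i].

Lemma cmeasurable_cst (c : R[i]) : cmeasurable (fun _ : T => c).
Proof. by split; exact: measurable_cst. Qed.

Lemma cmeasurableD f g : cmeasurable f -> cmeasurable g ->
  cmeasurable (fun x => f x + g x).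
Proof.
move=> [f1 f2] [g1 g2]; split.
- rewrite (_ : (fun x => _) = fun x => complex.Re (f x) + complex.Re (g x)).
    exact: measurable_funD.
  by apply/funext => x; case: (f x) => ? ?; case: (g x).
- rewrite (_ : (fun x => _) = fun x => complex.Im (f x) + complex.Im (g x)).
    exact: measurable_funD.
  by apply/funext => x; case: (f x) => ? ?; case: (g x).
Qed.

Lemma cmeasurableM f g : cmeasurable f -> cmeasurable g ->
  cmeasurable (fun x => f x * g x).
Proof.
move=> [f1 f2] [g1 g2]; split.
- rewrite (_ : (fun x => _) = fun x => complex.Re (f x) * complex.Re (g x) -
      complex.Im (f x) * complex.Im (g x)).
    by apply: measurable_funB; exact: measurable_funM.
  by apply/funext => x; case: (f x) => ? ?; case: (g x).
- rewrite (_ : (fun x => _) = fun x => complex.Re (f x) * complex.Im (g x) +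
      complex.Im (f x) * complex.Re (g x)).
    by apply: measurable_funD; exact: measurable_funM.
  by apply/funext => x; case: (f x) => ? ?; case: (g x).
Qed.

Lemma cmeasurable_sum (I : Type) (r : seq I) (F : I -> T -> R[i]) :
  (forall i, cmeasurable (F i)) -> cmeasurable (fun x => \sum_(i <- r) F i x).
Proof.
move=> h; elim: r => [|i r IH].
  by under eq_fun do rewrite big_nil; exact: cmeasurable_cst.
by under eq_fun do rewrite big_cons; exact: cmeasurableD.
Qed.

Lemma measurable_nsq f : cmeasurable f -> measurable_fun setT (fun x => nsq (f x)).
Proof.
by move=> [f1 f2]; apply: measurable_funD; exact: measurable_funX.
Qed.

End ComplexMeasurable.

Lemma cmeasurable_comp d d' (T : measurableType d) (U : measurableType d')
    (R : realType) (h : T -> U) (f : U -> R[i]) :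
  measurable_fun setT h -> cmeasurable f -> cmeasurable (fun x => f (h x)).
Proof.
by move=> mh [f1 f2]; split; [exact: (measurableT_comp f1 mh)|exact: (measurableT_comp f2 mh)].
Qed.

Lemma cmeasurable_wave (R : realType) (k : int) :
  cmeasurable (fun x : measurableTypeR R => wave k x).
Proof.
have [h1 h2] := wave_continuous R k.
split.
- exact: (@continuous_measurable_fun R _ h1).
- exact: (@continuous_measurable_fun R _ h2).
Qed.

Section Markov.
Context d (T : measurableType d) (R : realType) (m : {measure set T -> \bar R}).

Lemma markov_set (g : T -> \bar R) (a e : R) : measurable_fun setT g ->
  (forall x, 0 <= g x)%E -> 0 < a -> (\int[m]_x g x <= e%:E)%E ->
  (m [set x | (a%:E <= g x)%E] <= (e / a)%:E)%E.
Proof.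
move=> mg g0 a0 hg.
have := @le_integral_comp_abse _ _ _ m setT measurableT g a id (@measurable_id _ _ setT).
move=> /(_ (fun _ h => h) (fun _ _ _ _ h => h) mg a0).
have -> : setT `&` [set x | (a%:E <= `|g x|)%E] = [set x | (a%:E <= g x)%E].
  by rewrite setTI; apply/seteqP; split => x /=; rewrite gee0_abs.
under eq_integral do rewrite gee0_abs //.
move=> h; rewrite mulrC EFinM lee_pdivlMl //; exact: (le_trans h hg).
Qed.
End Markov.

Section Singular.
Context (R : realType).
Local Notation nu := (@circle_prob R).
Local Notation TR := (measurableTypeR R).
Variable sigma : {finite_measure set (measurableTypeR R) -> \bar R}.

(** The Fejer kernel at [t - x], kept as a squared sum: replacing [wave n t] by the values of [f]
    along an orbit gives the mean square of a twisted sum. *)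
Definition fejer N (x t : R) : R :=
  nsq (\sum_(n < N) wave (- n%:Z) x * wave n%:Z t) / N%:R.

Lemma fejer_ge0 N x t : 0 <= fejer N x t.
Proof. by rewrite divr_ge0 ?nsq_ge0. Qed.

Lemma measurable_fejer N :
  measurable_fun setT (fun p : TR * TR => fejer N p.1 p.2).
Proof.
apply: measurable_funM; last exact: measurable_cst.
apply: measurable_nsq; apply: cmeasurable_sum => n; apply: cmeasurableM.
- exact: (cmeasurable_comp (@measurable_fst _ _ _ _) (cmeasurable_wave R _)).
- exact: (cmeasurable_comp (@measurable_snd _ _ _ _) (cmeasurable_wave R _)).
Qed.

Lemma fejer_sym N x t : fejer N x t = fejer N t x.
Proof.
rewrite /fejer -nsq_conj conjc_sum; congr (nsq _ / _).
by apply: eq_bigr => n _; rewrite conjcM -!waveN opprK mulrC.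
Qed.

Lemma int_fejer N x : (0 < N)%N -> (\int[nu]_t (fejer N x t)%:E)%E = 1%E.
Proof.
move=> N0.
have inj : injective (fun n : 'I_N => (n : nat)%:Z) by move=> i j [/val_inj].
have h := has_intZ (N%:R^-1) (parseval_inj (fun n : 'I_N => wave (- (n : nat)%:Z) x) inj).
under eq_integral do rewrite /fejer mulrC.
rewrite (has_int_EFin h).
under eq_bigr do rewrite nsq_wave.
by rewrite sumr_const card_ord mulVf // pnatr_eq0 -lt0n.
Qed.

Lemma int_fejer1 N t : (0 < N)%N -> (\int[nu]_x (fejer N x t)%:E)%E = 1%E.
Proof. by move=> N0; under eq_integral do rewrite fejer_sym; exact: int_fejer. Qed.

(* Integrating the Fejer kernel over [A] gives a function whose sigma-integral
   is small and which is close to 1 in the mean. *)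
Lemma almost_separated (A : set TR) N (e : R) : measurable A -> (0 < N)%N -> 0 <= e ->
  (nu (~` A) <= e%:E)%E ->
  (forall x, A x -> (\int[sigma]_t (fejer N x t)%:E <= e%:E)%E) ->
  exists B : set TR, [/\ measurable B, (nu (~` B) <= (2 * e)%:E)%E &
    (sigma B <= (2 * e)%:E)%E].
Proof.
move=> mA N0 e0 nA sA.
pose f (S : set TR) (p : TR * TR) := (\1_S p.1 * fejer N p.1 p.2)%:E : \bar R.
have mf S : measurable S -> measurable_fun setT (f S).
  move=> mS; apply/measurable_EFinP; apply: measurable_funM; last exact: measurable_fejer.
  exact: (measurableT_comp (measurable_indic mS) (@measurable_fst _ _ _ _)).
have f0 S p : (0 <= f S p)%E by rewrite lee_fin mulr_ge0 ?fejer_ge0.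
pose u S t := (\int[nu]_x f S (x, t))%E.
have mu_ S : measurable S -> measurable_fun setT (u S).
  by move=> mS; exact: (measurable_fun_fubini_tonelli_G (m1 := nu) (f S) (mf S mS) (f0 S)).
have u0 S t : (0 <= u S t)%E by apply: integral_ge0 => x _; exact: f0.
have mfx x : measurable_fun setT (fun t => (fejer N x t)%:E).
  apply/measurable_EFinP.
  exact: (measurableT_comp (measurable_fejer N) (measurable_pair1 x)).
have inner (m : {measure set TR -> \bar R}) S x :
    (\int[m]_t f S (x, t))%E = ((\1_S x)%:E * \int[m]_t (fejer N x t)%:E)%E.
  rewrite -(ge0_integralZl m measurableT (mfx x)); first by apply: eq_integral.
  - by move=> t _; rewrite lee_fin fejer_ge0.
  - by rewrite lee_fin.
have hsig : (\int[sigma]_t u A t <= e%:E)%E.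
  rewrite /u -(fubini_tonelli (m1 := nu) (m2 := sigma) (f A) (mf A mA) (f0 A)).
  apply: (@le_trans _ _ (\int[nu]_x (cst e%:E x))%E).
    apply: ge0_le_integral => //.
    - by move=> x _; apply: integral_ge0.
    - exact: (measurable_fun_fubini_tonelli_F (m2 := sigma) (f A) (mf A mA) (f0 A)).
    - move=> x _; rewrite inner indicE.
      have [xA|xA] := boolP (x \in A); first by rewrite mul1e; apply: sA; rewrite inE in xA.
      by rewrite mul0e lee_fin.
  rewrite integral_cst // -[leRHS]mule1; apply: lee_wpmul2l; first by rewrite lee_fin.
  exact: (probability_le1 (@circle_prob R) measurableT).
have hnu : (\int[nu]_t u (~` A) t <= e%:E)%E.
  have mA' := measurableC mA.
  rewrite /u -(fubini_tonelli (m1 := nu) (m2 := nu) (f (~` A)) (mf _ mA') (f0 _)).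
  under eq_integral do rewrite inner int_fejer // mule1.
  by rewrite integral_indic // setIT.
have usum t : (u A t + u (~` A) t = 1)%E.
  rewrite -ge0_integralD //; first last.
  - exact: (measurableT_comp (mf _ (measurableC mA)) (measurable_pair2 t)).
  - exact: (measurableT_comp (mf _ mA) (measurable_pair2 t)).
  rewrite -(int_fejer1 t N0); apply: eq_integral => x _.
  rewrite /f -EFinD -mulrDl !indicE in_setC.
  by case: (x \in A); rewrite /= ?add0r ?addr0 mul1r.
exists [set t | (2^-1%:E <= u A t)%E]; split.
- rewrite -[X in measurable X]setTI; apply: emeasurable_fun_c_infty => //; exact: mu_.
- have := markov_set (mu_ _ (measurableC mA)) (u0 _) (_ : 0 < 2^-1) hnu.
  rewrite invr_gt0 ltr0n invrK mulrC => /(_ isT); apply: le_trans.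
  apply: le_measure; rewrite ?inE.
  + apply: measurableC; rewrite -[X in measurable X]setTI.
    apply: emeasurable_fun_c_infty => //; exact: mu_.
  + rewrite -[X in measurable X]setTI.
    by apply: emeasurable_fun_c_infty => //; apply: mu_; exact: measurableC.
  + move=> t /= /negP; rewrite -ltNge => h; rewrite leNgt; apply/negP => h'.
    have := usum t; move: h h' (u0 A t) (u0 (~` A) t).
    case: (u A t) => [a||] //; case: (u (~` A) t) => [b||] //.
    rewrite !lte_fin !lee_fin => h1 h2 _ _ []; lra.
- have := markov_set (mu_ _ mA) (u0 _) (_ : 0 < 2^-1) hsig.
  by rewrite invr_gt0 ltr0n invrK mulrC => /(_ isT).
Qed.

(** Borel-Cantelli with errors [1 / 2 ^ k.+1]. The upper limit of the complements is [nu]-null; the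
    lower limit of the [B k] is a countable union of sets, each contained in all late [B k] and
    therefore [sigma]-null. *)
Lemma singular_from_separated :
  (forall e : R, 0 < e -> exists B : set TR, [/\ measurable B,
     (nu (~` B) <= e%:E)%E & (sigma B <= e%:E)%E]) ->
  exists B : set TR, [/\ measurable B, nu (~` B) = 0%E & sigma B = 0%E].
Proof.
move=> h.
have h2 k : 0 < 1 / (2 ^ k.+1)%:R :> R by rewrite divr_gt0 // ltr0n expn_gt0.
have [B hB] := choice (fun k => h _ (h2 k)).
pose C k := ~` B k.
have mB k : measurable (B k) by have [] := hB k.
have mC k : measurable (C k) by apply: measurableC.
have mlim : measurable (lim_sup_set C).
  apply: bigcap_measurable => //= k _; exact: bigcup_measurable.
have nlim : nu (lim_sup_set C) = 0%E.
  apply: lim_sup_set_cvg0 => //.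
  apply: (@le_lt_trans _ _ 1%E); last by rewrite ltry.
  apply: le_trans (@epsilon_trick0 R 1 xpredT ler01).
  by apply: lee_nneseries => k _ //; have [] := hB k.
exists (~` lim_sup_set C); split; [exact: measurableC|by rewrite setCK|].
have -> : ~` lim_sup_set C = \bigcup_n \bigcap_(k in [set k | (n <= k)%N]) B k.
  rewrite /lim_sup_set setC_bigcap; apply: eq_bigcup => // n _.
  rewrite setC_bigcup; apply: eq_bigcapr => k _.
  by rewrite /C setCK.
have mcap n : measurable (\bigcap_(k in [set k | (n <= k)%N]) B k).
  by apply: bigcap_measurable => [|k _]; [exists n => /=|exact: mB].
apply/eqP; rewrite -measure_le0.
apply: (le_trans (measure_sigma_subadditive _ mcap _ (subset_refl _))).
  exact: bigcup_measurable.
  exact: subset_refl.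
rewrite eseries0 // => n _ _.
apply/eqP; rewrite -measure_le0; apply/lee_addgt0Pr => e e0.
rewrite add0e.
have [k0 _ hk0] := near_infty_natSinv_expn_lt (PosNum e0).
pose k := maxn n k0.
apply: (@le_trans _ _ (sigma (B k))).
  apply: le_measure; rewrite ?inE //.
  by move=> t; apply; rewrite /= leq_maxl.
have [_ _ h3] := hB k; apply: (le_trans h3); rewrite lee_fin ltW //.
apply: le_lt_trans (hk0 k (leq_maxr _ _)).
rewrite !div1r lef_pV2 ?posrE ?exprn_gt0 ?ltr0n ?expn_gt0 // natrX.
by rewrite exprS ler_peMl // ?exprn_ge0 // ler1n.
Qed.

End Singular.

(** * Measurable sets and invariant integrals on the shift *)

Section Shift.

Lemma measurable_coordinate (i : int) (a : letter) :
  measurable [set x : full_shift | x i = a].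
Proof. by apply: sub_sigma_algebra; exists i, a. Qed.

Lemma measurable_shift_pow (k : int) : measurable_fun setT (shift_pow k).
Proof.
refine (@measurability _ _ full_shift full_shift setT (shift_pow k) coordinate_sets erefl _).
move=> _ [_ [n [a ->]] <-]; rewrite setTI.
exact: (measurable_coordinate (n + k) a).
Qed.

Lemma factor_atS (x : int -> letter) i n :
  factor_at x i n.+1 = x i :: factor_at x (i + 1) n.
Proof.
rewrite /factor_at /= addr0; congr (_ :: _).
rewrite (iotaDl 1 0) -map_comp; apply: eq_map => k /=.
by rewrite PoszD addrA.
Qed.

Lemma size_factor_at x i n : size (factor_at x i n) = n.
Proof. by rewrite /factor_at size_map size_iota. Qed.

Lemma measurable_factor i n (P : set (seq letter)) :
  measurable [set x : full_shift | P (factor_at x i n)].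
Proof.
elim: n i P => [|n IH] i P.
  have [p|np] := pselect (P [::]).
    by rewrite (_ : [set x | _] = setT) //; apply/seteqP; split.
  by rewrite (_ : [set x | _] = set0) //; apply/seteqP; split.
rewrite (_ : [set x | _] =
   ([set x | x i = l0] `&` [set x | P (l0 :: factor_at x (i + 1) n)]) `|`
   ([set x | x i = l1] `&` [set x | P (l1 :: factor_at x (i + 1) n)])).
  apply: measurableU; apply: measurableI.
  - exact: measurable_coordinate.
  - exact: (IH (i + 1) (fun u => P (l0 :: u))).
  - exact: measurable_coordinate.
  - exact: (IH (i + 1) (fun u => P (l1 :: u))).
apply/seteqP; split => x /=; rewrite factor_atS.
  by elim/letter_case: (x i) => h; [left|right].
by case=> [[-> ]|[-> ]].
Qed.

Lemma measurable_subst_space (zeta : substitution) :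
  measurable (subst_space zeta : set full_shift).
Proof.
(* Two conditions for each natural [n] account for all integer positions. *)
rewrite (_ : subst_space zeta = \bigcap_n \bigcap_m
  ([set x | exists a k, infix (factor_at x n%:Z m) (iter k (subst_word zeta) [:: a])] `&`
   [set x | exists a k, infix (factor_at x (- n%:Z) m) (iter k (subst_word zeta) [:: a])])).
  apply: bigcapT_measurable => n; apply: bigcapT_measurable => m.
  apply: measurableI.
    exact: (measurable_factor n%:Z m (fun u => exists a k, infix u (iter k (subst_word zeta) [:: a]))).
  exact: (measurable_factor (- n%:Z) m (fun u => exists a k, infix u (iter k (subst_word zeta) [:: a]))).
apply/seteqP; split => x.
  by move=> h n _ m _; split; exact: h.
move=> h i n; have [h1 h2] := h `|i|%N I n I.
have [i0|i0] := leP 0 i.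
  by move: h1 => /=; rewrite gez0_abs.
by move: h2 => /=; rewrite lez0_abs ?opprK // ltW.
Qed.

Lemma measurable_word_fun d (U : measurableType d) i n (G : seq letter -> U) :
  measurable_fun setT (fun x : full_shift => G (factor_at x i n)).
Proof.
move=> _ B mB; rewrite setTI.
exact: (measurable_factor i n (fun u => B (G u))).
Qed.

Lemma shift_powD k l x : shift_pow k (shift_pow l x) = shift_pow (k + l) x.
Proof. by apply/funext => n; rewrite /shift_pow -addrA. Qed.

Variables (R : realType) (mu : probability full_shift R).
Hypothesis inv : shift_invariant mu.

Lemma shift_pow_invariant (n : nat) (B : set full_shift) : measurable B ->
  mu (shift_pow n%:Z @^-1` B) = mu B.
Proof.
elim: n B => [|n IH] B mB.
  congr (mu _); apply/seteqP; split => x /=.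
    by rewrite (_ : shift_pow 0 x = x) //; apply/funext => i; rewrite /shift_pow addr0.
  by rewrite (_ : shift_pow 0 x = x) //; apply/funext => i; rewrite /shift_pow addr0.
have -> : shift_pow n.+1%:Z @^-1` B = shift @^-1` (shift_pow n%:Z @^-1` B).
  apply/seteqP; split => x /=; rewrite /shift shift_powD -addn1 PoszD //.
rewrite inv ?IH //.
by rewrite -[X in measurable X]setTI; apply: measurable_shift_pow.
Qed.

Lemma integral_shift (n : nat) (f : full_shift -> \bar R) :
  measurable_fun setT f -> (forall x, 0 <= f x)%E ->
  (\int[mu]_x f (shift_pow n%:Z x) = \int[mu]_x f x)%E.
Proof.
move=> mf f0.
have mphi := measurable_shift_pow n%:Z.
pose pf : {measure set full_shift -> \bar R} := pushforward mu (shift_pow n%:Z).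
transitivity (\int[pf mphi]_x f x)%E.
  by rewrite (ge0_integral_pushforward mphi mu measurableT mf).
apply: eq_measure_integral => A mA _.
exact: shift_pow_invariant.
Qed.

Lemma has_int_shift (n : nat) (f : full_shift -> R) v :
  has_int mu f v -> has_int mu (fun x => f (shift_pow n%:Z x)) v.
Proof.
move=> [fi <-].
have mf : measurable_fun setT (EFin \o f) by exact: (measurable_int mu).
split.
  apply/integrableP; split.
    exact: (measurableT_comp mf (measurable_shift_pow n%:Z)).
  rewrite (@integral_shift n (fun x => `|(f x)%:E|)%E) //.
    by case/integrableP: fi.
  exact: measurableT_comp.
rewrite /Rintegral [in LHS]integralE [in RHS]integralE.
congr (fine (_ - _)).
  transitivity (\int[mu]_x ((EFin \o f)^\+)%E (shift_pow n%:Z x))%E.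
    by apply: eq_integral => x _; rewrite !funeposE.
  by apply: integral_shift; [exact: measurable_funepos|move=> x; exact: funepos_ge0].
transitivity (\int[mu]_x ((EFin \o f)^\-)%E (shift_pow n%:Z x))%E.
  by apply: eq_integral => x _; rewrite !funenegE.
by apply: integral_shift; [exact: measurable_funeneg|move=> x; exact: funeneg_ge0].
Qed.
End Shift.

(** * Approximation by functions of finitely many coordinates *)

Section Cylinders.

Definition window (T : Type) (r : nat) (g : full_shift -> T) :=
  forall x y : full_shift, (forall i : int, (`|i| <= r)%N -> x i = y i) -> g x = g y.

Lemma window_le (T : Type) r s (g : full_shift -> T) : (r <= s)%N ->
  window r g -> window s g.
Proof. by move=> rs h x y xy; apply: h => i ir; apply: xy; exact: leq_trans rs. Qed.

Lemma window_comp2 (T U W : Type) r s (f : full_shift -> T) (g : full_shift -> U)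
    (op : T -> U -> W) : window r f -> window s g ->
  window (maxn r s) (fun x => op (f x) (g x)).
Proof.
move=> hf hg x y xy.
by rewrite (window_le (leq_maxl r s) hf xy) (window_le (leq_maxr r s) hg xy).
Qed.

Lemma window_comp (T W : Type) r (f : full_shift -> T) (op : T -> W) :
  window r f -> window r (fun x => op (f x)).
Proof. by move=> hf x y xy; rewrite (hf _ _ xy). Qed.

(** Positions outside [[- r, r]] receive arbitrary values: the absolute value reflects those on the
    left, and [nth] fills in [l0] beyond the length of [u]. *)
Definition word_ext (r : nat) (u : seq letter) : full_shift :=
  fun i => nth l0 u `|i + r%:Z|.

Lemma window_word (T : Type) r (g : full_shift -> T) x : window r g ->
  g x = g (word_ext r (factor_at x (- r%:Z) (r + r).+1)).
Proof.
move=> h; apply: h => i ir; rewrite /word_ext /factor_at.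
have i0 : 0 <= i + r%:Z by lia.
rewrite (nth_map 0%N) ?size_iota; last by lia.
rewrite nth_iota; last by lia.
by rewrite add0n gez0_abs // addrC addrK.
Qed.

Lemma window_measurable d (U : measurableType d) r (g : full_shift -> U) :
  window r g -> measurable_fun setT g.
Proof.
move=> h; rewrite (_ : g = fun x => (fun u => g (word_ext r u))
  (factor_at x (- r%:Z) (r + r).+1)); first exact: (measurable_word_fun (- r%:Z) (r + r).+1 (fun u => g (word_ext r u))).
by apply/funext => x; exact: window_word.
Qed.

Lemma window_measurable_set r (C : set full_shift) : window r C -> measurable C.
Proof.
move=> h; rewrite (_ : C = [set x | C (word_ext r (factor_at x (- r%:Z) (r + r).+1))]).
  exact: (measurable_factor _ _ (fun u => C (word_ext r u))).
by apply/seteqP; split => x /=; rewrite -(window_word x h).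
Qed.

End Cylinders.

Lemma cvge0_small (R : realType) (u : nat -> \bar R) (e : R) : 0 < e ->
  u @ \oo --> 0%E -> exists n, (u n <= e%:E)%E.
Proof.
move=> e0 hu; apply: contrapT => /forallNP h.
have : (e%:E <= lim (u @ \oo))%E.
  apply: lime_ge; first by apply/cvg_ex; exists 0%E.
  by apply: nearW => n; have /negP := h n; rewrite -ltNge => /ltW.
by rewrite (cvg_lim _ hu) // lee_fin leNgt e0.
Qed.

Section Approximation.
Context (R : realType) (mu : probability full_shift R).

Definition symdiff (A C : set full_shift) := (A `\` C) `|` (C `\` A).

Definition set_approx (A : set full_shift) := measurable A /\
  forall e : R, 0 < e -> exists r (C : set full_shift), window r C /\
    (mu (symdiff A C) <= e%:E)%E.

Lemma measurable_symdiff A C : measurable A -> measurable C -> measurable (symdiff A C).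
Proof. by move=> mA mC; apply: measurableU; exact: measurableD. Qed.

Lemma set_approxC A : set_approx A -> set_approx (~` A).
Proof.
move=> [mA h]; split; first exact: measurableC.
move=> e /h[r [C [hC le]]]; exists r, (~` C); split.
  exact: (window_comp (fun P => ~ P) hC).
rewrite (_ : symdiff _ _ = symdiff A C) //.
by rewrite /symdiff !setDE !setCK setUC [~` A `&` C]setIC [~` C `&` A]setIC.
Qed.

Lemma set_approxU A B : set_approx A -> set_approx B -> set_approx (A `|` B).
Proof.
move=> [mA hA] [mB hB]; split; first exact: measurableU.
move=> e e0; have e2 : 0 < e / 2 by rewrite divr_gt0.
have [r [C [hC le1]]] := hA _ e2; have [s [D [hD le2]]] := hB _ e2.
exists (maxn r s), (C `|` D); split.
  exact: (window_comp2 (fun P Q => P \/ Q) hC hD).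
have mC := window_measurable_set hC; have mD := window_measurable_set hD.
apply: (@le_trans _ _ (mu (symdiff A C `|` symdiff B D))).
  apply: le_measure; rewrite ?inE.
  - by apply: measurable_symdiff; exact: measurableU.
  - by apply: measurableU; exact: measurable_symdiff.
  - move=> x; rewrite /symdiff /=.
    by move=> [[[a|b] /not_orP[c d]]|[[c|d] /not_orP[a b]]]; [left; left|right; left|left; right|right; right].
apply: (le_trans (measureU2 _ _ _)); try exact: measurable_symdiff.
by rewrite [e]splitr EFinD; exact: leeD.
Qed.

Lemma set_approx0 : set_approx set0.
Proof.
split => // e e0; exists 0%N, set0; split => //.
by rewrite /symdiff set0D setU0 measure0 lee_fin ltW.
Qed.

(** Half of [e] pays for a finite union in place of the countable one, by continuity of [mu] from
    above, and half for the cylinder that approximates it. *)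
Lemma set_approx_bigcup (A : (set full_shift)^nat) :
  (forall n, set_approx (A n)) -> set_approx (\bigcup_n A n).
Proof.
move=> hA; have mA n : measurable (A n) by have [] := hA n.
pose B n := \big[setU/set0]_(i < n) A i.
have hB n : set_approx (B n).
  rewrite /B; elim: n => [|n IH]; first by rewrite big_ord0; exact: set_approx0.
  by rewrite big_ord_recr; exact: set_approxU.
have mB n : measurable (B n) by have [] := hB n.
have mU : measurable (\bigcup_n A n) by exact: bigcup_measurable.
have BU n : B n `<=` \bigcup_n A n.
  by rewrite /B -bigcup_mkord; by move=> x [k _ Ak]; exists k.
split => // e e0; have e2 : 0 < e / 2 by rewrite divr_gt0.
have UB : \bigcap_n (\bigcup_n A n `\` B n) = set0.
  apply/seteqP; split => // x h; have [[n _ xn] _] := h 0%N I.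
  have [_] := h n.+1 I; apply; rewrite /B -bigcup_mkord.
  by exists n => //=.
have hc : mu \o (fun n => \bigcup_n A n `\` B n) @ \oo --> 0%E.
  rewrite -(measure0 mu) -UB; apply: nonincreasing_cvg_mu => //.
  - by apply: le_lt_trans (probability_le1 mu _) _; [exact: measurableD|rewrite ltry].
  - by move=> n; exact: measurableD.
  - by rewrite UB.
  - move=> m n mn; apply/subsetPset; apply: setDS.
    by rewrite /B -!bigcup_mkord => x [k /= km Ak]; exists k => //=; exact: leq_trans mn.
have [n hn] := cvge0_small e2 hc.
have [_ /(_ _ e2)[r [C [hC le]]]] := hB n.
exists r, C; split => //.
have mC := window_measurable_set hC.
apply: (@le_trans _ _ (mu ((\bigcup_n A n `\` B n) `|` symdiff (B n) C))).
  apply: le_measure; rewrite ?inE.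
  - exact: measurable_symdiff.
  - by apply: measurableU; [exact: measurableD|exact: measurable_symdiff].
  - move=> x [[xA xC]|[xC xA]].
      by have [xB|xB] := pselect (B n x); [right; left|left].
    by right; right; split => // xB; apply: xA; exact: BU xB.
apply: (le_trans (measureU2 _ _ _)); [exact: measurableD|exact: measurable_symdiff|].
by rewrite [e]splitr EFinD; exact: leeD.
Qed.

Lemma set_approx_all (A : set full_shift) : measurable A -> set_approx A.
Proof.
apply: (@smallest_sub _ (sigma_algebra setT) coordinate_sets) => /=.
  split; first exact: set_approx0.
    by move=> B /set_approxC; rewrite setTD.
  exact: set_approx_bigcup.
move=> _ [n [a ->]]; split; first exact: measurable_coordinate.
move=> e e0; exists `|n|%N, [set x | x n = a]; split.
  by move=> x y xy; rewrite /= (xy n).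
by rewrite /symdiff setDv setU0 measure0 lee_fin ltW.
Qed.

Definition fun_approx (f : full_shift -> R) := measurable_fun setT f /\
  forall e : R, 0 < e -> exists r (g : full_shift -> R) (M : R),
  [/\ window r g, forall x, `|g x| <= M &
      (\int[mu]_x (`|f x - g x|)%:E <= e%:E)%E].

Lemma fun_approx_near (f : full_shift -> R) : measurable_fun setT f ->
  (forall e : R, 0 < e -> exists h, fun_approx h /\
    (\int[mu]_x (`|f x - h x|)%:E <= e%:E)%E) -> fun_approx f.
Proof.
move=> mf h; split => // e e0; have e2 : 0 < e / 2 by rewrite divr_gt0.
have [k [[mk hk] le1]] := h _ e2; have [r [g [M [wg gM le2]]]] := hk _ e2.
exists r, g, M; split => //.
have mg := window_measurable wg.
have m1 : measurable_fun setT (fun x => (`|f x - k x|)%:E).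
  by apply/measurable_EFinP; apply: measurableT_comp => //; exact: measurable_funB.
have m2 : measurable_fun setT (fun x => (`|k x - g x|)%:E).
  by apply/measurable_EFinP; apply: measurableT_comp => //; exact: measurable_funB.
rewrite [e]splitr EFinD; apply: le_trans (leeD le1 le2).
rewrite -ge0_integralD //; first last.
- apply: ge0_le_integral => //.
  + by apply/measurable_EFinP; apply: measurableT_comp => //; exact: measurable_funB.
  + exact: emeasurable_funD.
  + move=> x _; rewrite -EFinD lee_fin.
    by rewrite -[f x - g x](subrKA (k x)) // ler_normD.
Qed.

Lemma fun_approxD f1 f2 : fun_approx f1 -> fun_approx f2 ->
  fun_approx (fun x => f1 x + f2 x).
Proof.
move=> [mf1 h1] [mf2 h2]; split; first exact: measurable_funD.
move=> e e0; have e2 : 0 < e / 2 by rewrite divr_gt0.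
have [r1 [g1 [M1 [w1 gM1 le1]]]] := h1 _ e2.
have [r2 [g2 [M2 [w2 gM2 le2]]]] := h2 _ e2.
exists (maxn r1 r2), (fun x => g1 x + g2 x), (M1 + M2); split.
- exact: (window_comp2 (fun a b => a + b) w1 w2).
- by move=> x; apply: (le_trans (ler_normD _ _)); exact: lerD.
have mg1 := window_measurable w1; have mg2 := window_measurable w2.
have m1 : measurable_fun setT (fun x => (`|f1 x - g1 x|)%:E).
  by apply/measurable_EFinP; apply: measurableT_comp => //; exact: measurable_funB.
have m2 : measurable_fun setT (fun x => (`|f2 x - g2 x|)%:E).
  by apply/measurable_EFinP; apply: measurableT_comp => //; exact: measurable_funB.
rewrite [e]splitr EFinD; apply: le_trans (leeD le1 le2).
rewrite -ge0_integralD //.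
apply: ge0_le_integral => //.
- apply/measurable_EFinP; apply: measurableT_comp => //; apply: measurable_funB; exact: measurable_funD.
- exact: emeasurable_funD.
- move=> x _; rewrite -EFinD lee_fin.
  by rewrite opprD addrACA ler_normD.
Qed.

Lemma fun_approxZ a f : fun_approx f -> fun_approx (fun x => a * f x).
Proof.
move=> [mf h]; split; first exact: measurable_funM.
move=> e e0; have a0 : 0 < `|a| + 1 by rewrite ltr_wpDl.
have [|r [g [M [w gM le]]]] := h (e / (`|a| + 1)); first by rewrite divr_gt0.
exists r, (fun x => a * g x), (`|a| * M); split.
- exact: (window_comp (fun b => a * b) w).
- by move=> x; rewrite normrM ler_wpM2l.
have mg := window_measurable w.
have m1 : measurable_fun setT (fun x => (`|f x - g x|)%:E).
  by apply/measurable_EFinP; apply: measurableT_comp => //; exact: measurable_funB.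
under eq_integral do rewrite -mulrBr normrM EFinM.
rewrite ge0_integralZl //.
apply: (le_trans (lee_wpmul2l _ le)); first by rewrite lee_fin.
rewrite -EFinM lee_fin mulrCA ler_piMr ?(ltW e0) // ler_pdivrMr // mul1r lerDl.
exact: ler01.
Qed.

Lemma fun_approx_indic A : measurable A -> fun_approx (\1_A : full_shift -> R).
Proof.
move=> mA; split; first exact: measurable_indic.
move=> e e0; have [_ /(_ e e0)[r [C [wC le]]]] := set_approx_all mA.
exists r, \1_C, 1; split.
- move=> x y xy; have e1 := wC _ _ xy; rewrite !indicE; congr (_%:R); congr nat_of_bool.
  by apply/idP/idP; rewrite !inE e1.
- by move=> x; rewrite indicE; case: (_ \in _); rewrite ?normr1 ?normr0.
have mC := window_measurable_set wC.
have E : mu (symdiff A C) = (\int[mu]_x (\1_(symdiff A C) x)%:E)%E.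
  by rewrite integral_indic ?setIT //; exact: measurable_symdiff.
apply: le_trans le; rewrite E.
rewrite le_eqVlt; apply/orP; left; apply/eqP; apply: eq_integral => x _; congr (_%:E).
rewrite !indicE /symdiff in_setU !in_setD.
by case: (x \in A); case: (x \in C); rewrite /= ?subrr ?normr0 ?subr0 ?sub0r ?normrN ?normr1.
Qed.

Lemma fun_approx_sum (I : Type) (s : seq I) (f : I -> full_shift -> R) :
  (forall i, fun_approx (f i)) -> fun_approx (fun x => \sum_(i <- s) f i x).
Proof.
move=> h; elim: s => [|i s IH].
  have -> : (fun x => \sum_(i <- [::]) f i x) = fun x => 0 * (\1_set0 : full_shift -> R) x.
    by apply/funext => x; rewrite big_nil mul0r.
  by apply: fun_approxZ; exact: fun_approx_indic.
have -> : (fun x => \sum_(j <- i :: s) f j x) = fun x => f i x + \sum_(j <- s) f j x.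
  by apply/funext => x; rewrite big_cons.
exact: fun_approxD.
Qed.

Import HBSimple.

Lemma fun_approx_integrable (f : full_shift -> R) :
  mu.-integrable setT (EFin \o f) -> fun_approx f.
Proof.
move=> fi; have mf : measurable_fun setT f.
  by apply/measurable_EFinP; exact: (measurable_int mu).
have [s_ [_ _ hs]] := approximation_sfun_integrable measurableT fi.
apply: fun_approx_near => // e e0.
have [n hn] := cvge0_small e0 hs.
exists (s_ n); split; last first.
  apply: le_trans hn; rewrite le_eqVlt; apply/orP; left; apply/eqP.
  by apply: eq_integral => x _.
have -> : (s_ n : full_shift -> R) = fun x => \sum_(y <- finmap.enum_fset (fset_set (range (s_ n))))
    y * (\1_(s_ n @^-1` [set y]) : full_shift -> R) x.
  apply/funext => x; rewrite [LHS]fimfunE fsbig_finite //.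
apply: fun_approx_sum => y; apply: fun_approxZ; apply: fun_approx_indic.
exact: measurable_sfunP.
Qed.

End Approximation.

Section L2Approximation.
Context (R : realType) (mu : probability full_shift R).

(** Truncation to [[- M, M]]. It is a contraction, and between functions bounded by [M] an L1
    approximation is also an L2 approximation. *)
Definition clamp (M t : R) : R := Num.max (- M) (Num.min M t).

Lemma clamp_bound M t : 0 <= M -> `|clamp M t| <= M.
Proof.
move=> M0; rewrite /clamp ler_norml le_max lexx /= ge_max ge_min lexx /= andbT.
lra.
Qed.

Lemma clamp_id M t : `|t| <= M -> clamp M t = t.
Proof.
by rewrite ler_norml /clamp => /andP[h1 h2]; rewrite (min_idPr h2) (max_idPr h1).
Qed.

Lemma clamp_lip M s t : 0 <= M -> `|clamp M s - clamp M t| <= `|s - t|.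
Proof.
move=> M0; rewrite /clamp !maxEle !minEle.
do ! case: ifPn; rewrite -?ltNge => *; rewrite ler_norml; apply/andP; split;
  have := ler_norm (s - t); have := ler_norm (t - s); rewrite distrC; lra.
Qed.

Lemma measurable_clamp M : measurable_fun setT (clamp M).
Proof.
apply: measurable_maxr; first exact: measurable_cst.
by apply: measurable_minr; [exact: measurable_cst|exact: measurable_id].
Qed.

Lemma clamp_L2 (phi : full_shift -> R) : measurable_fun setT phi ->
  (\int[mu]_x (phi x ^+ 2)%:E < +oo)%E -> forall e : R, 0 < e ->
  exists n : nat, (\int[mu]_x ((phi x - clamp n%:R (phi x)) ^+ 2)%:E <= e%:E)%E.
Proof.
move=> mphi hphi e e0.
have mc n : measurable_fun setT (fun x => clamp n%:R (phi x)).
  exact: (measurableT_comp (@measurable_clamp n%:R) mphi).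
have md n : measurable_fun setT (fun x => ((phi x - clamp n%:R (phi x)) ^+ 2)%:E).
  by apply/measurable_EFinP; apply: measurable_funX; exact: measurable_funB.
have ms : measurable_fun setT (fun x => (phi x ^+ 2)%:E).
  by apply/measurable_EFinP; exact: measurable_funX.
have is2 : mu.-integrable setT (fun x => (phi x ^+ 2)%:E).
  apply/integrableP; split => //.
  by under eq_integral do rewrite gee0_abs ?lee_fin ?sqr_ge0 //.
have clamp0 t : clamp 0 t = 0.
  by apply/eqP; rewrite -normr_le0; exact: clamp_bound.
have dom : {ae mu, forall x n, setT x ->
    (`|((phi x - clamp n%:R (phi x)) ^+ 2)%:E| <= (phi x ^+ 2)%:E)%E}.
  apply: aeW => x n _; rewrite gee0_abs ?lee_fin ?sqr_ge0 //.
  rewrite -[leLHS]real_normK ?num_real // -[leRHS]real_normK ?num_real //.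
  rewrite lerXn2r ?nnegrE //.
  have [h|h] := leP `|phi x| n%:R; first by rewrite clamp_id // subrr normr0.
  have n0 : (0 : R) <= n%:R by exact: ler0n.
  have [p|p] := leP 0 (phi x).
    rewrite (ger0_norm p) in h *.
    have h1 : n%:R <= phi x by exact: ltW.
    have h2 : - n%:R <= n%:R :> R by lra.
    by rewrite /clamp (min_idPl h1) (max_idPr h2) ger0_norm ?subr_ge0 // gerBl.
  rewrite (ltr0_norm p) in h *.
  have h1 : phi x <= n%:R by lra.
  have h2 : phi x <= - n%:R by lra.
  by rewrite /clamp (min_idPr h1) (max_idPl h2) opprK ler0_norm; lra.
have pt : {ae mu, forall x, setT x ->
    (fun n => ((phi x - clamp n%:R (phi x)) ^+ 2)%:E) @ \oo --> 0%E}.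
  apply: aeW => x _; apply: (@cvg_trans _ ((fun=> 0%E : \bar R) @ \oo)); last exact: cvg_cst.
  apply: near_eq_cvg; exists (Num.bound `|phi x|) => // n /= hn.
  rewrite clamp_id ?subrr ?expr0n //.
  apply: ltW; apply: lt_le_trans (archi_boundP _) _; first exact: normr_ge0.
  by rewrite ler_nat.
have [_ _] := dominated_convergence measurableT md (measurable_cst 0%E) pt is2 dom.
rewrite integral0 => hcv.
exact: cvge0_small hcv.
Qed.

Lemma L2_window (phi : full_shift -> R) : measurable_fun setT phi ->
  (\int[mu]_x (phi x ^+ 2)%:E < +oo)%E -> forall e : R, 0 < e ->
  exists r (g : full_shift -> R) (M : R), [/\ window r g, forall x, `|g x| <= M &
    (\int[mu]_x ((phi x - g x) ^+ 2)%:E <= e%:E)%E].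
Proof.
move=> mphi hphi e e0.
have [|n hn] := clamp_L2 mphi hphi (e := e / 4); first by rewrite divr_gt0.
pose c x := clamp n%:R (phi x).
have mc : measurable_fun setT c.
  exact: (measurableT_comp (@measurable_clamp n%:R) mphi).
have ci : mu.-integrable setT (EFin \o c).
  apply: measurable_bounded_integrable => //.
    by apply: le_lt_trans (probability_le1 mu measurableT) _; rewrite ltry.
  exists n%:R; split; first by rewrite num_real.
  by move=> M nM x _; apply: le_trans (ltW nM); apply: clamp_bound.
(* Since [|c x - k x| <= 2 n], its square is at most [2 n |c x - g x|], which is doubled below to
   [4 n]. The 1 keeps the denominator positive when [n = 0]. *)
have [_ /(_ (e / (8 * (n%:R + 1))))] := fun_approx_integrable ci.
have n1 : 0 < 8 * (n%:R + 1) :> R by rewrite mulr_gt0 // ltr_wpDl.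
case; first by rewrite divr_gt0.
move=> r [g [M [wg _ le]]].
have mg := window_measurable wg.
pose k x := clamp n%:R (g x).
have mk : measurable_fun setT k.
  exact: (measurableT_comp (@measurable_clamp n%:R) mg).
exists r, k, n%:R; split.
- exact: (window_comp (clamp n%:R) wg).
- by move=> x; exact: clamp_bound.
have m1 : measurable_fun setT (fun x => ((phi x - c x) ^+ 2)%:E).
  by apply/measurable_EFinP; apply: measurable_funX; exact: measurable_funB.
have m2 : measurable_fun setT (fun x => (`|c x - g x|)%:E).
  by apply/measurable_EFinP; apply: measurableT_comp => //; exact: measurable_funB.
apply: (@le_trans _ _ (\int[mu]_x (2%:E * ((phi x - c x) ^+ 2)%:E +
    (4 * n%:R)%:E * (`|c x - g x|)%:E))%E).
  apply: ge0_le_integral => //.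
  - by move=> x _; rewrite lee_fin sqr_ge0.
  - by apply/measurable_EFinP; apply: measurable_funX; exact: measurable_funB.
  - by apply: emeasurable_funD; exact: emeasurable_funM.
  - move=> x _; rewrite -!EFinM -EFinD lee_fin.
    have cn : `|c x| <= n%:R by exact: clamp_bound.
    have kn : `|k x| <= n%:R by exact: clamp_bound.
    have ck : `|c x - k x| <= `|c x - g x|.
      by rewrite -{1}(clamp_id cn); exact: clamp_lip.
    have ck2 : (c x - k x) ^+ 2 <= 2 * n%:R * `|c x - g x|.
      rewrite -real_normK ?num_real // expr2; apply: ler_pM => //.
      by apply: (le_trans (ler_normB _ _)); lra.
    have := sqr_ge0 ((phi x - c x) - (c x - k x)); nra.
have p1 x : (0 <= 2%:E * ((phi x - c x) ^+ 2)%:E)%E.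
  by rewrite -EFinM lee_fin mulr_ge0 ?sqr_ge0.
have p2 x : (0 <= (4 * n%:R)%:E * (`|c x - g x|)%:E)%E.
  by rewrite -EFinM lee_fin !mulr_ge0.
rewrite ge0_integralD //; try exact: emeasurable_funM.
rewrite (ge0_integralZl mu measurableT m1); last by rewrite lee_fin.
  rewrite (ge0_integralZl mu measurableT m2); last by rewrite lee_fin mulr_ge0.
    have -> : e%:E = (2%:E * (e / 4)%:E + (4 * (n%:R + 1))%:E * (e / (8 * (n%:R + 1)))%:E)%E.
      rewrite -!EFinM -EFinD; congr (_%:E); field.
      by rewrite gt_eqF // ltr_wpDl.
    apply: leeD; first by apply: lee_wpmul2l; rewrite ?lee_fin.
    apply: lee_pmul.
    - by rewrite lee_fin mulr_ge0.
    - by apply: integral_ge0 => x _; rewrite lee_fin.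
    - by rewrite lee_fin ler_wpM2l // lerDl.
    - exact: le.
  by move=> x _; rewrite lee_fin.
by move=> x _; rewrite lee_fin sqr_ge0.
Qed.

Lemma L2_window_complex (f : full_shift -> R[i]) : square_integrable mu f ->
  forall e : R, 0 < e -> exists r (g : full_shift -> R[i]) (M : R),
  [/\ window r g, 0 <= M, forall x, nsq (g x) <= M &
    (\int[mu]_x (nsq (f x - g x))%:E <= e%:E)%E].
Proof.
move=> [[m1 m2] hf] e e0; have e2 : 0 < e / 2 by rewrite divr_gt0.
have i1 : (\int[mu]_x (complex.Re (f x) ^+ 2)%:E < +oo)%E.
  apply: le_lt_trans hf; apply: ge0_le_integral => //.
  - by move=> x _; rewrite lee_fin sqr_ge0.
  - by apply/measurable_EFinP; exact: measurable_funX.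
  - by apply/measurable_EFinP; apply: measurable_funD; exact: measurable_funX.
  - by move=> x _; rewrite lee_fin lerDl sqr_ge0.
have i2 : (\int[mu]_x (complex.Im (f x) ^+ 2)%:E < +oo)%E.
  apply: le_lt_trans hf; apply: ge0_le_integral => //.
  - by move=> x _; rewrite lee_fin sqr_ge0.
  - by apply/measurable_EFinP; exact: measurable_funX.
  - by apply/measurable_EFinP; apply: measurable_funD; exact: measurable_funX.
  - by move=> x _; rewrite lee_fin lerDr sqr_ge0.
have [r1 [g1 [M1 [w1 b1 l1]]]] := L2_window m1 i1 e2.
have [r2 [g2 [M2 [w2 b2 l2]]]] := L2_window m2 i2 e2.
exists (maxn r1 r2), (fun x => Complex (g1 x) (g2 x)), (M1 ^+ 2 + M2 ^+ 2); split.
- exact: (window_comp2 (fun a b => Complex a b) w1 w2).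
- by rewrite addr_ge0 ?sqr_ge0.
- move=> x; rewrite /nsq /= lerD //.
    rewrite -real_normK ?num_real // lerXn2r ?nnegrE //.
    exact: le_trans (b1 x).
  rewrite -real_normK ?num_real // lerXn2r ?nnegrE //.
  exact: le_trans (b2 x).
rewrite [e]splitr EFinD; apply: le_trans (leeD l1 l2).
have mg1 := window_measurable w1; have mg2 := window_measurable w2.
rewrite -ge0_integralD //; first last.
- by apply/measurable_EFinP; apply: measurable_funX; exact: measurable_funB.
- by move=> x _; rewrite lee_fin sqr_ge0.
- by apply/measurable_EFinP; apply: measurable_funX; exact: measurable_funB.
- by move=> x _; rewrite lee_fin sqr_ge0.
rewrite le_eqVlt; apply/orP; left; apply/eqP; apply: eq_integral => x _.
by rewrite -EFinD /nsq; case: (f x).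
Qed.
End L2Approximation.

(** * Parsing a window of a sequence into substituted words *)

Section Horner.
Context (F : comNzRingType).

Fixpoint peval (z : F) (s : seq F) : F :=
  if s is c :: s' then c + z * peval z s' else 0.

Lemma peval_cat z s t : peval z (s ++ t) = peval z s + z ^+ size s * peval z t.
Proof.
elim: s => [|c s IH] /=; first by rewrite add0r expr0 mul1r.
by rewrite IH exprS; ring.
Qed.

Lemma peval_nseq0 z n : peval z (nseq n 0) = 0.
Proof. by elim: n => [//|n IH] /=; rewrite IH mulr0 addr0. Qed.

Lemma peval_sum z s : peval z s = \sum_(i < size s) nth 0 s i * z ^+ i.
Proof.
elim: s => [|c s IH] /=; first by rewrite big_ord0.
rewrite big_ord_recl /= expr0 mulr1 IH mulr_sumr; congr (_ + _).
by apply: eq_bigr => i _; rewrite /bump /= ?add1n exprS; ring.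
Qed.
End Horner.

Section Blocks.
Context (R : realType) (L : nat) (G : seq letter -> R[i]).

(* The contribution of the windows of length [L] contained in [y]. *)
Fixpoint block (y : seq letter) : seq R[i] :=
  if y is a :: y' then (if (L <= size y)%N then G (take L y) else 0) :: block y'
  else [::].

Lemma size_block y : size (block y) = size y.
Proof. by elim: y => //= a y ->. Qed.

Fixpoint mismatch (ms : seq R[i]) (v : seq letter) : nat :=
  if ms is c :: ms' then ((c != G (take L v)) + mismatch ms' (behead v))%N else 0.

Lemma mismatch_le ms v : (mismatch ms v <= size ms)%N.
Proof.
by elim: ms v => [//|c ms IH] v /=; exact: (leq_add (leq_b1 _) (IH _)).
Qed.

Lemma mismatch_cat ms ns v :
  mismatch (ms ++ ns) v = (mismatch ms v + mismatch ns (drop (size ms) v))%N.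
Proof.
elim: ms v => [|c ms IH] v /=; first by rewrite drop0.
by rewrite IH addnA; case: v => [|a v] //=; rewrite !drop_oversize.
Qed.

(** Only the windows that leave [y] are wrong, and these start at its last positions, fewer than [L]
    of them when [L > 0]. *)
Lemma mismatch_block y t : (mismatch (block y) (y ++ t) <= L)%N.
Proof.
elim: y => [//|a y IH].
have [Ly|yL] := leqP L (size (a :: y)); last first.
  by apply: leq_trans (mismatch_le _ _) _; rewrite size_block; exact: ltnW.
rewrite [mismatch _ _]/= -[(size y).+1]/(size (a :: y)) Ly.
by rewrite -cat_cons takel_cat // eqxx.
Qed.

Lemma mismatch_blocks (s : letter -> seq letter) u t :
  (mismatch (flatten [seq block (s b) | b <- u]) (flatten (map s u) ++ t) <= L * size u)%N.
Proof.
elim: u => [//|b u IH] /=.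
rewrite mismatch_cat -catA size_block drop_size_cat // mulnS leq_add //.
exact: mismatch_block.
Qed.

Lemma mismatch_sum ms v : mismatch ms v =
  (\sum_(i < size ms) (nth 0%R ms i != G (take L (drop i v))))%N.
Proof.
elim: ms v => [|c ms IH] v /=; first by rewrite big_ord0.
rewrite big_ord_recl /= drop0 IH; congr (_ + _)%N.
by apply: eq_bigr => i _; rewrite /bump /= ?add1n; case: v => [|a v].
Qed.

Lemma size_blocks (s : letter -> seq letter) u :
  size (flatten [seq block (s b) | b <- u]) = size (flatten (map s u)).
Proof. by elim: u => [//|b u IH] /=; rewrite !size_cat IH size_block. Qed.

(** Link with the cocycle: positions weighted by powers of [z] become letters weighted by the phases
    of their images. *)
Lemma tsum_blocks z (s : letter -> seq letter) u :
  tsum (fun b => z ^+ size (s b)) (fun b => peval z (block (s b))) u =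
  peval z (flatten [seq block (s b) | b <- u]).
Proof. by elim: u => [//|b u IH] /=; rewrite peval_cat IH size_block. Qed.

Variable M : R.
Hypothesis M0 : 0 <= M.
Hypothesis GM : forall u, nsq (G u) <= M.

Lemma block_bound y c : c \in block y -> nsq c <= M.
Proof.
elim: y => [//|a y IH] /=; rewrite in_cons => /orP[/eqP ->|/IH //].
by case: ifP => _; rewrite ?GM // nsq0.
Qed.

End Blocks.

Lemma factor_at_cat x i m n :
  factor_at x i (m + n) = factor_at x i m ++ factor_at x (i + m%:Z) n.
Proof.
rewrite /factor_at iotaD map_cat; congr (_ ++ _).
rewrite -[(0 + m)%N]/(m) -[m in iota m _]addn0 iotaDl -map_comp; apply: eq_map => k /=.
by rewrite PoszD addrA.
Qed.

Lemma factor_at_sub x N n L : (n + L <= N)%N ->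
  take L (drop n (factor_at x 0 N)) = factor_at x n%:Z L.
Proof.
move=> h; rewrite -(subnKC h) -addnA factor_at_cat drop_size_cat ?size_factor_at //.
by rewrite add0r factor_at_cat take_size_cat // size_factor_at.
Qed.

Lemma sum_lt N L : (\sum_(n < N) (n < L) = minn N L)%N.
Proof.
elim: N => [|N IH]; first by rewrite big_ord0 min0n.
by rewrite big_ord_recr /= IH; case: ltnP => /=; lia.
Qed.

Lemma rev_lt N n L : (n < N)%N -> ((N < N - n.+1 + L)%N <= (n < L)%N)%N.
Proof.
move=> nN; have [_|Ln] := ltnP n L; first exact: leq_b1.
rewrite (_ : (N < _)%N = false) //; apply/negbTE; rewrite -leqNgt.
by rewrite -[leqRHS](subnK nN) leq_add2l leqW.
Qed.

Lemma len_mono zeta m n b : (m <= n)%N -> (len zeta m b <= len zeta n b)%N.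
Proof.
elim: n => [|n IH]; first by rewrite leqn0 => /eqP ->.
rewrite leq_eqVlt => /orP[/eqP -> //|/IH h]; apply: (leq_trans h).
rewrite /len iterS; move: (iter n _ _) => u.
rewrite /subst_word; elim: u => [//|a u IHu] /=; rewrite size_cat.
have : (0 < size (zeta a))%N by rewrite lt0n size_eq0 subst_neq0.
by move: IHu => /=; lia.
Qed.

(** Longer than either word [zeta^n(b)], so that a factor of this length can only occur in a high
    iterate, and still of the order of [theta^n]. *)
Definition window_length zeta n := (len zeta n l0 + len zeta n l1)%N.

Lemma len_lt_window zeta n b : (len zeta n b < window_length zeta n)%N.
Proof.
have := len_gt0 zeta n l0; have := len_gt0 zeta n l1; rewrite /window_length.
by elim/letter_case: b; lia.
Qed.

Section ParseEstimate.
Context (R : realType) (zeta : substitution) (theta c d : R).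
Hypothesis th1 : 1 < theta.
Hypothesis c0 : 0 < c.
Hypothesis len_bounds : forall n b, c * theta ^+ n <= (len zeta n b)%:R <= d * theta ^+ n.

Local Notation sub k := (iter k (subst_word zeta)).

Lemma size_sub_ge k u : (size u)%:R * (c * theta ^+ k) <= (size (sub k u))%:R :> R.
Proof.
rewrite size_iter natrD !natrM.
have -> : size u = (count_mem l0 u + count_mem l1 u)%N.
  elim: u => [//|b u IH] /=; rewrite IH; elim/letter_case: b => /=; rewrite /l0 /l1 /=; lia.
rewrite natrD mulrDl lerD // ler_wpM2l ?ler0n //.
  by have /andP[] := len_bounds k l0.
by have /andP[] := len_bounds k l1.
Qed.

(* The twisted sum over the windows of length [L] contained in [zeta^l(b)]. *)
Definition start (L : nat) (G : seq letter -> R[i]) l (x : R) (b : letter) : R[i] :=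
  peval (wave (- 1) x) (block L G (sub l [:: b])).

(** The first term is the cost of the incomplete ends in [subword_bound]; the second bounds the
    number of letters of [q], as the window has length at most [2 d theta^(l + k)]. *)
Definition main_const : R :=
  4 * (1 + (size (zeta l0) + size (zeta l1))).+1%:R + 2 * d / c ^+ 2.

(** The sequence [m] puts 0 for the windows across a border of the words [zeta^l(b)] and at all
    positions of the incomplete words at the ends. Its twisted sums are then orbits of the cocycle,
    bounded independently of [x], and it differs from [G] at few positions, each at a cost of at
    most [4 * M]. *)
Lemma parse_estimate (L : nat) (G : seq letter -> R[i]) (M : R) l k (x : int -> letter) :
  0 <= M -> (forall u, nsq (G u) <= M) -> subst_space zeta x ->
  exists m : nat -> R[i],
  (forall t, nsq (\sum_(n < window_length zeta (l + k)) m n * wave (- n%:Z) t) <=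
     (main_const * levels (vsum zeta (phases zeta l t) (start L G l t)) k) ^+ 2) /\
  \sum_(n < window_length zeta (l + k)) nsq (m n - G (factor_at x n%:Z L)) <=
    4 * M * ((2 * window_length zeta l + L)%:R +
      L%:R * (window_length zeta (l + k))%:R / (c * theta ^+ l)).
Proof.
move=> M0 GM xX; set N := window_length zeta (l + k).
have th0 : 0 < theta by exact: lt_trans th1.
have tp n : 0 < c * theta ^+ n by rewrite mulr_gt0 // exprn_gt0.
have [a [h inf]] := xX 0 N.
(* A lower iterate would be shorter than the window; this leaves room to write the iterate as the
   [l]-th image of a [k]-th image. *)
have hlk : (l + k <= h)%N.
  rewrite leqNgt; apply/negP => hl.
  have := size_infix inf; rewrite size_factor_at -/(len zeta h a) leqNgt.
  by rewrite (leq_ltn_trans (len_mono zeta a (ltnW hl)) (len_lt_window _ _ _)).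
have e1 : sub h [:: a] = flatten [seq sub l [:: b] | b <- sub k (sub (h - (l + k)) [:: a])].
  rewrite -iter_subst_flatten -!iterD; congr (iter _ _ _).
  by rewrite subnKC.
rewrite e1 in inf.
have [s [u [p [ev infu hs hp]]]] := infix_flatten inf.
have szl y : y = [::] \/ (exists b, infix y (sub l [:: b])) -> (size y <= window_length zeta l)%N.
  case=> [->//|[b /size_infix h2]].
  by apply: leq_trans h2 _; apply: ltnW; exact: len_lt_window.
have hs' := szl s hs; have hp' := szl p hp.
pose blk := flatten [seq block L G (sub l [:: b]) | b <- u].
pose ms := nseq (size s) 0 ++ blk ++ nseq (size p) 0.
have sms : size ms = N.
  rewrite /ms !size_cat !size_nseq size_blocks -(size_factor_at x 0 N) ev.
  by rewrite !size_cat.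
have su : (size u)%:R * (c * theta ^+ l) <= N%:R.
  apply: (le_trans (size_sub_ge l u)); rewrite ler_nat iter_subst_flatten.
  by rewrite -(size_factor_at x 0 N) ev !size_cat addnCA leq_addr.
have msM i : nsq (nth 0 ms i) <= M.
  have [im|im] := ltnP i (size ms); last by rewrite nth_default // nsq0.
  have := mem_nth 0 im; rewrite /ms !mem_cat => /or3P[|/flattenP[y /mapP[b _ ->]]|].
  - by rewrite mem_nseq => /andP[_ /eqP ->]; rewrite nsq0.
  - exact: block_bound.
  - by rewrite mem_nseq => /andP[_ /eqP ->]; rewrite nsq0.
exists (nth 0 ms); split.
  move=> t; set z := wave (- 1) t.
  have zn n : wave (- n%:Z) t = z ^+ n by rewrite /z -waveM mulN1r.
  have -> : \sum_(n < N) nth 0 ms n * wave (- n%:Z) t = peval z ms.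
    by rewrite peval_sum sms; apply: eq_bigr => i _; rewrite zn.
  rewrite /ms !peval_cat !peval_nseq0 mulr0 addr0 add0r nsqM nsqX ?nsq_wave // mul1r.
  set V := vsum _ _ _.
  have -> : peval z blk = tsum (phases zeta l t 0) (V 0%N) u.
    rewrite /blk -tsum_blocks; congr (tsum _ _ u).
    by apply/funext => b; rewrite /phases addn0 zn.
  rewrite -cmod_sqr.
  have wS j : phases zeta l t j.+1 = next_phase zeta (phases zeta l t j).
    by apply/funext => b; exact: phasesS.
  have VS j : V j.+1 = next_sum zeta (phases zeta l t j) (V j) by [].
  have [q [sq hq]] := subword_bound wS VS (phases_unit zeta l t) infu.
  have lv0 := levels_ge0 V k.
  have qle : (size q)%:R <= 2 * d / c ^+ 2.
    have h1 := size_sub_ge k q.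
    have h2 : (size (sub k q))%:R <= (size u)%:R :> R by rewrite ler_nat.
    have h3 : N%:R <= 2 * d * theta ^+ (l + k).
      rewrite /N /window_length natrD.
      have /andP[_ a1] := len_bounds (l + k) l0.
      have /andP[_ a2] := len_bounds (l + k) l1.
      lra.
    have h4 : (size q)%:R * (c * theta ^+ k) * (c * theta ^+ l) <= 2 * d * theta ^+ (l + k).
      apply: le_trans h3; apply: le_trans su; rewrite ler_wpM2r ?(ltW (tp l)) //.
      exact: le_trans h2.
    rewrite ler_pdivlMr ?exprn_gt0 //.
    have e2 : (size q)%:R * (c * theta ^+ k) * (c * theta ^+ l) =
      (size q)%:R * c ^+ 2 * theta ^+ (l + k) by rewrite exprD; ring.
    by rewrite e2 ler_pM2r ?exprn_gt0 in h4.
  have cm0 : 0 <= main_const * levels V k.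
    apply: le_trans (_ : cmod (tsum (phases zeta l t 0) (V 0%N) u) <= _).
      exact: cmod_ge0.
    apply: (le_trans hq); by rewrite ler_wpM2r // /main_const lerD2l.
  rewrite lerXn2r ?nnegrE ?cmod_ge0 //.
  apply: (le_trans hq); by rewrite ler_wpM2r // /main_const lerD2l.
have mb : (mismatch L G ms (factor_at x 0 N) <= 2 * window_length zeta l + L * size u)%N.
  rewrite ev /ms !mismatch_cat size_nseq drop_size_cat //.
  have h1 := mismatch_le L G (nseq (size s) 0) (s ++ flatten [seq sub l [:: b] | b <- u] ++ p).
  have h2 := mismatch_blocks L G (fun b => sub l [:: b]) u p.
  have h3 := mismatch_le L G (nseq (size p) 0)
    (drop (size blk) (flatten [seq sub l [:: b] | b <- u] ++ p)).
  rewrite !size_nseq in h1 h3; rewrite -/blk in h2.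
  rewrite addnCA [X in (_ <= X)%N]addnC; apply: leq_add => //.
  rewrite mul2n -addnn; apply: leq_add; [exact: leq_trans h1 hs'|exact: leq_trans h3 hp'] .
(* Near the end the window of length [L] leaves the factor of length [N]; these positions are
   counted by the second indicator. *)
apply: (@le_trans _ _ (\sum_(n < N) 4 * M * ((nth 0 ms n != G (take L (drop n (factor_at x 0 N))))%:R
    + ((N < n + L)%N)%:R))).
  apply: ler_sum => n _.
  have b4 : nsq (nth 0 ms n - G (factor_at x n%:Z L)) <= 4 * M.
    by have := nsqD_le (nth 0 ms n) (- G (factor_at x n%:Z L)); rewrite nsqN; have := msM n; have := GM (factor_at x n%:Z L); lra.
  have [nL|nL] := leqP (n + L) N; last first.
    apply: (le_trans b4); rewrite ler_peMr ?mulr_ge0 // lerDr; exact: ler0n.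
  rewrite factor_at_sub // addr0.
  have [->|ne] := eqVneq (nth 0 ms n) (G (factor_at x n%:Z L)).
    by rewrite subrr nsq0 mulr0.
  by rewrite mulr1.
rewrite -mulr_sumr ler_wpM2l ?mulr_ge0 // big_split /=.
have h1 : \sum_(n < N) ((nth 0 ms n != G (take L (drop n (factor_at x 0 N))))%:R : R) <=
    (2 * window_length zeta l + L * size u)%:R.
  rewrite -natr_sum ler_nat; apply: leq_trans mb; rewrite mismatch_sum sms.
  exact: leqnn.
have h2 : \sum_(n < N) (((N < n + L)%N)%:R : R) <= L%:R.
  rewrite -natr_sum ler_nat (reindex_inj rev_ord_inj) /=.
  apply: leq_trans (_ : \sum_(n < N) (n < L) <= _)%N; last by rewrite sum_lt geq_minr.
  by apply: leq_sum => n _; exact: rev_lt.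
have h3 : (L * size u)%:R <= L%:R * N%:R / (c * theta ^+ l).
  by rewrite natrM -mulrA ler_wpM2l ?ler0n // ler_pdivlMr.
apply: (le_trans (lerD h1 h2)); rewrite natrD [(_ + L)%:R]natrD addrAC.
by rewrite lerD2l.
Qed.
End ParseEstimate.

(** * Spectral measures *)

Section Spectral.
Context (R : realType) (mu : probability full_shift R).
Hypothesis inv : shift_invariant mu.
Variable f : full_shift -> R[i].
Hypothesis f2 : square_integrable mu f.

Lemma cmeasurable_shift k : cmeasurable (fun x => f (shift_pow k x)).
Proof. by have [h _] := f2; exact: (cmeasurable_comp (measurable_shift_pow k) h). Qed.

Lemma integrable_nsq_shift (n : nat) :
  mu.-integrable setT (EFin \o (fun x => nsq (f (shift_pow n%:Z x)))).
Proof.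
have mn : measurable_fun setT (fun x => nsq (f x)) by apply: measurable_nsq; have [] := f2.
apply/integrableP; split.
  by apply/measurable_EFinP; apply: measurable_nsq; exact: cmeasurable_shift.
under eq_integral => x _ do rewrite /= (ger0_norm (nsq_ge0 _)).
have := integral_shift inv n (f := fun x => (nsq (f x))%:E).
move=> -> //; last by move=> x; rewrite lee_fin nsq_ge0.
- by have [] := f2.
- exact/measurable_EFinP.
Qed.

Lemma cinner_shift_int (k : nat) :
  mu.-integrable setT (EFin \o (fun x => complex.Re (f (shift_pow k%:Z x) * conjc (f x)))) /\
  mu.-integrable setT (EFin \o (fun x => complex.Im (f (shift_pow k%:Z x) * conjc (f x)))).
Proof.
have hk := integrable_nsq_shift k.
have h0 := integrable_nsq_shift 0%N.
have e0 x : shift_pow (Posz 0%N) x = x by apply/funext => i; rewrite /shift_pow addr0.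
have hs := integrableD measurableT hk h0.
have cj : cmeasurable (fun x => conjc (f x)).
  have [[m1 m2] _] := f2; split.
    by rewrite (_ : (fun x => _) = fun x => complex.Re (f x)) //; apply/funext => x; case: (f x).
  rewrite (_ : (fun x => _) = fun x => - complex.Im (f x)); last by apply/funext => x; case: (f x).
  exact: (measurableT_comp (@oppr_measurable R setT) m2).
have [m1 m2] := cmeasurableM (cmeasurable_shift k%:Z) cj.
have b (a c : R[i]) : `|complex.Re (a * conjc c)| <= nsq a + nsq c /\
    `|complex.Im (a * conjc c)| <= nsq a + nsq c.
  case: a c => [a1 a2] [c1 c2]; rewrite /nsq /=; split; rewrite ler_norml;
    apply/andP; split.
  - by have := sqr_ge0 (a1 + c1); have := sqr_ge0 (a2 + c2); rewrite !sqrrD !expr2; nra.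
  - by have := sqr_ge0 (a1 - c1); have := sqr_ge0 (a2 - c2); nra.
  - by have := sqr_ge0 (a2 + c1); have := sqr_ge0 (a1 - c2); nra.
  - by have := sqr_ge0 (a2 - c1); have := sqr_ge0 (a1 + c2); nra.
split; apply: le_integrable hs => //=; try exact/measurable_EFinP.
- move=> x _; rewrite lee_fin e0 [leRHS]ger0_norm; last by rewrite addr_ge0 ?nsq_ge0.
  by have [] := b (f (shift_pow k x)) (f x).
- move=> x _; rewrite lee_fin e0 [leRHS]ger0_norm; last by rewrite addr_ge0 ?nsq_ge0.
  by have [] := b (f (shift_pow k x)) (f x).
Qed.

Variable sigma : {finite_measure set (measurableTypeR R) -> \bar R}.
Hypothesis spec : is_spectral_measure mu f sigma.

Lemma wave_abs_le (k : int) (x : R) : `|complex.Re (wave k x)| <= 1 /\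
  `|complex.Im (wave k x)| <= 1.
Proof.
have h := nsq_wave k x; rewrite /nsq in h; have := sqr_ge0 (complex.Re (wave k x)).
have := sqr_ge0 (complex.Im (wave k x)).
by move=> a b; split; rewrite -ler_sqr ?nnegrE // expr1n real_normK ?num_real //; lra.
Qed.

Lemma circle_measure_int (g : R -> R) : measurable_fun setT g -> (forall x, `|g x| <= 1) ->
  has_int sigma g (\int[sigma]_(x in `[0, 1[) g x).
Proof.
move=> mg g1; have [c0 _] := spec.
have gi : sigma.-integrable setT (EFin \o g).
  apply: (le_integrable measurableT) (finite_measure_integrable_cst sigma 1 measurableT).
    exact/measurable_EFinP.
  by move=> x _; rewrite /= lee_fin normr1.
split => //; rewrite /Rintegral (negligible_integral _ _ gi c0) //.
  by rewrite setTD setCK.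
by apply: measurableC; exact: measurable_itv.
Qed.

Lemma wave_spectral (k : int) :
  has_int sigma (fun t => complex.Re (wave k t)) (complex.Re (cinner mu (f \o shift_pow k) f)) /\
  has_int sigma (fun t => complex.Im (wave k t)) (complex.Im (cinner mu (f \o shift_pow k) f)).
Proof.
have [_ h] := spec; have [m1 m2] := cmeasurable_wave R k.
rewrite -h; split.
- exact: (circle_measure_int m1 (fun x => (wave_abs_le k x).1)).
- exact: (circle_measure_int m2 (fun x => (wave_abs_le k x).2)).
Qed.

Lemma correlation_int (i j : nat) s :
  has_int mu (fun x => complex.Re (f (shift_pow (i + s)%:Z x) * conjc (f (shift_pow (j + s)%:Z x))))
    (complex.Re (cinner mu (f \o shift_pow (i%:Z - j%:Z)) f)) /\
  has_int mu (fun x => complex.Im (f (shift_pow (i + s)%:Z x) * conjc (f (shift_pow (j + s)%:Z x))))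
    (complex.Im (cinner mu (f \o shift_pow (i%:Z - j%:Z)) f)).
Proof.
have up k m : has_int mu (fun x => complex.Re (f (shift_pow (m + k)%:Z x) * conjc (f (shift_pow m%:Z x))))
      (complex.Re (cinner mu (f \o shift_pow k%:Z) f)) /\
    has_int mu (fun x => complex.Im (f (shift_pow (m + k)%:Z x) * conjc (f (shift_pow m%:Z x))))
      (complex.Im (cinner mu (f \o shift_pow k%:Z) f)).
  have [h1 h2] := cinner_shift_int k.
  have e x : shift_pow (m + k)%:Z x = shift_pow k%:Z (shift_pow m%:Z x).
    by rewrite shift_powD addrC.
  split.
  - have := @has_int_shift _ mu inv m _ _ (conj h1 erefl).
    by congr has_int; apply/funext => x; rewrite e.
  - have := @has_int_shift _ mu inv m _ _ (conj h2 erefl).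
    by congr has_int; apply/funext => x; rewrite e.
have [ij|ji] := leqP j i.
  have := up (i - j)%N (j + s)%N.
  by rewrite addnAC subnKC // -subzn.
(* Only forward shifts have been treated. For [i < j] the correlation is the conjugate of the
   opposite one, which is read off from [sigma], where opposite waves are conjugate. *)
have := up (j - i)%N (i + s)%N.
rewrite addnAC subnKC ?(ltnW ji) // -subzn ?(ltnW ji) //.
have [[_ <-] [_ <-]] := wave_spectral (i%:Z - j%:Z).
have [[a1 <-] [a2 <-]] := wave_spectral (j%:Z - i%:Z).
move=> [h1 h2].
have eN x : wave (i%:Z - j%:Z) x = conjc (wave (j%:Z - i%:Z) x) :> R[i].
  by rewrite -waveN opprB.
split.
- have -> : (\int[sigma]_x complex.Re (wave (i%:Z - j%:Z) x) =
    \int[sigma]_x complex.Re (wave (j%:Z - i%:Z) x)).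
    by congr Rintegral; apply/funext => x; rewrite eN; case: (wave _ x).
  move: h1; congr has_int; apply/funext => x.
  by case: (f _) => ? ?; case: (f _) => ? ? /=; ring.
- have [_ e] := has_intZ (-1) (conj a2 erefl).
  have -> : (\int[sigma]_x complex.Im (wave (i%:Z - j%:Z) x) =
    - \int[sigma]_x complex.Im (wave (j%:Z - i%:Z) x)).
    rewrite -[RHS]mulN1r -e; congr Rintegral; apply/funext => x.
    by rewrite eN mulN1r; case: (wave _ x).
  have := has_intZ (-1) h2; rewrite mulN1r; congr has_int; apply/funext => x.
  by case: (f _) => ? ?; case: (f _) => ? ? /=; ring.
Qed.

(** Both sides are the same quadratic form in the correlations of [f]. Invariance leaves the offset
    [s] free; it will be the radius of the windows. *)
Lemma fejer_spectral N w s :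
  (\int[sigma]_t (fejer N w t)%:E)%E =
  (\int[mu]_x (nsq (\sum_(n < N) wave (- n%:Z) w * f (shift_pow (n + s)%:Z x)) / N%:R)%:E)%E.
Proof.
pose rho (i j : 'I_N) := complex.Re (cinner mu (f \o shift_pow (i%:Z - j%:Z)) f).
pose iot (i j : 'I_N) := complex.Im (cinner mu (f \o shift_pow (i%:Z - j%:Z)) f).
pose c (n : 'I_N) : R[i] := wave (- n%:Z) w.
have h1 := @has_int_nsq _ _ _ sigma N c (fun n t => wave n%:Z t) rho iot.
have h2 := @has_int_nsq _ _ _ mu N c (fun n x => f (shift_pow (n + s)%:Z x)) rho iot.
rewrite /fejer; under eq_integral do rewrite mulrC.
under [RHS]eq_integral do rewrite mulrC.
rewrite (has_int_EFin (has_intZ _ (h1 _ _))).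
- by rewrite (has_int_EFin (has_intZ _ (h2 _ _))) // => i j; have [] := correlation_int i j s.
- by move=> i j; have [h _] := wave_spectral (i%:Z - j%:Z); move: h; congr has_int;
    apply/funext => t; rewrite wave_conj.
- by move=> i j; have [_ h] := wave_spectral (i%:Z - j%:Z); move: h; congr has_int;
    apply/funext => t; rewrite wave_conj.
Qed.

End Spectral.

(** * Assembling the estimates *)

Section SmallInMeasure.
Context d (T : measurableType d) (R : realType) (nu : probability T R).

(** Convergence almost everywhere implies convergence in measure: truncation at [a] allows dominated
    convergence, and Markov's inequality concludes. *)
Lemma small_in_measure (Z : nat -> T -> R) (a e : R) k0 :
  (forall k, measurable_fun setT (Z k)) -> (forall k x, 0 <= Z k x) ->
  {ae nu, forall x, Z ^~ x @ \oo --> 0} -> 0 < a -> 0 < e ->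
  exists k, (k0 <= k)%N /\ (nu [set x | (a <= Z k x)%R] <= e%:E)%E.
Proof.
move=> mZ Z0 hZ a0 e0.
pose g k (x : T) := (Num.min a (Z (k + k0)%N x))%:E.
have mg k : measurable_fun setT (g k).
  by apply/measurable_EFinP; apply: measurable_minr => //; exact: measurable_cst.
have g0 k x : (0 <= g k x)%E by rewrite lee_fin le_min (ltW a0) Z0.
have [||||_ _ h] := @dominated_convergence _ _ _ nu setT measurableT g (cst 0%E) (cst a%:E) mg.
- exact: measurable_cst.
- case: hZ => N [mN N0 sN]; exists N; split => // x /= hx; apply: sN => /= hz; apply: hx => _.
  apply: cvg_EFin; first exact: nearW.
  apply: (@squeeze_cvgr _ _ _ _ (cst 0) (fun k => Z (k + k0)%N x)).
  + by apply: nearW => k; rewrite /g /= le_min (ltW a0) Z0 ge_min lexx orbT.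
  + exact: cvg_cst.
  + by rewrite (cvg_shiftn k0 (Z ^~ x)).
- exact: (finite_measure_integrable_cst nu).
- by apply: (aeW nu) => x n _; rewrite gee0_abs // lee_fin ge_min lexx.
rewrite integral0 in h.
have [n hn] := cvge0_small (mulr_gt0 e0 a0) h.
exists (n + k0)%N; split; first exact: leq_addl.
have := markov_set (mg n) (g0 n) a0 hn.
rewrite mulfK ?gt_eqF //; congr (nu _ <= _)%E.
by apply/seteqP; split => x /=; rewrite lee_fin le_min lexx.
Qed.

End SmallInMeasure.

Section GoodSet.
Context d d' (T : measurableType d) (U : measurableType d') (R : realType).
Context (mu : probability T R) (nu : probability U R).

(* Tonelli applied to the excess of [F] over [H]. *)
Lemma good_set (F : T -> U -> R) (H : U -> R) (K : T -> R) (X : set T) (a dl et : R) :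
  measurable_fun setT (fun p : T * U => F p.1 p.2) -> (forall x w, 0 <= F x w) ->
  measurable_fun setT H -> (forall w, 0 <= H w) ->
  measurable_fun setT K -> (forall x, 0 <= K x) ->
  measurable X -> mu X = 1%E ->
  (forall x, X x -> (\int[nu]_w (Num.max 0 (F x w - H w))%:E <= (K x)%:E)%E) ->
  (\int[mu]_x (K x)%:E <= dl%:E)%E ->
  0 < a -> (nu [set w | (a <= H w)%R] <= et%:E)%E ->
  exists A : set U, [/\ measurable A, (nu (~` A) <= (et + dl / a)%:E)%E &
    forall w, A w -> (\int[mu]_x (F x w)%:E <= (a + a)%:E)%E].
Proof.
move=> mF F0 mH H0 mK K0 mX X1 hX hK a0 hH.
pose E (p : T * U) := (Num.max 0 (F p.1 p.2 - H p.2))%:E.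
have mE : measurable_fun setT E.
  apply/measurable_EFinP; apply: measurable_maxr; first exact: measurable_cst.
  apply: measurable_funB => //; exact: (measurableT_comp mH (@measurable_snd _ _ _ _)).
have E0 p : (0 <= E p)%E by rewrite lee_fin le_max lexx.
pose u w := (\int[mu]_x E (x, w))%E.
have mu_ : measurable_fun setT u := measurable_fun_fubini_tonelli_G (m1 := mu) E mE E0.
have u0 w : (0 <= u w)%E by apply: integral_ge0.
have hu : (\int[nu]_w u w <= dl%:E)%E.
  rewrite /u -(fubini_tonelli (m1 := mu) (m2 := nu) E mE E0); apply: le_trans hK.
  apply: ae_ge0_le_integral => //.
  - by move=> x _; apply: integral_ge0.
  - exact: (measurable_fun_fubini_tonelli_F (m2 := nu) E mE E0).
  - by move=> x _; rewrite lee_fin.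
  - exact/measurable_EFinP.
  - exists (~` X); split; first exact: measurableC.
      by have := probability_setC mu mX; rewrite X1 subee.
    by move=> x; apply: contra_not => Xx _; exact: hX.
have mark := markov_set mu_ u0 a0 hu.
have mB1 : measurable [set w | (a%:E <= u w)%E].
  by rewrite -[X in measurable X]setTI; apply: emeasurable_fun_c_infty.
have mB2 : measurable [set w | (a <= H w)%R].
  by rewrite -[X in measurable X]setTI; apply: measurable_fun_le => //; exact: measurable_cst.
exists (~` ([set w | (a <= H w)%R] `|` [set w | (a%:E <= u w)%E])); split.
- by apply: measurableC; exact: measurableU.
- rewrite setCK EFinD; apply: le_trans (leeD hH mark).
  exact: measureU2.
move=> w /not_orP[/negP h1 /negP h2]; rewrite -ltNge in h1; rewrite -ltNge in h2.
apply: (@le_trans _ _ (\int[mu]_x (E (x, w) + (H w)%:E))%E).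
  apply: ge0_le_integral => //.
  - by move=> x _; rewrite lee_fin.
  - apply/measurable_EFinP; exact: (measurableT_comp mF (measurable_pair2 w)).
  - apply: emeasurable_funD; last exact: measurable_cst.
    exact: (measurableT_comp mE (measurable_pair2 w)).
  - by move=> x _; rewrite -EFinD lee_fin /= -lerBlDr le_max lexx orbT.
rewrite ge0_integralD //; first last.
- by move=> x _; rewrite lee_fin.
- exact: (measurableT_comp mE (measurable_pair2 w)).
rewrite (integral_cst mu measurableT).
have -> : ((mu : {measure set T -> \bar R}) setT = 1)%E by exact: probability_setT.
rewrite mule1 EFinD; apply: leeD; first exact: ltW.
by rewrite lee_fin ltW.
Qed.

End GoodSet.

Section MeasurableLevels.
Context (R : realType) (zeta : substitution).
Local Notation TR := (measurableTypeR R).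

Lemma cmeasurable_peval (s : seq R[i]) : cmeasurable (fun w : TR => peval (wave (- 1) w) s).
Proof.
elim: s => [|c s IH] /=; first exact: cmeasurable_cst.
apply: cmeasurableD; first exact: cmeasurable_cst.
by apply: cmeasurableM => //; exact: cmeasurable_wave.
Qed.

Lemma cmeasurable_tsum (P V : TR -> letter -> R[i]) u :
  (forall b, cmeasurable (P ^~ b)) -> (forall b, cmeasurable (V ^~ b)) ->
  cmeasurable (fun w => tsum (P w) (V w) u).
Proof.
move=> hP hV; elim: u => [|b u IH] /=; first exact: cmeasurable_cst.
by apply: cmeasurableD => //; exact: cmeasurableM.
Qed.

Lemma measurable_levels l (V0 : TR -> letter -> R[i]) k :
  (forall b, cmeasurable (V0 ^~ b)) ->
  measurable_fun setT (fun w : TR => levels (vsum zeta (phases zeta l w) (V0 w)) k).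
Proof.
move=> h0.
have hv j b : cmeasurable (fun w : TR => vsum zeta (phases zeta l w) (V0 w) j b).
  elim: j b => [|j IH] b /=; first exact: h0.
  by apply: cmeasurable_tsum => // c; exact: cmeasurable_wave.
have hm j b : measurable_fun setT (fun w : TR => cmod (vsum zeta (phases zeta l w) (V0 w) j b)).
  apply: (@measurableT_comp _ _ _ TR TR TR (@Num.sqrt R)); last exact: measurable_nsq.
  exact: (@continuous_measurable_fun R _ (@sqrt_continuous R)).
apply: measurable_sum => j; exact: measurable_funD.
Qed.
End MeasurableLevels.

Lemma factor_at_shift (m i : int) n x : factor_at (shift_pow m x) i n = factor_at x (i + m) n.
Proof. by apply: eq_map => k; rewrite /shift_pow addrAC. Qed.

Lemma power_large (R : realType) (t K : R) : 1 < t -> exists n, forall k, (n <= k)%N -> K <= t ^+ k.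
Proof.
move=> t1; have t0 : 0 < t - 1 by rewrite subr_gt0.
have b n : n%:R * (t - 1) <= t ^+ n.
  elim: n => [|n IH]; first by rewrite mul0r expr0.
  have h : 1 <= t ^+ n by rewrite exprn_ege1 // ltW.
  have : t - 1 <= t ^+ n * (t - 1) by rewrite ler_peMl // ltW.
  by rewrite -[n.+1%:R]natr1 exprS; move: IH; lra.
exists (Num.bound `|K / (t - 1)|) => k hk; apply: le_trans (b k).
rewrite -ler_pdivrMr //; apply: (le_trans (ler_norm _)).
have h := archi_boundP (normr_ge0 (K / (t - 1))).
by apply: (le_trans (ltW h)); rewrite ler_nat.
Qed.

Lemma cmeasurableB d (T : measurableType d) (R : realType) (f g : T -> R[i]) :
  cmeasurable f -> cmeasurable g -> cmeasurable (fun x => f x - g x).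
Proof.
move=> hf hg; rewrite (_ : (fun x => _) = fun x => f x + (fun=> -1) x * g x).
  by apply: cmeasurableD => //; apply: cmeasurableM => //; exact: cmeasurable_cst.
by apply/funext => x; rewrite mulN1r.
Qed.

Section Excess.
Context (R : realType).
Local Notation nu := (@circle_prob R).

(** Split [F] into [m], whose twisted sums are controlled by [H] at every frequency, and [F - m],
    whose twisted sums are controlled in mean by Parseval. Subtracting [2 * H / N] leaves only the
    second part. *)
Lemma excess_bound N (F G m : nat -> R[i]) (H : R -> R) (Q : R) : (0 < N)%N ->
  measurable_fun setT H ->
  (forall t, nsq (\sum_(n < N) m n * wave (- n%:Z) t) <= H t) ->
  \sum_(n < N) nsq (m n - G n) <= Q ->
  (\int[nu]_w (Num.max 0 (nsq (\sum_(n < N) wave (- n%:Z) w * F n) / N%:R -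
      2 * H w / N%:R))%:E <=
   (4 / N%:R * \sum_(n < N) nsq (F n - G n) + 4 * Q / N%:R)%:E)%E.
Proof.
move=> N0 mH hm hQ.
have N1 : 0 < N%:R :> R by rewrite ltr0n.
have inj : injective (fun n : 'I_N => - (n : nat)%:Z) by move=> i j /oppr_inj[/val_inj].
have hp := has_intZ (2 / N%:R) (parseval_inj (fun n : 'I_N => F n - m n) inj).
have mS (c : 'I_N -> R[i]) := measurable_nsq_wave (fun n : 'I_N => - (n : nat)%:Z) c.
have e1 w : \sum_(n < N) wave (- n%:Z) w * F n = \sum_(n < N) F n * wave (- n%:Z) w.
  by apply: eq_bigr => n _; rewrite mulrC.
apply: (@le_trans _ _ (\int[nu]_w (2 / N%:R * nsq (\sum_(n < N) (F n - m n) * wave (- n%:Z) w))%:E)%E).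
  apply: ge0_le_integral => //.
  - by move=> w _; rewrite lee_fin le_max lexx.
  - apply/measurable_EFinP; apply: measurable_maxr; first exact: measurable_cst.
    apply: measurable_funB.
      under eq_fun do rewrite e1.
      by apply: measurable_funM; [exact: mS|exact: measurable_cst].
    apply: measurable_funM; last exact: measurable_cst.
    by apply: measurable_funM => //; exact: measurable_cst.
  - apply/measurable_EFinP; apply: measurable_funM; [exact: measurable_cst|exact: mS].
  - move=> w _; rewrite lee_fin ge_max; apply/andP; split.
      by rewrite mulr_ge0 ?nsq_ge0 // divr_ge0.
    rewrite -mulrBl mulrAC ler_pM2r ?invr_gt0 // lerBlDr e1.
    have -> : \sum_(n < N) F n * wave (- n%:Z) w =
        \sum_(n < N) (F n - m n) * wave (- n%:Z) w + \sum_(n < N) m n * wave (- n%:Z) w.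
      by rewrite -big_split; apply: eq_bigr => n _ /=; rewrite -mulrDl subrK.
    by apply: (le_trans (nsqD_le _ _)); rewrite lerD2l ler_pM2l //; exact: hm.
rewrite (has_int_EFin hp) lee_fin.
have h : \sum_(n < N) nsq (F n - m n) <= 2 * \sum_(n < N) nsq (F n - G n) + 2 * Q.
  apply: (@le_trans _ _ (\sum_(n < N) (2 * nsq (F n - G n) + 2 * nsq (m n - G n)))).
    apply: ler_sum => n _.
    have := nsqD_le (F n - G n) (G n - m n).
    by rewrite addrA subrK -[nsq (G n - m n)]nsqN opprB.
  by rewrite big_split /= -!mulr_sumr lerD2l ler_pM2l.
rewrite mulrAC [4 / _ * _]mulrAC -mulrDl ler_pM2r ?invr_gt0 //; move: h; lra.
Qed.

End Excess.

Section Main.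
Context (R : realType) (zeta : substitution) (theta : R) (mu : probability full_shift R).
Hypothesis pf : perron_frobenius_eigenvalue (subst_matrix zeta) theta.
Hypothesis irr : irreducible_over_rat (subst_matrix zeta)^T.
Hypothesis inv : shift_invariant mu.
Hypothesis supp : mu (subst_space zeta) = 1%E.
Hypothesis cond : large_min_condition zeta theta \/ zero_entry_condition zeta \/
    block_condition zeta theta.
Variable f : full_shift -> R[i].
Hypothesis f2 : square_integrable mu f.
Variable sigma : {finite_measure set (measurableTypeR R) -> \bar R}.
Hypothesis spec : is_spectral_measure mu f sigma.
Local Notation nu := (@circle_prob R).
Local Notation TR := (measurableTypeR R).

Let th1 : 1 < theta. Proof. by have [] := conditions_mahler pf cond. Qed.

Lemma len_growth_uniform : exists c d : R, 0 < c /\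
  forall n b, c * theta ^+ n <= (len zeta n b)%:R <= d * theta ^+ n.
Proof.
have g := len_growth (char_irreducible irr) th1 (perron_root pf) (perron_second irr pf).
have [c [d [c0 h]]] := g l0; have [c' [d' [c'0 h']]] := g l1.
exists (Num.min c c'), (Num.max d d'); split; first by rewrite lt_min c0.
have tp n : 0 < theta ^+ n by rewrite exprn_gt0 // (lt_trans _ th1).
move=> n b; elim/letter_case: b.
- have /andP[h1 h2] := h n; apply/andP; split.
    by apply: le_trans h1; rewrite ler_pM2r // ge_min lexx.
  by apply: (le_trans h2); rewrite ler_pM2r // le_max lexx.
- have /andP[h1 h2] := h' n; apply/andP; split.
    by apply: le_trans h1; rewrite ler_pM2r // ge_min lexx orbT.
  by apply: (le_trans h2); rewrite ler_pM2r // le_max lexx orbT.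
Qed.

Lemma approximation_mean (g : full_shift -> R[i]) r N (eg q : R) : (0 < N)%N -> cmeasurable g ->
  (\int[mu]_x (nsq (f x - g x))%:E <= eg%:E)%E ->
  (\int[mu]_x (4 / N%:R * \sum_(n < N) nsq (f (shift_pow (n + r)%:Z x) - g (shift_pow (n + r)%:Z x)) + q)%:E
    <= (4 * eg + q)%:E)%E.
Proof.
move=> N0 mg hg; have [mf _] := f2.
have mfg : measurable_fun setT (fun x => nsq (f x - g x)).
  by apply: measurable_nsq; exact: cmeasurableB.
have hi : has_int mu (fun x => nsq (f x - g x)) (\int[mu]_x nsq (f x - g x)).
  split => //; apply/integrableP; split; first exact/measurable_EFinP.
  under eq_integral => x _ do rewrite /= (ger0_norm (nsq_ge0 _)).
  exact: le_lt_trans hg (ltry _).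
have vle : \int[mu]_x nsq (f x - g x) <= eg.
  by rewrite -lee_fin -(has_int_EFin hi).
have hc : has_int mu (fun=> q) q.
  split; first exact: (finite_measure_integrable_cst mu).
  by rewrite Rintegral_cst //= probability_setT mulr1.
have h := has_intD (has_intZ (4 / N%:R)
  (has_int_sum (index_enum 'I_N) (fun n => has_int_shift inv (n + r) hi))) hc.
rewrite (has_int_EFin h) lee_fin lerD2r sumr_const card_ord.
set v := Rintegral _ _ _ in vle *; rewrite -[v *+ N]mulr_natr mulrCA divfK.
  by rewrite mulrC ler_pM2l.
by rewrite pnatr_eq0 -lt0n.
Qed.

Lemma separated (e : R) : 0 < e -> exists B : set TR, [/\ measurable B,
  (nu (~` B) <= e%:E)%E & (sigma B <= e%:E)%E].
Proof.
move=> e0.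
(* Since [almost_separated] doubles its error, both [a + dl / a] and [a + a] are made equal to
   [e / 2]. *)
pose a := e / 4; have a0 : 0 < a by rewrite divr_gt0.
pose dl := a ^+ 2; have dl0 : 0 < dl by rewrite exprn_gt0.
(* Half of [dl] goes to the error of [g], multiplied by 4 in [approximation_mean], and half to
   [4 * Q / N]. *)
have dl8 : 0 < dl / 8 by rewrite divr_gt0.
have [r [g [M [wg M0 gM hg]]]] := L2_window_complex f2 dl8.
have mg : cmeasurable g.
  split; exact: (window_measurable (window_comp _ wg)).
pose L := (r + r).+1; pose G u := g (word_ext r u).
have GM u : nsq (G u) <= M by exact: gM.
(* Shifting by [r] makes the window centred at [n + r] start at [n]. *)
have gG x n : g (shift_pow (n + r)%:Z x) = G (factor_at x n%:Z L).
  by rewrite (window_word _ wg) factor_at_shift PoszD addrCA addNr addr0.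
have [c [d [c0 hlen]]] := len_growth_uniform.
have tp n : 0 < theta ^+ n by rewrite exprn_gt0 // (lt_trans _ th1).
(* This [l] makes the windows across borders rare. Only then is the length [W] of the incomplete
   ends known, and [k0] makes it small compared with [N]. *)
have [l hl] := power_large (64 * M * L%:R / (c * dl)) th1.
have {}hl := hl l (leqnn _).
pose W := window_length zeta l.
have [k0 hk0] := power_large (64 * M * (2 * W + L)%:R / (c * dl)) th1.
pose C := main_const zeta c d.
pose V0 (w : TR) := start zeta L G l w.
pose lev k (w : TR) := levels (vsum zeta (phases zeta l w) (V0 w)) k.
have mlev k : measurable_fun setT (lev k).
  by apply: measurable_levels => b; exact: cmeasurable_peval.
(* As [N >= c theta^k], the bound [Hf] is at most [D] times the normalized square of [lev]; the 1
   makes [D] positive. *)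
pose D := 2 * C ^+ 2 / c + 1.
have D0 : 0 < D by rewrite ltr_wpDl // divr_ge0 ?(ltW c0) // mulr_ge0 ?sqr_ge0.
have [|||||k [kk0 hk]] := @small_in_measure _ _ _ nu (fun k w => lev k w ^+ 2 / theta ^+ k) (a / D) a k0.
- by move=> k; apply: measurable_funM; [exact: measurable_funX|exact: measurable_cst].
- by move=> k w; rewrite divr_ge0 ?sqr_ge0 // ltW.
- exact: (ae_levels irr pf th1 cond l V0).
- exact: divr_gt0.
- exact: a0.
pose N := window_length zeta (l + k).
have N0 : (0 < N)%N by rewrite (leq_ltn_trans _ (len_lt_window zeta (l + k) l0)).
have N1 : 0 < N%:R :> R by rewrite ltr0n.
have Nk : c * theta ^+ k <= N%:R.
  apply: (@le_trans _ _ (len zeta (l + k) l0)%:R).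
    have /andP[h _] := hlen (l + k)%N l0; apply: le_trans h.
    by rewrite ler_pM2l // exprD ler_peMl ?(ltW (tp k)) // exprn_ege1 // ltW.
  by rewrite ler_nat ltnW // len_lt_window.
pose Hf (w : TR) := 2 * (C * lev k w) ^+ 2 / N%:R.
pose Ff (x : full_shift) (w : TR) :=
  nsq (\sum_(n < N) wave (- n%:Z) w * f (shift_pow (n + r)%:Z x)) / N%:R.
pose Q := 4 * M * ((2 * W + L)%:R + L%:R * N%:R / (c * theta ^+ l)).
pose Kf x := 4 / N%:R * \sum_(n < N) nsq (f (shift_pow (n + r)%:Z x) - g (shift_pow (n + r)%:Z x)) +
  4 * Q / N%:R.
have Q0 : 0 <= Q.
  by rewrite mulr_ge0 ?mulr_ge0 // addr_ge0 // divr_ge0 ?mulr_ge0 // ltW // mulr_gt0.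
have cmfg : cmeasurable (fun x => f x - g x).
  have [mf _] := f2; exact: cmeasurableB.
have mH : measurable_fun setT Hf.
  apply: measurable_funM; last exact: measurable_cst.
  apply: measurable_funM; first exact: measurable_cst.
  by apply: measurable_funX; apply: measurable_funM => //; exact: measurable_cst.
have qle : 4 * Q / N%:R <= dl / 2.
  have cd0 : 0 < c * dl by rewrite mulr_gt0.
  have hN : 16 * M * (2 * W + L)%:R / N%:R <= dl / 4.
    rewrite ler_pdivrMr //; have := le_trans (hk0 k kk0) (lexx _).
    rewrite ler_pdivrMr // => h; have := ler_wpM2r (ltW dl0) Nk.
    move: h; rewrite [theta ^+ k * _]mulrA [theta ^+ k * c]mulrC; lra.
  have hL : 16 * M * L%:R / (c * theta ^+ l) <= dl / 4.
    rewrite ler_pdivrMr; last by rewrite mulr_gt0.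
    move: hl; rewrite ler_pdivrMr // [theta ^+ l * _]mulrA [theta ^+ l * c]mulrC; lra.
  have -> : 4 * Q / N%:R = 16 * M * (2 * W + L)%:R / N%:R + 16 * M * L%:R / (c * theta ^+ l).
    have Nn : N%:R != 0 :> R by rewrite gt_eqF.
    have cn : c != 0 by rewrite gt_eqF.
    have tn : theta ^+ l != 0 by rewrite gt_eqF.
    by rewrite /Q; field; rewrite Nn cn tn.
  by move: hN hL; lra.
have cF n : cmeasurable (fun p : full_shift * TR => f (shift_pow (n + r)%:Z p.1)).
  exact: (cmeasurable_comp (@measurable_fst _ _ _ _) (cmeasurable_shift f2 _)).
have mF : measurable_fun setT (fun p : full_shift * TR => Ff p.1 p.2).
  apply: measurable_funM; last exact: measurable_cst.
  apply: measurable_nsq; apply: cmeasurable_sum => n; apply: cmeasurableM => //.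
  exact: (cmeasurable_comp (@measurable_snd _ _ _ _) (cmeasurable_wave R _)).
have F0 x w : 0 <= Ff x w by rewrite divr_ge0 ?nsq_ge0.
have H0 w : 0 <= Hf w by rewrite divr_ge0 // mulr_ge0 // sqr_ge0.
have mK : measurable_fun setT Kf.
  apply: measurable_funD; last exact: measurable_cst.
  apply: measurable_funM; first exact: measurable_cst.
  apply: measurable_sum => n; apply: measurable_nsq.
  exact: (cmeasurable_comp (measurable_shift_pow _) cmfg).
have K0 x : 0 <= Kf x.
  apply: addr_ge0; last by rewrite divr_ge0 // mulr_ge0 // Q0.
  apply: mulr_ge0; first by rewrite divr_ge0.
  by apply: sumr_ge0 => n _; exact: nsq_ge0.
have hX : forall x, subst_space zeta x ->
    (\int[nu]_w (Num.max 0 (Ff x w - Hf w))%:E <= (Kf x)%:E)%E.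
  move=> x xX; have [m [m1 m2]] := parse_estimate th1 c0 hlen L l k M0 GM xX.
  have mHH : measurable_fun setT (fun w => (C * lev k w) ^+ 2).
    by apply: measurable_funX; apply: measurable_funM => //; exact: measurable_cst.
  have -> : Kf x = 4 / N%:R * \sum_(n < N)
      nsq (f (shift_pow (n + r)%:Z x) - G (factor_at x n%:Z L)) + 4 * Q / N%:R.
    by congr (_ * _ + _); apply: eq_bigr => n _; rewrite gG.
  exact: (@excess_bound R N (fun n => f (shift_pow (n + r)%:Z x))
    (fun n => G (factor_at x n%:Z L)) m (fun w => (C * lev k w) ^+ 2) Q N0 mHH m1 m2).
have hK : (\int[mu]_x (Kf x)%:E <= dl%:E)%E.
  apply: (le_trans (approximation_mean r (4 * Q / N%:R) N0 mg hg)).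
  by rewrite lee_fin; move: qle; lra.
have hH : (nu [set w | (a <= Hf w)%R] <= a%:E)%E.
  apply: le_trans hk; apply: le_measure; rewrite ?inE.
  - by rewrite -[X in measurable X]setTI; apply: measurable_fun_le => //; exact: measurable_cst.
  - rewrite -[X in measurable X]setTI; apply: measurable_fun_le => //.
    by apply: measurable_funM; [exact: measurable_funX|exact: measurable_cst].
  - move=> w /= aw; rewrite ler_pdivrMr //; apply: (le_trans aw).
    have -> : Hf w = 2 * C ^+ 2 * lev k w ^+ 2 / N%:R by rewrite /Hf exprMn mulrA.
    apply: (@le_trans _ _ (2 * C ^+ 2 * lev k w ^+ 2 / (c * theta ^+ k))).
      have hC : 0 <= 2 * C ^+ 2 * lev k w ^+ 2 by do 2 (apply: mulr_ge0; last exact: sqr_ge0).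
      apply: (ler_wpM2l hC).
      by rewrite lef_pV2 // posrE // mulr_gt0.
    have -> : 2 * C ^+ 2 * lev k w ^+ 2 / (c * theta ^+ k) =
        lev k w ^+ 2 / theta ^+ k * (2 * C ^+ 2 / c).
      by rewrite invfM; ring.
    by rewrite ler_wpM2l ?lerDl // divr_ge0 ?sqr_ge0 // ltW.
have [A [mA nA hA]] := good_set mF F0 mH H0 mK K0 (measurable_subst_space zeta) supp hX hK a0 hH.
have e1 : a + dl / a = e / 2 by rewrite /dl expr2 mulfK ?gt_eqF // /a; lra.
have e2 : a + a = e / 2 by rewrite /a; lra.
have e3 : 0 <= e / 2 by rewrite divr_ge0 // ltW.
rewrite e1 in nA; rewrite e2 in hA.
have hA' w : A w -> (\int[sigma]_t (fejer N w t)%:E <= (e / 2)%:E)%E.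
  by move=> /hA; rewrite (fejer_spectral inv f2 spec N w r).
have [B [mB h1 h2]] := almost_separated mA N0 e3 nA hA'.
rewrite mulrC divfK // in h1 h2.
by exists B.
Qed.
End Main.

Theorem proposition3p5 (R : realType) (zeta : substitution) (theta : R)
    (mu : probability full_shift R) :
  primitive_subst zeta ->
  non_periodic zeta ->
  perron_frobenius_eigenvalue (subst_matrix zeta) theta ->
  irreducible_over_rat (subst_matrix zeta)^T ->
  invariant_probability zeta mu ->
  large_min_condition zeta theta \/ zero_entry_condition zeta \/
    block_condition zeta theta ->
  pure_singular_spectrum mu.
Proof.
move=> _ _ pf irr [supp inv] cond f f2 sigma spec.
have [B [mB nB sB]] :=
  singular_from_separated (separated pf irr inv supp cond f2 spec).
have [s0 _] := spec.
have mI : measurable (~` `[0, 1[%classic : set (measurableTypeR R)).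
  by apply: measurableC; exact: measurable_itv.
(* The set [B] separates only inside the unit interval. The rest of the line is [sigma]-null and is
   added, so that the complement lies in [[0, 1[]. *)
exists (B `|` ~` `[0, 1[%classic); split; first exact: measurableU.
  apply/eqP; rewrite -measure_le0; apply: (le_trans (measureU2 sigma mB mI)).
  by rewrite le_eqVlt; apply/orP; left; apply/eqP; rewrite -[RHS](adde0 0%E); congr (_ + _)%E.
apply/eqP; rewrite -measure_le0 -nB circle_prob_null; last exact: measurableC.
have mI' : measurable (`[0, 1]%classic : set (measurableTypeR R)) by exact: measurable_itv.
apply: le_measure; rewrite ?inE.
- by apply: measurableC; exact: measurableU.
- by apply: measurableI => //; exact: measurableC.
rewrite setCU setCK; apply: setIS => x /=; rewrite !in_itv /= => /andP[-> /ltW].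
by [].
Qed.
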